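(* There is an integer $i_0$ such that the following are equivalent: (a) $[\omega]_{-a}R$ is a faithful $R$-module; (b) $J^{i}:\mathfrak m^{a+d}=\mathfrak m^{i}$ for every $i$; (c) $J^{i}:\mathfrak m^{a+d}=\mathfrak m^{i}$ for some $i\ge i_0$ (i.e. for some $i\gg 0$). Moreover, if $R$ is reduced and $i\ge a+d$ is an integer such that $J^{i}\omega:_\omega\mathfrak m^{a+d}=(J^{i}:_R\mathfrak m^{a+d})\,\omega$, then conditions (a), (b) and (c) are equivalent to: (d) $J^{i}:\mathfrak m^{a+d}=\mathfrak m^{i}$ (for this $i$).
   Context: $k$ is a field and $R$ is a standard graded Cohen-Macaulay $k$-algebra (so $[R]_0=k$ and $R$ is generated over $k$ by finitely many elements of degree $1$) of dimension $d\ge 1$, with homogeneous maximal ideal $\mathfrak m$ and graded canonical module $\omega=\omega_R$, normalized as usual (if $R=S/I$ with $S=k[X_1,\dots,X_n]$ a standard graded polynomial ring and $I$ a homogeneous ideal of height $g$, then $\omega_R\cong \mathrm{Ext}^g_S(R,S(-n))$). For a graded module $M$, $[M]_i$ is the degree $i$ component and $[M]_tR$ is the submodule generated by $[M]_t$. The $a$-invariant is $a=a(R)=-\min\{i : [\omega]_i\ne 0\}$. The ideal $J=(y_1,\dots,y_d)$ is generated by a system of parameters $y_1,\dots,y_d$ of $R$ consisting of linear forms. Convention: powers of ideals with non-positive exponent are the unit ideal. Colons without subscript are taken in $R$; for a submodule $N\subset\omega$ and an ideal $A$ of $R$, $N:_\omega A=\{x\in\omega : Ax\subset N\}$. *)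

(* Defs.v *)
From HB Require Import structures.
From mathcomp Require Import all_boot all_order all_algebra.
From mathcomp Require Import mpoly.
From mathcomp Require Import boolp classical_sets.
Set Implicit Arguments.
Unset Strict Implicit.
Unset Printing Implicit Defensive.
Import Order.TTheory GRing.Theory Num.Theory.
Local Open Scope classical_set_scope.
Local Open Scope ring_scope.

(** * Submodules, ideals, products and colons *)

(* An ideal of [R] is a submodule of the regular module [R^o], so that the
   operations below serve both for ideals of [R] and for submodules of an
   [R]-module. *)

Definition is_submod (R : comNzRingType) (M : lmodType R) (N : set M) : Prop :=
  submod_closed [pred x in N].

Definition submod_gen (R : comNzRingType) (M : lmodType R) (A : set M) : set M :=
  smallest (@is_submod R M) A.

Definition submod_mul (R : comNzRingType) (M : lmodType R)
    (I : set R) (N : set M) : set M :=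
  submod_gen [set u | exists r x, [/\ I r, N x & u = r *: x]].

Definition submod_colon (R : comNzRingType) (M : lmodType R)
    (N : set M) (A : set R) : set M :=
  [set x | forall r, A r -> N (r *: x)].

Definition faithful (R : comNzRingType) (M : lmodType R) (N : set M) : Prop :=
  forall r : R, (forall x, N x -> r *: x = 0) -> r = 0.

Definition ideal_gen (R : comNzRingType) (A : set R) : set R :=
  @submod_gen R R^o A.

Definition ideal_mul (R : comNzRingType) (I J : set R) : set R :=
  @submod_mul R R^o I J.

Definition ideal_colon (R : comNzRingType) (I A : set R) : set R :=
  @submod_colon R R^o I A.

Definition ideal_pow (R : comNzRingType) (I : set R) (i : int) : set R :=
  if i is Posz n then iter n (ideal_mul I) setT else setT.

Definition radical (R : comNzRingType) (I : set R) : set R :=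
  [set x | exists n, I (x ^+ n)].

Definition reduced (R : comNzRingType) : Prop :=
  forall (x : R) (n : nat), x ^+ n = 0 -> x = 0.

(** * Prime ideals, dimension, height, Cohen-Macaulay rings *)

(* [idealr_closed] is the library's notion of a proper ideal. *)
Definition prime_ideal (R : comNzRingType) (P : set R) : Prop :=
  idealr_closed [pred x in P] /\ prime_idealr_closed [pred x in P].

Definition maximal_ideal (R : comNzRingType) (P : set R) : Prop :=
  idealr_closed [pred x in P] /\
  forall Q : set R, idealr_closed [pred x in Q] -> P `<=` Q -> Q `<=` P.

Definition prime_chain (R : comNzRingType) (h : nat) (P : nat -> set R) : Prop :=
  (forall i, (i <= h)%N -> prime_ideal (P i)) /\
  (forall i, (i < h)%N -> P i `<` P i.+1).

Definition krull_dim (R : comNzRingType) (d : nat) : Prop :=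
  (exists P : nat -> set R, prime_chain d P) /\
  ~ (exists P : nat -> set R, prime_chain d.+1 P).

Definition prime_height (R : comNzRingType) (Q : set R) (h : nat) : Prop :=
  (exists P, prime_chain h P /\ P h = Q) /\
  ~ (exists P, prime_chain h.+1 P /\ P h.+1 = Q).

Definition height (R : comNzRingType) (I : set R) (g : nat) : Prop :=
  (exists Q, [/\ prime_ideal Q, I `<=` Q & prime_height Q g]) /\
  (forall Q h, prime_ideal Q -> I `<=` Q -> prime_height Q h -> (g <= h)%N).

Definition regular_seq (R : comNzRingType) (s : seq R) : Prop :=
  ~ ideal_gen [set` s] 1 /\
  forall j x, (j < size s)%N ->
    ideal_gen [set` take j s] (s`_j * x) -> ideal_gen [set` take j s] x.

Definition grade (R : comNzRingType) (I : set R) (h : nat) : Prop :=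
  (exists s, [/\ regular_seq s, [set` s] `<=` I & size s = h]) /\
  (forall s, regular_seq s -> [set` s] `<=` I -> (size s <= h)%N).

(* Kaplansky's definition for a Noetherian ring: grade and height agree at
   every maximal ideal.  It is only applied to finitely generated algebras over
   a field, where being Noetherian is automatic. *)
Definition cohen_macaulay (R : comNzRingType) : Prop :=
  forall P : set R, maximal_ideal P ->
    exists h, prime_height P h /\ grade P h.

(** * Gradings *)

(* [V] is the internal direct sum of the additive subgroups [G i]. *)
Definition is_grading (V : zmodType) (G : int -> set V) : Prop :=
  [/\ forall i, zmod_closed [pred x in G i],
      forall v, exists (s : seq int) (f : int -> V),
        [/\ uniq s, forall i, G i (f i) & v = \sum_(i <- s) f i]
    & forall (s : seq int) (f : int -> V),
        uniq s -> (forall i, G i (f i)) -> \sum_(i <- s) f i = 0 ->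
        forall i, i \in s -> f i = 0].

Definition graded_module (R : comNzRingType) (RG : int -> set R)
    (M : lmodType R) (MG : int -> set M) : Prop :=
  is_grading MG /\
  forall i j r x, RG i r -> MG j x -> MG (i + j) (r *: x).

(* The [k]-algebra morphism k[X_1, ..., X_n] -> R sending X_i to [x i]. *)
Definition poly_eval (k : fieldType) (R : comAlgType k) (n : nat)
    (x : 'I_n -> R) (p : {mpoly k[n]}) : R :=
  mmap (in_alg R) x p.

Definition linear_generators (k : fieldType) (R : comAlgType k)
    (RG : int -> set R) (n : nat) (x : 'I_n -> R) : Prop :=
  (forall i, RG 1 (x i)) /\ (forall r : R, exists p, poly_eval x p = r).

Definition standard_graded (k : fieldType) (R : comAlgType k)
    (RG : int -> set R) : Prop :=
  [/\ @graded_module R RG R^o RG,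
      RG 0 = range (fun c : k => c%:A)
    & exists (n : nat) (x : 'I_n -> R), linear_generators RG x].

Definition irrelevant_ideal (R : comNzRingType) (RG : int -> set R) : set R :=
  ideal_gen [set r | exists i : int, 0 < i /\ RG i r].

(* [d] linear forms with radical J = m; with [d = dim R] this is a linear
   system of parameters. *)
Definition linear_sop (R : comNzRingType) (RG : int -> set R) (d : nat)
    (y : 'I_d -> R) : Prop :=
  [/\ krull_dim R d, forall i, RG 1 (y i)
    & radical (ideal_gen (range y)) = irrelevant_ideal RG].

(** * Graded Ext and the graded canonical module *)

Definition homog_deg (k : fieldType) (n : nat) (t : int) (p : {mpoly k[n]}) : Prop :=
  if t is Posz e then p \is e.-homog else p = 0.

(* A sequence ... -> F_1 -> F_0 of graded free modules of finite rank over
   S = k[X_1, ..., X_n]: F_i has a homogeneous basis indexed by ['I_(rk i)],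
   its j-th element having degree [sh i j].  Elements of F_i are row vectors,
   and F_{i+1} -> F_i is right multiplication by [df i]. *)
Record free_seq (k : fieldType) (n : nat) := FreeSeq {
  rk : nat -> nat;
  sh : forall i, 'I_(rk i) -> int;
  df : forall i, 'M[{mpoly k[n]}]_(rk i.+1, rk i)
}.
Arguments rk {k n} f i.
Arguments sh {k n} f i j.
Arguments df {k n} f i.

(* [F], augmented by the map F_0 -> R sending the j-th basis element to [e j],
   is a graded free S-resolution of [R], viewed as an S-module through [x]. *)
Definition graded_free_resolution (k : fieldType) (R : comAlgType k)
    (RG : int -> set R) (n : nat) (x : 'I_n -> R)
    (F : free_seq k n) (e : 'I_(rk F 0) -> R) : Prop :=
  let aug (v : 'rV[{mpoly k[n]}]_(rk F 0)) : R :=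
    \sum_j poly_eval x (v 0 j) * e j in
  [/\ forall i j l, homog_deg (sh F i.+1 j - sh F i l) (df F i j l),
      forall j, RG (sh F 0 j) (e j),
      forall r, exists v, aug v = r,
      forall v, aug v = 0 <-> exists w, v = w *m df F 0
    & forall i (v : 'rV_(rk F i.+1)),
        v *m df F i = 0 <-> exists w, v = w *m df F i.+1].

(* Hom_S(F_i, S) consists of the column vectors of values on the basis of F_i;
   the map Hom_S(F_i, S) -> Hom_S(F_{i+1}, S) is left multiplication by
   [df F i]. *)
Definition cocycle (k : fieldType) (n : nat) (F : free_seq k n) (i : nat)
    (c : 'cV[{mpoly k[n]}]_(rk F i)) : Prop :=
  df F i *m c = 0.

Definition coboundary (k : fieldType) (n : nat) (F : free_seq k n) (i : nat) :
    'cV[{mpoly k[n]}]_(rk F i) -> Prop :=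
  match i return 'cV[{mpoly k[n]}]_(rk F i) -> Prop with
  | 0%N => fun c => c = 0
  | j.+1 => fun c => exists b, c = df F j *m b
  end.

(* [c] has degree [t] as an element of Hom_S(F_i, S(m)). *)
Definition cochain_deg (k : fieldType) (n : nat) (F : free_seq k n) (m : int)
    (i : nat) (t : int) (c : 'cV[{mpoly k[n]}]_(rk F i)) : Prop :=
  forall j, homog_deg (sh F i j + t + m) (c j 0).

(* The graded module [W] is isomorphic to Ext^i_S(R, S(m)), the i-th cohomology
   of Hom_S(F, S(m)): [psi] is defined on cocycles, is S-linear, surjective,
   homogeneous of degree 0, and its kernel consists of the coboundaries.
   Outside the cocycles the values of [psi] are irrelevant. *)
Definition iso_graded_Ext (k : fieldType) (R : comAlgType k) (n : nat)
    (x : 'I_n -> R) (F : free_seq k n) (m : int) (i : nat)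
    (W : lmodType R) (WG : int -> set W) : Prop :=
  exists psi : 'cV[{mpoly k[n]}]_(rk F i) -> W,
  [/\ forall (p : {mpoly k[n]}) c c', cocycle c -> cocycle c' ->
        psi (p *: c + c') = poly_eval x p *: psi c + psi c',
      forall w, exists c, cocycle c /\ psi c = w,
      forall c, cocycle c -> (psi c = 0 <-> coboundary c)
    & forall t c, cocycle c -> cochain_deg m t c -> WG t (psi c)].

(* [W] is isomorphic to Ext^g_S(R, S(-n)) for a presentation R = S/I by linear
   forms, with I of height g.  Up to graded isomorphism this depends neither on
   the presentation nor on the resolution. *)
Definition graded_canonical_module (k : fieldType) (R : comAlgType k)
    (RG : int -> set R) (W : lmodType R) (WG : int -> set W) : Prop :=
  graded_module RG WG /\
  exists (n : nat) (x : 'I_n -> R) (g : nat) (F : free_seq k n)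
         (e : 'I_(rk F 0) -> R),
  [/\ linear_generators RG x,
      height [set p : {mpoly k[n]} | poly_eval x p = 0] g,
      graded_free_resolution RG x e
    & iso_graded_Ext x F (- n%:Z) g WG].

(* [a] is minus the least degree in which [W] is nonzero. *)
Definition is_a_invariant (W : zmodType) (WG : int -> set W) (a : int) : Prop :=
  (exists w, WG (- a) w /\ w != 0) /\
  (forall i w, WG i w -> w != 0 -> - a <= i).

(* Main.v *)
Require Import Defs.
From HB Require Import structures.
From mathcomp Require Import all_boot all_order all_algebra.
From mathcomp Require Import mpoly.
From mathcomp Require Import boolp classical_sets.
From mathcomp Require Import ring zify.
Set Implicit Arguments.
Unset Strict Implicit.
Unset Printing Implicit Defensive.
Import Order.TTheory GRing.Theory Num.Theory.
Local Open Scope classical_set_scope.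
Local Open Scope ring_scope.

(** Let A be the polynomial ring in the parameters. Then [R] is a graded free
    A-module, with a basis of forms b_j of degrees e_j ([sop_free_basis]), and
    the canonical module is the module of A-linear maps from [R] to A with
    degrees shifted by [d] ([canonical_pairing]). The equivalences are read off
    from this pairing. The maps dual to the b_j are elements of the canonical
    module of degrees d - e_j, so all e_j are at most a + d ([basis_degree_le]).
    An element of J^i has values of order at least i under the pairing with any
    w ([pairing_order]), and an element whose coordinates in the b_j have order
    at least i lies in J^i; in particular m^(i+a+d) is contained in J^i, so that
    m^i is contained in J^i : m^(a+d) ([colon_sub]).

    Let x lie in this colon ideal, let x_t be its component of a degree t < i and
    let w be an element of degree -a of the canonical module. On forms r of
    degree a + d the values w(x_t r) have degree t and are components of w(x r),
    which has order at least i, so they vanish; since e_j <= a + d for all j this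
    implies that x_t w = 0 ([colon_kills]). Thus faithfulness of the submodule
    generated by the lowest component yields x_t = 0. Conversely, a nonzero form
    x annihilating the lowest component is orthogonal to the dual basis elements
    with e_j = a + d, whence its product by a power of a parameter that has
    degree i - 1 lies in J^i : m^(a+d) but not in m^i, for every i > deg x
    ([colon_faithful]). If the colon condition on the canonical module holds
    together with the equality of ideals for a single i >= a + d, then the
    component of degree i - a of the canonical module is the product of the
    forms of degree i with the lowest component. An annihilator of the latter
    kills multiples of all dual basis elements by powers of a parameter and
    is zero ([module_colon_faithful]).

    Freeness of [R] over A: the parameters are algebraically independent, for
    otherwise the components of [R] would grow too slowly to accommodate the
    monomials in a regular sequence of length d ([params_alg_indep]). By going up
    some chain of d inclusions of primes ends at the irrelevant ideal
    ([going_up_chain]), which therefore has grade d, as [R] is Cohen-Macaulay.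
    Koszul cohomology then shows that the parameters form a regular sequence
    ([params_regular]).

    Duality: after a linear change of variables ([adapted_presentation]) let the
    parameters be the images of the first d variables of S = k[X_1, ..., X_n].
    Homogeneous power series being polynomials, Ext(R, S) can be computed with
    power series coefficients, hence inside the functions on the lattice of
    exponents, on which S acts by shifts. For t > d a power of X_t plus terms
    divisible by the first d variables annihilates [R], and it is invertible on
    functions whose exponents are constrained to be nonnegative in the first
    t - 1 variables only ([stage_injective], [stage_surjective]). So the Ext
    modules of [R] with values in such functions vanish ([ext_vanish]), and
    trading power series in X_t for series in its inverse lowers the degree of
    Ext by one. In n - d steps Ext^(n-d)(R, S) turns into the S-linear maps from
    [R] to functions that are power series in the first d variables and inverse
    power series in the others; the coefficient at the exponents (-1, ..., -1) in
    the latter, the residue, identifies these with A-linear maps from [R] to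
    power series in the parameters, and the homogeneous ones with the maps to A.
    The other Ext modules vanish: in lower degrees because degree zero is reached
    before all variables are traded, in higher degrees because [R] is free over A
    ([ext_vanish_off]). *)

(** * Submodules and ideals *)

Section Submodules.
Variables (R : comNzRingType) (M : lmodType R).
Implicit Types (N : set M) (A : set M).

Lemma submodP N :
  is_submod N <-> N 0 /\ forall (a : R) u v, N u -> N v -> N (a *: u + v).
Proof.
split=> [[N0 NS]|[N0 NS]].
  split; first by move: N0; rewrite inE.
  by move=> a u v Nu Nv; have := NS a u v; rewrite !inE; apply.
split; first by rewrite inE.
by move=> a u v; rewrite !inE; apply: NS.
Qed.

Lemma submod0 N : is_submod N -> N 0.
Proof. by case/submodP. Qed.

Lemma submodD N u v : is_submod N -> N u -> N v -> N (u + v).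
Proof. by case/submodP=> _ NS Nu Nv; rewrite -[u]scale1r; apply: NS. Qed.

Lemma submodZ N a u : is_submod N -> N u -> N (a *: u).
Proof. by case/submodP=> N0 NS Nu; rewrite -[_ *: _]addr0; apply: NS. Qed.

Lemma submodN N u : is_submod N -> N u -> N (- u).
Proof. by move=> sN Nu; rewrite -scaleN1r; apply: submodZ. Qed.

Lemma submodB N u v : is_submod N -> N u -> N v -> N (u - v).
Proof. by move=> sN Nu Nv; apply: submodD => //; apply: submodN. Qed.

Lemma submod_sum N (I : Type) (r : seq I) (P : pred I) (F : I -> M) :
  is_submod N -> (forall i, P i -> N (F i)) -> N (\sum_(i <- r | P i) F i).
Proof.
move=> sN NF; elim/big_rec: _ => [|i x Pi Nx]; first exact: submod0.
by apply: submodD => //; apply: NF.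
Qed.

Lemma sub_submod_gen A : A `<=` submod_gen A.
Proof. exact: sub_smallest. Qed.

Lemma submod_gen_sub A N : is_submod N -> A `<=` N -> submod_gen A `<=` N.
Proof. by move=> sN AN x; apply. Qed.

Lemma submod_gen_submod A : is_submod (submod_gen A).
Proof.
apply/submodP; split=> [N [sN _]|a u v Au Av N NA]; first exact: submod0.
have sN := NA.1; apply: submodD => //; last exact: Av.
by apply: submodZ => //; apply: Au.
Qed.

Lemma submod_mul_submod (I : set R) N : is_submod (submod_mul I N).
Proof. exact: submod_gen_submod. Qed.

Lemma mem_submod_mul (I : set R) N r x : I r -> N x -> submod_mul I N (r *: x).
Proof. by move=> Ir Nx; apply: sub_submod_gen; exists r, x. Qed.

Lemma submod_mul_sub (I : set R) N N' : is_submod N' ->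
  (forall r x, I r -> N x -> N' (r *: x)) -> submod_mul I N `<=` N'.
Proof.
by move=> sN' H; apply: submod_gen_sub => // u [r [x [Ir Nx ->]]]; apply: H.
Qed.

End Submodules.

Definition ideal (R : comNzRingType) (I : set R) : Prop := @is_submod R R^o I.

Section Ideals.
Variable R : comNzRingType.
Implicit Types (I J : set R).

Lemma idealP I :
  ideal I <-> I 0 /\ forall a u v, I u -> I v -> I (a * u + v).
Proof. exact: (@submodP R R^o). Qed.

Lemma ideal_mull I a u : ideal I -> I u -> I (a * u).
Proof. exact: (@submodZ R R^o). Qed.

Lemma ideal_mulr I a u : ideal I -> I u -> I (u * a).
Proof. by rewrite mulrC; apply: ideal_mull. Qed.

Lemma ideal_powS I n : ideal_pow I n.+1%:Z = ideal_mul I (ideal_pow I n%:Z).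
Proof. by []. Qed.

Lemma mem_ideal_mul (I N : set R) a b : I a -> N b -> ideal_mul I N (a * b).
Proof. exact: (@mem_submod_mul R R^o). Qed.

Lemma ideal_setT : ideal ([set: R] : set R).
Proof. by apply/idealP. Qed.

Lemma ideal_pow_ideal I i : ideal (ideal_pow I i).
Proof.
case: i => [[|n]|n]; [exact: ideal_setT| |exact: ideal_setT].
exact: (@submod_gen_submod R R^o).
Qed.

Lemma ideal_gen_ideal A : ideal (@ideal_gen R A).
Proof. exact: (@submod_gen_submod R R^o). Qed.

Lemma sub_ideal_gen (A : set R) : A `<=` ideal_gen A.
Proof. exact: (@sub_submod_gen R R^o). Qed.

Lemma ideal_gen_sub (A I : set R) : ideal I -> A `<=` I -> ideal_gen A `<=` I.
Proof. exact: (@submod_gen_sub R R^o). Qed.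

Lemma ideal_gen_mull (A : set R) a u : ideal_gen A u -> ideal_gen A (a * u).
Proof. by move=> Au; exact: (ideal_mull a (ideal_gen_ideal A) Au). Qed.

Lemma ideal_gen_mulr (A : set R) a u : ideal_gen A u -> ideal_gen A (u * a).
Proof. by rewrite mulrC; apply: ideal_gen_mull. Qed.

Lemma prime_idealP (P : set R) : prime_ideal P <->
  [/\ ideal P, ~ P 1 & forall u v, P (u * v) -> P u \/ P v].
Proof.
split=> [[[P0 P1 PS] Pp]|[/idealP [P0 PS] P1 Pp]].
  split.
  - apply/idealP; split; first by move: P0; rewrite inE.
    by move=> a u v Nu Nv; have := PS a u v; rewrite !inE; apply.
  - by move=> PP; case/negP: P1; rewrite inE.
  - by move=> u v Puv; have := Pp u v; rewrite !inE => /(_ Puv)/orP [];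
      rewrite inE; [left|right].
split; first split.
- by rewrite inE.
- by apply/negP; rewrite inE.
- by move=> a u v; rewrite !inE; apply: PS.
move=> u v; rewrite inE => /Pp [] h; apply/orP; [left|right];
  by rewrite inE.
Qed.

Lemma proper_idealP (P : set R) :
  idealr_closed [pred x in P] <-> ideal P /\ ~ P 1.
Proof.
split=> [[P0 P1 PS]|[/idealP [P0 PS] P1]].
  split; last by move=> PP; case/negP: P1; rewrite inE.
  apply/idealP; split; first by move: P0; rewrite inE.
  by move=> a u v Nu Nv; have := PS a u v; rewrite !inE; apply.
split.
- by rewrite inE.
- by apply/negP; rewrite inE.
- by move=> a u v; rewrite !inE; apply: PS.
Qed.

Lemma prime_idealX (P : set R) x n : prime_ideal P -> P (x ^+ n) -> P x.
Proof.
case/prime_idealP=> _ P1 Pp; elim: n => [|n IH]; first by rewrite expr0.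
by rewrite exprS => /Pp [].
Qed.

End Ideals.

(** * Homogeneous components *)

(** A grading only asserts that decompositions exist, so the component is picked
    by choice; it depends on neither the decomposition nor the index set, which
    may omit [i]. *)
Definition gproj (V : zmodType) (G : int -> set V) (i : int) (v : V) : V :=
  xget 0 [set w | exists s f, [/\ uniq s, forall j, G j (f j),
    v = \sum_(j <- s) f j & w = if i \in s then f i else 0]].

Section Grading.
Variables (V : zmodType) (G : int -> set V).
Hypothesis hG : is_grading G.

Lemma graded0 i : G i 0.
Proof. by case: hG => /(_ i) [h _] _ _; move: h; rewrite inE. Qed.

Lemma gradedB i u v : G i u -> G i v -> G i (u - v).
Proof.
case: hG => /(_ i) [_ h] _ _ hu hv.
by have := h u v; rewrite !inE; apply.
Qed.

Lemma gradedN i u : G i u -> G i (- u).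
Proof. by move=> hu; rewrite -sub0r; apply: gradedB => //; apply: graded0. Qed.

Lemma gradedD i u v : G i u -> G i v -> G i (u + v).
Proof. by move=> hu hv; rewrite -[v]opprK; apply/gradedB/gradedN. Qed.

Lemma graded_sum i (I : Type) (r : seq I) (P : pred I) (F : I -> V) :
  (forall j, P j -> G i (F j)) -> G i (\sum_(j <- r | P j) F j).
Proof.
move=> NF; elim/big_rec: _ => [|j x Pj Nx]; first exact: graded0.
by apply: gradedD => //; apply: NF.
Qed.

Lemma sum_widen_uniq (s t : seq int) (f : int -> V) : uniq s -> uniq t ->
  {subset s <= t} ->
  \sum_(i <- t) (if i \in s then f i else 0) = \sum_(i <- s) f i.
Proof.
move=> us ut st; rewrite -big_mkcond /= -big_filter; apply: perm_big.
apply: uniq_perm; rewrite ?filter_uniq // => x; rewrite mem_filter.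
by case: (boolP (x \in s)) => //= /st.
Qed.

Lemma gproj_sum s f i : uniq s -> (forall j, G j (f j)) ->
  gproj G i (\sum_(j <- s) f j) = if i \in s then f i else 0.
Proof.
move=> us Gf; rewrite /gproj; case: xgetP => [w -> [t [g [ut Gg e ->]]]|]; last first.
  by move=> /(_ (if i \in s then f i else 0)) []; exists s, f.
pose F j := (if j \in s then f j else 0) - (if j \in t then g j else 0).
case: hG => _ _ /(_ (undup (s ++ t)) F (undup_uniq _)).
have GF j : G j (F j).
  by apply: gradedB; case: ifP => _ //; apply: graded0.
move=> /(_ GF); rewrite sumrB !sum_widen_uniq ?undup_uniq //; last first.
- by move=> x xs; rewrite mem_undup mem_cat xs.
- by move=> x xs; rewrite mem_undup mem_cat xs orbT.
rewrite e subrr => /(_ erefl i); rewrite mem_undup mem_cat /F.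
case: (i \in s); case: (i \in t) => //= /(_ isT); move/eqP.
- by rewrite subr_eq0 => /eqP.
- by rewrite subr0 => /eqP.
- by rewrite sub0r oppr_eq0 => /eqP.
Qed.

Lemma gprojE v : exists s, [/\ uniq s, v = \sum_(i <- s) gproj G i v
  & forall i, i \notin s -> gproj G i v = 0].
Proof.
case: hG => _ /(_ v) [s [f [us Gf ev]]] _; exists s; split=> //.
  rewrite {1}ev; apply: eq_big_seq => i si.
  by rewrite ev gproj_sum // si.
by move=> i /negbTE si; rewrite ev gproj_sum // si.
Qed.

Lemma gproj_in i v : G i (gproj G i v).
Proof.
case: hG => _ /(_ v) [s [f [us Gf ->]]] _; rewrite gproj_sum //.
by case: ifP => // _; apply: graded0.
Qed.

Lemma gproj_id i j v : G i v -> gproj G j v = if j == i then v else 0.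
Proof.
move=> Gv; have := @gproj_sum [:: i] (fun l => if l == i then v else 0) j.
rewrite big_seq1 eqxx inE => -> //; first by case: (j == i).
by move=> l; case: eqP => [->|] // _; apply: graded0.
Qed.

Lemma gprojB i u v : gproj G i (u - v) = gproj G i u - gproj G i v.
Proof.
have [s [us eu su]] := gprojE u; have [t [ut ev tv]] := gprojE v.
pose F j := gproj G j u - gproj G j v.
have e : u - v = \sum_(j <- undup (s ++ t)) F j.
  rewrite sumrB {1}eu {1}ev; congr (_ - _).
    rewrite -(@sum_widen_uniq s (undup (s ++ t))) ?undup_uniq //.
      by apply: eq_bigr => j _; case: ifPn => // /su.
    by move=> x xs; rewrite mem_undup mem_cat xs.
  rewrite -(@sum_widen_uniq t (undup (s ++ t))) ?undup_uniq //.
    by apply: eq_bigr => j _; case: ifPn => // /tv.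
  by move=> x xs; rewrite mem_undup mem_cat xs orbT.
rewrite {1}e gproj_sum ?undup_uniq //; last first.
  by move=> j; apply: gradedB; apply: gproj_in.
rewrite mem_undup mem_cat; case: ifPn => //.
by rewrite negb_or => /andP [/su -> /tv ->]; rewrite subrr.
Qed.

Lemma gproj0 i : gproj G i 0 = 0.
Proof. by rewrite -[0 in LHS](subrr 0) gprojB subrr. Qed.

Lemma gprojN i u : gproj G i (- u) = - gproj G i u.
Proof. by rewrite -sub0r gprojB gproj0 sub0r. Qed.

Lemma gprojD i u v : gproj G i (u + v) = gproj G i u + gproj G i v.
Proof. by rewrite -[v in LHS]opprK gprojB gprojN opprK. Qed.

Lemma gproj_bigsum i (I : Type) (r : seq I) (P : pred I) (F : I -> V) :
  gproj G i (\sum_(j <- r | P j) F j) = \sum_(j <- r | P j) gproj G i (F j).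
Proof. by apply: (big_morph (gproj G i)); [apply: gprojD|apply: gproj0]. Qed.

Lemma gproj_eq0 v : (forall i, gproj G i v = 0) -> v = 0.
Proof. by move=> h; have [s [_ -> _]] := gprojE v; rewrite big1. Qed.

End Grading.

Lemma gprojZ (R : comNzRingType) (RG : int -> set R) (M : lmodType R)
    (MG : int -> set M) i j r x : graded_module RG MG -> RG j r ->
  gproj MG i (r *: x) = r *: gproj MG (i - j) x.
Proof.
move=> [hG hM] Rr; have [s [us ex sx]] := gprojE hG x; rewrite [in LHS]ex.
rewrite scaler_sumr gproj_bigsum //.
rewrite (eq_bigr (fun l => if l == i - j then r *: gproj MG l x else 0)).
  rewrite -big_mkcond /= -big_filter.
  case: (boolP (i - j \in s)) => si.
    by rewrite (_ : filter _ _ = [:: i - j]) ?big_seq1 // filter_pred1_uniq.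
  rewrite (_ : filter _ _ = [::]) ?big_nil ?sx ?scaler0 //.
  apply/eqP; rewrite -[_ == _]negbK -has_filter; apply/hasPn => z zs.
  by apply: contraNN si => /eqP <-.
move=> l _; rewrite (@gproj_id _ _ hG (j + l)); last first.
  by apply: hM => //; apply: gproj_in.
by rewrite addrC -subr_eq eq_sym.
Qed.

(** * Evaluation of polynomials and homogeneous parts *)

Section PolyEval.
Variables (k : fieldType) (R : comAlgType k) (n : nat) (x : 'I_n -> R).
Implicit Types (p q : {mpoly k[n]}).

Lemma poly_eval_is_additive p q :
  poly_eval x (p - q) = poly_eval x p - poly_eval x q.
Proof. exact: mmapB. Qed.

Lemma poly_evalD p q : poly_eval x (p + q) = poly_eval x p + poly_eval x q.
Proof. exact: mmapD. Qed.

Lemma poly_eval0 : poly_eval x 0 = 0.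
Proof. exact: mmap0. Qed.

Lemma poly_evalN p : poly_eval x (- p) = - poly_eval x p.
Proof. exact: mmapN. Qed.

Lemma poly_eval_sum (I : Type) (r : seq I) (P : pred I) F :
  poly_eval x (\sum_(i <- r | P i) F i) = \sum_(i <- r | P i) poly_eval x (F i).
Proof. by apply: (big_morph _ poly_evalD poly_eval0). Qed.

Lemma poly_evalM p q : poly_eval x (p * q) = poly_eval x p * poly_eval x q.
Proof. exact: (rmorphM (mmap (in_alg R) x)). Qed.

Lemma poly_eval1 : poly_eval x 1 = 1.
Proof. exact: (rmorph1 (mmap (in_alg R) x)). Qed.

Lemma poly_evalXn p e : poly_eval x (p ^+ e) = poly_eval x p ^+ e.
Proof. exact: (rmorphXn (mmap (in_alg R) x)). Qed.

Lemma poly_evalX m : poly_eval x 'X_[m] = mmap1 x m.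
Proof. exact: mmapX. Qed.

Lemma poly_evalXU i : poly_eval x 'X_i = x i.
Proof. by rewrite poly_evalX mmap1U. Qed.

Lemma poly_evalZ c p : poly_eval x (c *: p) = c *: poly_eval x p.
Proof. by rewrite /poly_eval mmapZ mulr_algl. Qed.

Lemma poly_evalC c : poly_eval x c%:MP = c%:A.
Proof. exact: mmapC. Qed.

Lemma poly_evalE p :
  poly_eval x p = \sum_(m <- msupp p) p@_m *: mmap1 x m.
Proof.
by rewrite [p in LHS]mpolyE poly_eval_sum; apply: eq_bigr => m _;
  rewrite poly_evalZ poly_evalX.
Qed.

End PolyEval.

Lemma mmap1M (S : comNzRingType) n (h : 'I_n -> S) m1 m2 :
  mmap1 h (m1 + m2) = mmap1 h m1 * mmap1 h m2.
Proof. by apply: commr_mmap1_M => i z; apply: mulrC. Qed.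

Lemma mnm_add_ind n (P : 'X_{1..n} -> Prop) :
  P 0%MM -> (forall i m, P m -> P (U_(i) + m)%MM) -> forall m, P m.
Proof.
move=> P0 PU m; have [N hN] : exists N, mdeg m = N by exists (mdeg m).
elim: N m hN => [|N IH] m hN; first by move/eqP: hN; rewrite mdeg_eq0 => /eqP ->.
have [i mi] : exists i, m i != 0%N.
  apply/existsP; apply: contraT; rewrite negb_exists => /forallP h.
  by rewrite mdegE big1 in hN => // i _; apply/eqP; have := h i; rewrite negbK.
have em : m = (U_(i) + (m - U_(i)))%MM by rewrite addmC submK // lep1mP.
rewrite em; apply: PU; apply: IH; apply/eqP.
by rewrite -eqSS -hN [in X in _ == X]em mdegD mdeg1.
Qed.

Lemma mmap1_ideal_pow (S : comNzRingType) n (z : 'I_n -> S) (I : set S) :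
  (forall j, I (z j)) ->
  forall m i, (i <= mdeg m)%N -> ideal_pow I i%:Z (mmap1 z m).
Proof.
move=> hz; elim/mnm_add_ind => [[|i]|j m IH [|i]] //; first by rewrite mdeg0.
rewrite mdegD mdeg1 add1n ltnS => /IH h; rewrite mmap1M mmap1U ideal_powS.
exact: mem_ideal_mul.
Qed.

Section HomogeneousPart.
Variables (k : fieldType) (n : nat).
Implicit Types (p q : {mpoly k[n]}) (t : int).

Definition hpart t p : {mpoly k[n]} :=
  if t is Posz e then pihomog mdeg e p else 0.

Lemma homog_degP t p :
  homog_deg t p <-> forall m, p@_m != 0 -> (mdeg m)%:Z = t.
Proof.
case: t => [e|e] /=.
  split=> [/dhomogP h m|h]; first by rewrite -mcoeff_msupp => /h ->.
  by apply/dhomogP => m; rewrite mcoeff_msupp => /h [].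
split=> [-> m|h]; first by rewrite mcoeff0 eqxx.
apply/mpolyP => m; rewrite mcoeff0; apply/eqP; case: eqP => // /eqP /h.
by [].
Qed.

Lemma mcoeff_filter (Q : pred 'X_{1..n}) p m :
  (\sum_(m' <- msupp p | Q m') p@_m' *: 'X_[m'])@_m = if Q m then p@_m else 0.
Proof.
rewrite raddf_sum /= big_mkcond /= (eq_bigr (fun m' => if m' == m then
  (if Q m then p@_m else 0) else 0)); last first.
  move=> m' _; rewrite mcoeffZ mcoeffX; case: (m' =P m) => [->|_].
    by rewrite mulr1.
  by rewrite mulr0; case: ifP.
rewrite -big_mkcond /= -big_filter; case: (boolP (m \in msupp p)) => mp.
  by rewrite filter_pred1_uniq ?msupp_uniq // big_seq1.
rewrite (memN_msupp_eq0 mp) (_ : filter _ _ = [::]) ?big_nil; first by case: ifP.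
apply/eqP; rewrite -[_ == _]negbK -has_filter; apply/hasPn => z zs.
by apply: contraNN mp => /eqP <-.
Qed.

Lemma mcoeff_hpart t p m :
  (hpart t p)@_m = if (mdeg m)%:Z == t then p@_m else 0.
Proof.
case: t => [e|e] /=; last by rewrite mcoeff0.
by rewrite pihomogE mcoeff_filter.
Qed.

Lemma homog_hpart t p : homog_deg t (hpart t p).
Proof.
by apply/homog_degP => m; rewrite mcoeff_hpart; case: (_ =P t) => // _; rewrite eqxx.
Qed.

Lemma hpart_id t p : homog_deg t p -> hpart t p = p.
Proof.
move/homog_degP=> h; apply/mpolyP => m; rewrite mcoeff_hpart.
by case: eqP => // ne; apply/eqP; rewrite eq_sym; apply: contra_notT ne => /h.
Qed.

Lemma homog_deg0 t : homog_deg t (0 : {mpoly k[n]}).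
Proof. by apply/homog_degP => m; rewrite mcoeff0 eqxx. Qed.

Lemma homog_degD t p q : homog_deg t p -> homog_deg t q -> homog_deg t (p + q).
Proof.
move=> /homog_degP hp /homog_degP hq; apply/homog_degP => m; rewrite mcoeffD.
by case: (eqVneq p@_m 0) => [->|/hp //]; rewrite add0r => /hq.
Qed.

Lemma homog_degZ t c p : homog_deg t p -> homog_deg t (c *: p).
Proof.
move=> /homog_degP hp; apply/homog_degP => m; rewrite mcoeffZ.
by rewrite mulf_eq0 negb_or => /andP [_ /hp].
Qed.

Lemma homog_degM s t p q :
  homog_deg s p -> homog_deg t q -> homog_deg (s + t) (p * q).
Proof.
move=> /homog_degP hp /homog_degP hq; apply/homog_degP => m.
rewrite -mcoeff_msupp => /msuppM_le /allpairsP [[m1 m2] /= [h1 h2 ->]].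
rewrite mcoeff_msupp in h1; rewrite mcoeff_msupp in h2.
by rewrite mdegD PoszD (hp _ h1) (hq _ h2).
Qed.

Lemma homog_degX m : homog_deg (mdeg m)%:Z ('X_[m] : {mpoly k[n]}).
Proof. by rewrite /= dhomogX. Qed.

Lemma homog_degXU i : homog_deg 1 ('X_i : {mpoly k[n]}).
Proof. by rewrite -[1]/(Posz 1) -(mdeg1 i); apply: homog_degX. Qed.

Lemma homog_deg_sum t (I : Type) (r : seq I) (P : pred I)
    (F : I -> {mpoly k[n]}) :
  (forall i, P i -> homog_deg t (F i)) -> homog_deg t (\sum_(i <- r | P i) F i).
Proof.
move=> hF; elim/big_rec: _ => [|i p Pi hp]; first exact: homog_deg0.
by apply: homog_degD => //; apply: hF.
Qed.

Lemma hpartD t p q : hpart t (p + q) = hpart t p + hpart t q.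
Proof.
apply/mpolyP => m; rewrite mcoeffD !mcoeff_hpart mcoeffD.
by case: ifP; rewrite ?addr0.
Qed.

Lemma hpart0 t : hpart t 0 = 0.
Proof. by apply/mpolyP => m; rewrite mcoeff_hpart mcoeff0; case: ifP. Qed.

Lemma hpart_bigsum t (I : Type) (r : seq I) (P : pred I) F :
  hpart t (\sum_(i <- r | P i) F i) = \sum_(i <- r | P i) hpart t (F i).
Proof. exact: (big_morph _ (hpartD t) (hpart0 t)). Qed.

Lemma hpart_homog s t p : homog_deg s p -> hpart t p = if t == s then p else 0.
Proof.
move=> hp; case: eqP => [->|ne]; first exact: hpart_id.
apply/mpolyP => m; rewrite mcoeff_hpart mcoeff0; case: eqP => // e.
by apply/eqP; apply: contra_notT ne => /((homog_degP _ _).1 hp); rewrite e.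
Qed.

Lemma hpart_sum p : p = \sum_(e < msize p) hpart e%:Z p.
Proof. exact: pihomog_partitionE. Qed.

Lemma hpartM s t p q : homog_deg s p -> hpart t (p * q) = p * hpart (t - s) q.
Proof.
move=> hp; rewrite [q in LHS]hpart_sum mulr_sumr hpart_bigsum.
rewrite [q in RHS]hpart_sum hpart_bigsum mulr_sumr; apply: eq_bigr => i _.
rewrite (hpart_homog _ (homog_degM hp (homog_hpart _ _))).
rewrite (hpart_homog _ (homog_hpart _ _)).
have -> : (t == s + i%:Z) = (t - s == i%:Z) by rewrite subr_eq addrC.
by case: ifP; rewrite ?mulr0.
Qed.

End HomogeneousPart.

(** * Standard graded algebras *)

Section StandardGraded.
Variables (k : fieldType) (R : comAlgType k) (RG : int -> set R).
Hypothesis hR : standard_graded RG.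

Lemma sg_grading : @is_grading R RG.
Proof. by case: hR => [[]]. Qed.

Lemma sg_alg c : RG 0 c%:A.
Proof. by case: hR => [_ -> _]; exists c. Qed.

Lemma sg_one : RG 0 1.
Proof. by rewrite -(scale1r 1); apply: sg_alg. Qed.

Lemma sg_mul i j a b : RG i a -> RG j b -> RG (i + j) (a * b).
Proof. by case: hR => [[_ h] _ _]; apply: h. Qed.

Lemma sg_scale i c a : RG i a -> RG i (c *: a).
Proof. by move=> ha; rewrite -mulr_algl -[i]add0r; apply: sg_mul => //; apply: sg_alg. Qed.

Lemma sg_exp i a e : RG i a -> RG (i * e%:Z) (a ^+ e).
Proof.
move=> ha; elim: e => [|e IH]; first by rewrite mulr0; apply: sg_one.
by rewrite exprS -addn1 PoszD mulrDr mulr1 addrC; apply: sg_mul.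
Qed.

Lemma sg_mon n (z : 'I_n -> R) m : (forall i, RG 1 (z i)) ->
  RG (mdeg m)%:Z (mmap1 z m).
Proof.
move=> hz; rewrite /mmap1 mdegE (big_morph Posz PoszD erefl).
elim/big_rec2: _ => [|i a b _ IH]; first exact: sg_one.
by apply: sg_mul => //; rewrite -[Posz (m i)]mul1r; apply: sg_exp.
Qed.

Lemma gprojM t s a b : RG s a -> gproj RG t (a * b) = a * gproj RG (t - s) b.
Proof. by move=> ha; apply: (@gprojZ R RG R^o RG) => //; case: hR. Qed.

Lemma gprojZk t c a : gproj RG t (c *: a) = c *: gproj RG t a.
Proof. by rewrite -mulr_algl (gprojM _ _ (sg_alg c)) subr0 mulr_algl. Qed.

Section Linear.
Variables (n : nat) (z : 'I_n -> R).
Hypothesis hz : forall i, RG 1 (z i).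

Lemma homog_eval t p : homog_deg t p -> RG t (poly_eval z p).
Proof.
move/homog_degP=> h; rewrite poly_evalE big_seq.
apply: (graded_sum sg_grading) => m; rewrite mcoeff_msupp => /h <-.
by apply: sg_scale; apply: sg_mon.
Qed.

Lemma gproj_eval t p : gproj RG t (poly_eval z p) = poly_eval z (hpart t p).
Proof.
rewrite [p in LHS]hpart_sum poly_eval_sum (gproj_bigsum sg_grading).
rewrite [p in RHS]hpart_sum hpart_bigsum poly_eval_sum; apply: eq_bigr => i _.
rewrite (gproj_id sg_grading _ (homog_eval (homog_hpart _ _))).
by rewrite (hpart_homog _ (homog_hpart _ _)); case: ifP => //; rewrite poly_eval0.
Qed.

End Linear.

Lemma sg_linear_generators : exists n (x : 'I_n -> R), linear_generators RG x.
Proof. by case: hR. Qed.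

Lemma sg_gen n (x : 'I_n -> R) t r : linear_generators RG x -> RG t r ->
  exists p, homog_deg t p /\ poly_eval x p = r.
Proof.
case=> hx gx hr; have [p ep] := gx r; exists (hpart t p).
split; first exact: homog_hpart.
by rewrite -gproj_eval // ep (gproj_id sg_grading _ hr) eqxx.
Qed.

Lemma sg_neg t r : t < 0 -> RG t r -> r = 0.
Proof.
move=> t0 hr; have [n [x hx]] := sg_linear_generators.
have [p [hp <-]] := sg_gen hx hr.
by case: t t0 hr hp => // e _ _ /= ->; rewrite poly_eval0.
Qed.

Lemma gproj_neg t r : t < 0 -> gproj RG t r = 0.
Proof. by move=> t0; apply: (sg_neg t0); apply: (gproj_in sg_grading). Qed.

(** This ideal is the [i]-th power of the irrelevant one because [R] is
    generated in degree one, and unlike the power it can be tested degree by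
    degree. *)
Definition Rge (i : nat) : set R :=
  [set r | forall t, t < i%:Z -> gproj RG t r = 0].

Lemma RgeP i r : Rge i r -> forall t, gproj RG t r != 0 -> i%:Z <= t.
Proof. by move=> hr t; rewrite leNgt; apply: contraNN => /hr ->. Qed.

Lemma Rge_homog i t r : RG t r -> i%:Z <= t -> Rge i r.
Proof.
move=> hr it s si; rewrite (gproj_id sg_grading _ hr); case: eqP => // e.
by move: si; rewrite e ltNge it.
Qed.

Lemma Rge_mul i j a b : Rge i a -> Rge j b -> Rge (i + j) (a * b).
Proof.
move=> ha hb t tij.
have [s [_ ea _]] := gprojE sg_grading a; rewrite ea.
rewrite mulr_suml (gproj_bigsum sg_grading) big1 // => l _.
rewrite (gprojM _ _ (gproj_in sg_grading _ _)).
have [li|il] := ltP l i%:Z; first by rewrite ha // mul0r.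
by rewrite hb ?mulr0 // ltrBlDr (lt_le_trans tij) // PoszD addrC lerD2l.
Qed.

Lemma Rge0 r : Rge 0 r.
Proof. by move=> t t0; apply: gproj_neg. Qed.

Lemma Rge_ideal i : ideal (Rge i).
Proof.
apply/idealP; split=> [t _|a u v hu hv t ti]; first exact: gproj0 sg_grading _.
rewrite (gprojD sg_grading) hv // addr0.
by have := @Rge_mul 0 i a u (@Rge0 a) hu; apply.
Qed.

Lemma irrelevant_sub : irrelevant_ideal RG `<=` Rge 1.
Proof.
apply: ideal_gen_sub; first exact: Rge_ideal.
by move=> r [i [i0 hr]]; apply: Rge_homog hr _.
Qed.

Lemma irrelevant_homog t r : 0 < t -> RG t r -> irrelevant_ideal RG r.
Proof. by move=> t0 hr; apply: sub_ideal_gen; exists t. Qed.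

Lemma irrelevant_ideal_ideal : ideal (irrelevant_ideal RG).
Proof. exact: ideal_gen_ideal. Qed.

Lemma irrelevant_pow i : ideal_pow (irrelevant_ideal RG) i%:Z = Rge i.
Proof.
apply/seteqP; split.
  elim: i => [|i IH]; first by move=> r _; apply: Rge0.
  rewrite ideal_powS; apply: (@submod_mul_sub R R^o); first exact: Rge_ideal.
  by move=> a b /irrelevant_sub ha /IH hb; rewrite -[i.+1]add1n; apply: Rge_mul.
move=> r hr; have [s [us -> _]] := gprojE sg_grading r.
apply: (@submod_sum R R^o); first exact: ideal_pow_ideal.
move=> t _; have [->|nz] := eqVneq (gproj RG t r) 0.
  by apply: (@submod0 R R^o); apply: ideal_pow_ideal.
have := RgeP hr nz; have := gproj_in sg_grading t r.
move: (gproj RG t r) => {nz us hr s}r hr it.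
have [n [x hx]] := sg_linear_generators; have [p [/homog_degP hp <-]] := sg_gen hx hr.
rewrite poly_evalE big_seq; apply: (@submod_sum R R^o).
  exact: ideal_pow_ideal.
move=> m; rewrite mcoeff_msupp => /hp dm; rewrite -mulr_algl.
apply: ideal_mull; first exact: ideal_pow_ideal.
apply: mmap1_ideal_pow => [j|]; last by rewrite -lez_nat dm.
by apply: (@irrelevant_homog 1) => //; apply: hx.1.
Qed.

End StandardGraded.

(** * Finiteness over the parameter subalgebra *)

Lemma ideal_gen_rangeP (R : comNzRingType) d (y : 'I_d -> R) u :
  ideal_gen (range y) u <-> exists a : 'I_d -> R, u = \sum_i a i * y i.
Proof.
split; last first.
  move=> [a ->]; apply: (@submod_sum R R^o); first exact: ideal_gen_ideal.
  by move=> i _; apply: ideal_gen_mull; apply: sub_ideal_gen; exists i.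
suff sub : ideal_gen (range y) `<=`
    [set u | exists a : 'I_d -> R, u = \sum_i a i * y i] by move/sub.
apply: ideal_gen_sub.
  apply/idealP; split.
    by exists (fun _ => 0); rewrite big1 // => i _; rewrite mul0r.
  move=> c _ _ [a ->] [b ->]; exists (fun i => c * a i + b i).
  by rewrite mulr_sumr -big_split; apply: eq_bigr => i _; rewrite mulrDl mulrA.
move=> _ [i _ <-]; exists (fun j => (j == i)%:R).
rewrite (bigD1 i) //= eqxx mul1r big1 ?addr0 // => j /negbTE ->.
by rewrite mul0r.
Qed.

(** The elements of [s] are scanned in turn, an element being kept when it is
    independent of the kept ones modulo [U]. *)
Lemma basis_modulo (k : fieldType) (V : lmodType k) (U : set V) (T : eqType)
    (t0 : T) (f : T -> V) (s : seq T) :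
  U 0 -> (forall (c : k) u v, U u -> U v -> U (c *: u + v)) ->
  exists b : seq T, [/\ {subset b <= s},
    forall c : nat -> k, U (\sum_(i < size b) c i *: f (nth t0 b i)) ->
      forall i, (i < size b)%N -> c i = 0
    & forall v, v \in s ->
      exists c : nat -> k, U (f v - \sum_(i < size b) c i *: f (nth t0 b i))].
Proof.
move=> U0 UL; elim: s => [|v s [b [bs ib sb]]].
  by exists [::]; split=> // c _ i; rewrite ltn0.
case: (pselect (exists c : nat -> k,
    U (f v - \sum_(i < size b) c i *: f (nth t0 b i)))) => [hv|nv].
  exists b; split=> // [w /bs|w]; first by rewrite inE => ->; rewrite orbT.
  by rewrite inE => /predU1P [->|/sb].
exists (v :: b); split.
- move=> w; rewrite !inE => /predU1P [->|/bs ->]; first by rewrite eqxx.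
  by rewrite orbT.
- move=> c; rewrite /= big_ord_recl /= => hU.
  have c0 : c 0%N = 0.
    apply/eqP; apply: contra_notT nv => c0.
    exists (fun i => - (c 0%N)^-1 * c i.+1).
    have /UL := hU => /(_ (c 0%N)^-1 0 U0); rewrite addr0 scalerDr scalerA.
    rewrite mulVf // scale1r scaler_sumr; congr (U (_ + _)).
    rewrite -sumrN; apply: eq_bigr => i _.
    by rewrite /bump /= add1n scalerA mulNr scaleNr opprK.
  case=> [//|i] ib'; move: hU; rewrite c0 scale0r add0r => hU.
  by apply: (ib (fun i => c i.+1)).
- move=> w; rewrite inE => /predU1P [->|/sb [c hc]].
    exists (fun i => (i == 0%N)%:R); rewrite /= big_ord_recl /= scale1r.
    rewrite big1 ?addr0 ?subrr // => i _; by rewrite scale0r.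
  exists (fun i => if i is j.+1 then c j else 0).
  by rewrite /= big_ord_recl /= scale0r add0r.
Qed.

Section FiniteOverParameters.
Variables (k : fieldType) (R : comAlgType k) (RG : int -> set R).
Hypothesis hR : standard_graded RG.
Variables (d : nat) (y : 'I_d -> R).
Hypothesis hy1 : forall i, RG 1 (y i).
Let J : set R := ideal_gen (range y).
Hypothesis hrad : radical J = irrelevant_ideal RG.

Let gRG := sg_grading hR.

Lemma params_homog t u : RG t u -> J u ->
  exists a : 'I_d -> R, (forall i, RG (t - 1) (a i)) /\ u = \sum_i a i * y i.
Proof.
move=> hu /ideal_gen_rangeP [a eu]; exists (fun i => gproj RG (t - 1) (a i)).
split=> [i|]; first exact: gproj_in.
rewrite -[u in LHS](_ : gproj RG t u = u); last by rewrite (gproj_id gRG _ hu) eqxx.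
rewrite {1}eu (gproj_bigsum gRG); apply: eq_bigr => i _.
by rewrite mulrC (gprojM hR _ _ (hy1 i)) mulrC.
Qed.

Lemma params_gproj t u : J u -> J (gproj RG t u).
Proof.
move=> /ideal_gen_rangeP [a ->]; rewrite (gproj_bigsum gRG).
apply: (@submod_sum R R^o); first exact: ideal_gen_ideal.
move=> i _; rewrite mulrC (gprojM hR _ _ (hy1 i)).
by apply: ideal_gen_mulr; apply: sub_ideal_gen; exists i.
Qed.

(** A monomial of large degree is divisible by a large power of some generator. *)
Lemma params_top : exists N : nat, forall t r, N%:Z <= t -> RG t r -> J r.
Proof.
have [n [x hx]] := sg_linear_generators hR.
have /choice [e he] : forall j, exists e, J (x j ^+ e).
  move=> j; have : irrelevant_ideal RG (x j).
    by apply: (@irrelevant_homog _ _ _ 1) => //; apply: hx.1.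
  by rewrite -hrad.
exists (\sum_j e j).+1 => t r Nt hr.
have [p [/homog_degP hp <-]] := sg_gen hR hx hr.
rewrite poly_evalE big_seq; apply: (@submod_sum R R^o).
  exact: ideal_gen_ideal.
move=> m; rewrite mcoeff_msupp => /hp dm; rewrite -mulr_algl.
apply: ideal_gen_mull.
have [j ej] : exists j, (e j <= m j)%N.
  apply/existsP; apply: contraTT Nt; rewrite negb_exists => /forallP h.
  rewrite -dm -ltNge ltz_nat ltnS mdegE; apply: leq_sum => j _.
  by have := h j; rewrite -ltnNge => /ltnW.
rewrite /mmap1 (bigD1 j) //= -(subnK ej) exprD -mulrA mulrCA.
by apply: (@ideal_gen_mulr R (range y)); apply: he.
Qed.

(** Graded Nakayama: subtracting the part of [r] spanned by the basis leaves a
    combination of the parameters whose coefficients have smaller degree. The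
    basis is selected among finitely many monomials, as monomials of large
    degree lie in the ideal of the parameters. *)
Lemma params_basis : exists (q : nat) (b : 'I_q -> R) (e : 'I_q -> nat),
  [/\ forall j, RG (e j)%:Z (b j),
    forall c : 'I_q -> k, J (\sum_j c j *: b j) -> forall j, c j = 0
    & forall t r, RG t r -> exists P : 'I_q -> {mpoly k[d]},
        (forall j, homog_deg (t - (e j)%:Z) (P j)) /\
        r = \sum_j poly_eval y (P j) * b j].
Proof.
have [N hN] := params_top.
have [n [x hx]] := sg_linear_generators hR.
pose s := [seq val m | m : 'X_{1..n < N}].
have sJ : ideal J by exact: ideal_gen_ideal.
have J0 : J 0 by exact: (@submod0 R R^o _ sJ).
have JL (c : k) u v : J u -> J v -> J (c *: u + v).
  move=> hu hv; rewrite -mulr_algl; exact: (@submodD R R^o J _ _ sJ (ideal_mull _ sJ hu) hv).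
have [l [ls il sl]] := basis_modulo 0%MM (mmap1 x) s J0 JL.
pose b (j : 'I_(size l)) := mmap1 x (nth 0%MM l j).
pose e (j : 'I_(size l)) := mdeg (nth 0%MM l j).
have hb j : RG (e j)%:Z (b j) by apply: (sg_mon hR) => //; apply: hx.1.
exists (size l), b, e; split=> //.
  move=> c hc j; pose c' i := if insub i is Some i' then c i' else 0.
  have cE i : c' (val i) = c i by rewrite /c' valK.
  rewrite -cE; apply: il; last exact: ltn_ord.
  by under eq_bigr do rewrite cE.
have span t r : RG t r -> exists c : 'I_(size l) -> k,
    J (r - \sum_j c j *: b j).
  move=> hr; have [Nt|tN] := leP N%:Z t.
    exists (fun _ => 0); rewrite big1 ?subr0; first exact: hN hr.
    by move=> j _; rewrite scale0r.
  have [p [/homog_degP hp <-]] := sg_gen hR hx hr.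
  have /choice [C hC] : forall m, exists c : nat -> k, m \in msupp p ->
      J (mmap1 x m - \sum_(i < size l) c i *: mmap1 x (nth 0%MM l i)).
    move=> m; case: (boolP (m \in msupp p)) => [mp|]; last by exists (fun _ => 0).
    have [|c hc] := sl m; last by exists c.
    move: mp; rewrite mcoeff_msupp => /hp mt.
    have mN : (mdeg m < N)%N by rewrite -ltz_nat mt.
    by apply/mapP; exists (BMultinom mN) => //; rewrite mem_enum.
  exists (fun j => \sum_(m <- msupp p) p@_m * C m j).
  rewrite poly_evalE.
  under [X in _ - X]eq_bigr do rewrite scaler_suml.
  rewrite exchange_big -sumrB big_seq; apply: (@submod_sum R R^o J) => // m mp.
  have -> : p@_m *: mmap1 x m - \sum_(i < size l) (p@_m * C m i) *: b i =
     p@_m *: (mmap1 x m - \sum_(i < size l) C m i *: b i) + 0.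
    rewrite addr0 scalerBr scaler_sumr; congr (_ - _).
    by apply: eq_bigr => i _; rewrite scalerA.
  by apply: JL => //; apply: hC.
have main T : forall t r, t < T%:Z -> RG t r ->
    exists P : 'I_(size l) -> {mpoly k[d]},
      (forall j, homog_deg (t - (e j)%:Z) (P j)) /\
      r = \sum_j poly_eval y (P j) * b j.
  elim: T => [|T IH] t r tT hr.
    exists (fun _ => 0); split=> [j|]; first exact: homog_deg0.
    rewrite (sg_neg hR tT hr) big1 // => j _; by rewrite poly_eval0 mul0r.
  have [c hc] := span t r hr.
  pose c' j : k := if (e j)%:Z == t then c j else 0.
  have hr' : gproj RG t (r - \sum_j c j *: b j) = r - \sum_j c' j *: b j.
    rewrite (gprojB gRG) (gproj_id gRG _ hr) eqxx; congr (_ - _).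
    rewrite (gproj_bigsum gRG); apply: eq_bigr => j _.
    rewrite (gprojZk hR) (gproj_id gRG _ (hb j)) /c' eq_sym.
    by case: ifP => //; rewrite scaler0 scale0r.
  have [a [ha ea]] := params_homog (gproj_in gRG t _) (params_gproj t hc).
  have /choice [P hP] : forall i, exists P : 'I_(size l) -> {mpoly k[d]},
      (forall j, homog_deg (t - 1 - (e j)%:Z) (P j)) /\
      a i = \sum_j poly_eval y (P j) * b j.
    by move=> i; apply: IH => //; rewrite ltrBlDr -PoszD addn1.
  exists (fun j => c' j *: 1 + \sum_i 'X_i * P i j); split=> [j|].
    apply: homog_degD.
      rewrite /c'; case: eqP => [<-|_]; last by rewrite scale0r; apply: homog_deg0.
      by rewrite subrr; apply: homog_degZ; apply: dhomog1.
    apply: homog_deg_sum => i _.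
    have -> : t - (e j)%:Z = 1 + (t - 1 - (e j)%:Z) by ring.
    by apply: homog_degM; [exact: homog_degXU|case: (hP i)].
  rewrite -[r in LHS](subrK (\sum_j c' j *: b j)) -hr' ea addrC.
  under [RHS]eq_bigr do rewrite poly_evalD mulrDl.
  rewrite big_split; congr (_ + _).
    by apply: eq_bigr => j _; rewrite poly_evalZ poly_eval1 mulr_algl.
  under [RHS]eq_bigr do rewrite poly_eval_sum mulr_suml.
  rewrite exchange_big; apply: eq_bigr => i _; rewrite (hP i).2 mulr_suml.
  by apply: eq_bigr => j _; rewrite poly_evalM poly_evalXU mulrC mulrA.
move=> t r hr; apply: (main `|t|.+1) => //.
by case: t {hr} => [t|t]; rewrite /= ?ltz_nat.
Qed.

Lemma params_generate (q : nat) (b : 'I_q -> R) (e : 'I_q -> nat) :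
  (forall t r, RG t r -> exists P : 'I_q -> {mpoly k[d]},
     (forall j, homog_deg (t - (e j)%:Z) (P j)) /\
     r = \sum_j poly_eval y (P j) * b j) ->
  forall r, exists P : 'I_q -> {mpoly k[d]}, r = \sum_j poly_eval y (P j) * b j.
Proof.
move=> gb r; have [s [_ -> _]] := gprojE gRG r.
elim/big_rec: _ => [|t x _ [P ->]].
  by exists (fun _ => 0); rewrite big1 // => j _; rewrite poly_eval0 mul0r.
have [Q [_ ->]] := gb _ _ (gproj_in gRG t r); exists (fun j => Q j + P j).
by rewrite -big_split; apply: eq_bigr => j _; rewrite poly_evalD mulrDl.
Qed.

End FiniteOverParameters.

(** * Algebraic independence *)

Section SplitVariable.
Variables (k : fieldType) (d : nat).
Implicit Types (p : {mpoly k[d]}) (m : 'X_{1..d}).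

Lemma mpoly_split (t : 'I_d) p : exists p0 p1, [/\ p = p0 + 'X_t * p1,
  forall m, p0@_m = if m t == 0%N then p@_m else 0
  & forall m, p1@_m = p@_(U_(t) + m)].
Proof.
pose p0 := \sum_(m <- msupp p | m t == 0%N) p@_m *: 'X_[m] : {mpoly k[d]}.
pose p1 := \sum_(m <- msupp p | m t != 0%N) p@_m *: 'X_[(m - U_(t))%MM] :
  {mpoly k[d]}.
have ep : p = p0 + 'X_t * p1.
  rewrite [LHS]mpolyE (bigID (fun m => m t == 0%N)) /=; congr (_ + _).
  rewrite mulr_sumr; apply: eq_bigr => m mt.
  by rewrite -scalerAr -mpolyXD addmC submK // lep1mP.
have e0 m : p0@_m = if m t == 0%N then p@_m else 0 by apply: mcoeff_filter.
exists p0, p1; split=> // m.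
rewrite -[LHS](mcoeffMX p1 U_(t)) mulrC; have := congr1 (mcoeff (U_(t) + m)) ep.
by rewrite mcoeffD e0 mnmDE mnm1E eqxx add1n add0r => ->.
Qed.

End SplitVariable.

(** In a combination of the [b j] with polynomials in [s] as coefficients that
    lies in [I 0], the parts of the coefficients without the first variable give
    a combination in [I 1], so they are zero by induction; as [s 0] is regular
    modulo [I 0], it can then be divided out. *)
Lemma regular_chain_indep (k : fieldType) (R : comAlgType k) (d q : nat)
    (s : 'I_d -> R) (I : nat -> set R) (b : 'I_q -> R) :
  (forall t, ideal (I t)) ->
  (forall t : 'I_d, I t `<=` I t.+1) ->
  (forall (t : 'I_d) r, I t.+1 (s t * r)) ->
  (forall (t : 'I_d) r, I t (s t * r) -> I t r) ->
  (forall c : 'I_q -> k, I d (\sum_j c j *: b j) -> forall j, c j = 0) ->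
  forall P : 'I_q -> {mpoly k[d]},
    I 0%N (\sum_j poly_eval s (P j) * b j) -> forall j, P j = 0.
Proof.
move=> hI incl mem reg ib.
suff main u : (u <= d)%N -> forall P : 'I_q -> {mpoly k[d]},
    (forall j m, (P j)@_m != 0 -> forall i : 'I_d, (i < d - u)%N -> m i = 0%N) ->
    I (d - u)%N (\sum_j poly_eval s (P j) * b j) -> forall j, P j = 0.
  by move=> P hP; apply: (main d) => //; rewrite subnn.
elim: u => [_ P Pc hP j|u IH ud P Pc hP j].
  rewrite subn0 in Pc hP.
  have Pj l : P l = ((P l)@_0%MM)%:MP.
    apply/mpolyP => m; rewrite mcoeffC; case: eqP => [->|m0]; first by rewrite mulr1.
    rewrite mulr0; apply/eqP; apply: contra_notT m0 => /Pc h.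
    by apply/mnmP => i; rewrite mnm0E h.
  rewrite Pj (ib (fun l => (P l)@_0%MM)) //.
  by move: hP; under eq_bigr do rewrite Pj poly_evalC mulr_algl.
have tlt : (d - u.+1 < d)%N by lia.
pose t := Ordinal tlt; have te : (d - u = t.+1)%N by rewrite /=; lia.
have {}IH := IH (ltnW ud); rewrite te in IH.
have [N hN] : exists N, forall j, (msize (P j) <= N)%N.
  by exists (\max_j msize (P j)) => l; apply: leq_bigmax.
elim: N P Pc hP hN j => [|N IHN] P Pc hP hN j.
  by apply/eqP; rewrite -msize_poly_eq0 -leqn0.
have /choice [P0 /choice [P1 hS]] := fun l => mpoly_split t (P l).
have z0 : forall l, P0 l = 0.
  apply: IH => [l m|].
    case: (hS l) => _ -> _; case: (eqVneq (m t) 0%N) => [mt /Pc h i|_]; last by rewrite eqxx.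
    rewrite ltnS leq_eqVlt => /predU1P [e|/h //].
    by rewrite (val_inj e : i = t).
  have -> : \sum_l poly_eval s (P0 l) * b l =
     \sum_l poly_eval s (P l) * b l - s t * (\sum_l poly_eval s (P1 l) * b l).
    rewrite mulr_sumr -sumrB; apply: eq_bigr => l _.
    case: (hS l) => -> _ _; rewrite poly_evalD poly_evalM poly_evalXU.
    by rewrite mulrA -mulrBl addrK.
  apply: (@submodB R R^o _ _ _ (hI _)); first exact: incl.
  exact: mem.
have PE l : P l = 'X_t * P1 l by have [e _ _] := hS l; rewrite [LHS]e z0 add0r.
have z1 : forall l, P1 l = 0.
  apply: IHN => [l m||l].
  - case: (hS l) => _ _ -> /Pc h i /h; rewrite mnmDE; lia.
  - apply: (reg t); move: hP.
    under eq_bigr do rewrite PE poly_evalM poly_evalXU -mulrA.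
    by rewrite -mulr_sumr.
  - rewrite msizeE; apply/bigmax_leqP_seq => m; rewrite mcoeff_msupp => hm _.
    case: (hS l) => _ _ e1; rewrite e1 -mcoeff_msupp in hm.
    by have := leq_trans (msize_mdeg_lt hm) (hN l); rewrite mdegD mdeg1 add1n ltnS.
by rewrite PE z1 mulr0.
Qed.

Lemma linear_dependence (k : fieldType) (V : lmodType k) (T1 T2 : finType)
    (u : T1 -> V) (v : T2 -> V) (C : T1 -> T2 -> k) :
  (#|T2| < #|T1|)%N -> (forall i, u i = \sum_j C i j *: v j) ->
  exists c : T1 -> k, (exists i, c i != 0) /\ \sum_i c i *: u i = 0.
Proof.
move=> lt21 hu; pose A : 'M[k]_(#|T1|, #|T2|) :=
  \matrix_(i, j) C (enum_val i) (enum_val j).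
have : kermx A != 0.
  rewrite -mxrank_eq0 mxrank_ker subn_eq0 -ltnNge.
  exact: leq_ltn_trans (rank_leq_col A) lt21.
case/rowV0Pn=> w /sub_kermxP wA w0.
have [i wi] : exists i, w 0 i != 0.
  apply/existsP; apply: contraNT w0; rewrite negb_exists => /forallP h.
  apply/eqP/rowP => i; rewrite mxE; apply/eqP; have := h i; by rewrite negbK.
exists (fun z => w 0 (enum_rank z)); split.
  by exists (enum_val i); rewrite enum_valK.
under eq_bigr do rewrite hu scaler_sumr.
rewrite exchange_big big1 // => j _.
have /rowP/(_ (enum_rank j)) := wA; rewrite !mxE => e.
under eq_bigr do rewrite scalerA.
rewrite -scaler_suml (_ : \sum_i _ = 0) ?scale0r // -[RHS]e.
rewrite (reindex (fun i : 'I_#|T1| => enum_val i)) /=; last first.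
  by apply: onW_bij; apply: enum_val_bij.
by apply: eq_bigr => l _; rewrite !mxE enum_valK enum_rankK.
Qed.

Section Growth.
Variables (k : fieldType) (R : comAlgType k) (RG : int -> set R).
Hypothesis hR : standard_graded RG.
Let gRG := sg_grading hR.

Definition Rle (N : nat) : set R :=
  [set r | forall t, N%:Z < t -> gproj RG t r = 0].

Lemma Rle_mul M N a b : Rle M a -> Rle N b -> Rle (M + N) (a * b).
Proof.
move=> ha hb t Nt; have [s [_ ea _]] := gprojE gRG a; rewrite ea.
rewrite mulr_suml (gproj_bigsum gRG) big1 // => l _.
rewrite (gprojM hR _ _ (gproj_in gRG _ _)).
have [li|il] := ltP M%:Z l; first by rewrite ha // mul0r.
rewrite hb ?mulr0 // ltrBrDr; apply: le_lt_trans Nt.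
by rewrite PoszD addrC lerD2r.
Qed.

Lemma Rle_one N : Rle N 1.
Proof.
move=> t Nt; rewrite (gproj_id gRG _ (sg_one hR)); case: eqP => // e.
by move: Nt; rewrite e.
Qed.

Lemma Rle_exp N a e : Rle N a -> Rle (N * e) (a ^+ e).
Proof.
move=> ha; elim: e => [|e IH]; first exact: Rle_one.
by rewrite exprS mulnS; apply: Rle_mul.
Qed.

Lemma Rle_leq M N : (M <= N)%N -> Rle M `<=` Rle N.
Proof. by move=> MN r hr t Nt; apply: hr; apply: le_lt_trans Nt; rewrite lez_nat. Qed.

Lemma Rle_exists r : exists N, Rle N r.
Proof.
have [s [_ _ sr]] := gprojE gRG r.
exists (\max_(t <- s) `|t|)%N => t; case: (boolP (t \in s)) => [ts|/sr //].
have h : (`|t|%N <= \max_(t <- s) `|t|)%N by apply: leq_bigmax_seq.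
lia.
Qed.

Lemma Rle_mmap1 d (s : 'I_d -> R) E m : (forall i, Rle E (s i)) ->
  Rle (E * mdeg m) (mmap1 s m).
Proof.
move=> hs; rewrite /mmap1 mdegE big_distrr /=.
elim/big_rec2: _ => [|i N a _ IH]; first exact: Rle_one.
by apply: Rle_mul => //; apply: Rle_exp.
Qed.

Variables (d : nat) (y : 'I_d -> R).
Hypothesis hy1 : forall i, RG 1 (y i).
Hypothesis hrad : radical (ideal_gen (range y)) = irrelevant_ideal RG.

(** Division by [p] with respect to a degree-compatible monomial order: the
    leading monomial of [p] can be replaced by the other terms, which are
    smaller and hence of no larger degree. *)
Lemma relation_normal_form (p : {mpoly k[d]}) : p != 0 -> poly_eval y p = 0 ->
  forall m, exists N : {mpoly k[d]}, poly_eval y N = mmap1 y m /\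
    forall m', N@_m' != 0 -> ~~ (mlead p <= m')%MM /\ (mdeg m' <= mdeg m)%N.
Proof.
move=> p0 ep; elim/(well_founded_ind (@ltom_wf d)) => m IH.
have [pm|pm] := boolP (mlead p <= m)%MM; last first.
  exists 'X_[m]; split=> [|m']; first exact: poly_evalX.
  by rewrite mcoeffX; case: (m =P m') => [<-|_] //; rewrite eqxx.
have /choice [N hN] : forall l, exists N : {mpoly k[d]}, (l < mlead p)%O ->
    poly_eval y N = mmap1 y (l + (m - mlead p))%MM /\
    forall m', N@_m' != 0 -> ~~ (mlead p <= m')%MM /\ (mdeg m' <= mdeg m)%N.
  move=> l; have [lp|_] := boolP (l < mlead p)%O; last by exists 0.
  have lm : ((l + (m - mlead p))%MM < m)%O.
    by rewrite -[X in (_ < X)%O](submK pm) [X in (_ < X)%O]addmC ltmc_add2l.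
  have [N [eN hN]] := IH _ lm; exists N => _; split=> // m' /hN [h1 h2].
  by split=> //; apply: leq_trans h2 _; apply: lemc_mdeg; apply: ltW.
have c0 : p@_(mlead p) != 0 by rewrite mleadc_eq0.
exists (\sum_(l <- msupp p | l != mlead p) (- (p@_(mlead p))^-1 * p@_l) *: N l).
have lt l : l \in msupp p -> l != mlead p -> (l < mlead p)%O.
  by move=> lp ne; rewrite lt_neqAle ne msupp_le_mlead.
split; last first.
  move=> m'; rewrite raddf_sum /= => nz.
  have [l /andP [lp ne] nl] : exists2 l, (l \in msupp p) && (l != mlead p) & (N l)@_m' != 0.
    apply/exists2P; apply: contraNP nz => h; rewrite big_seq_cond big1 // => l hl.
    rewrite mcoeffZ; case: (eqVneq (N l)@_m' 0) => [->|nl]; first by rewrite mulr0.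
    by case: h; exists l.
  by case: (hN _ (lt _ lp ne)) => _; apply.
rewrite poly_eval_sum; under eq_bigr do rewrite poly_evalZ.
rewrite big_seq_cond (eq_bigr (fun l => - (p@_(mlead p))^-1 *:
   (p@_l *: mmap1 y l * mmap1 y (m - mlead p)%MM))); last first.
  move=> l /andP [lp ne]; case: (hN _ (lt _ lp ne)) => -> _.
  by rewrite mmap1M -scalerAl scalerA.
rewrite -scaler_sumr -mulr_suml -big_seq_cond.
have := ep; rewrite poly_evalE (bigD1_seq (mlead p)) ?mlead_supp ?msupp_uniq //=.
move/eqP; rewrite addrC addr_eq0 => /eqP ->.
rewrite mulNr scalerN scaleNr opprK -scalerAl scalerA mulVf // scale1r -mmap1M.
by rewrite addmC submK.
Qed.

(** A relation between the parameters would make the dimension of [Rle N] grow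
    like [N ^ d.-1], whereas the monomials in [d] algebraically independent
    elements force it to grow like [N ^ d]. *)
Lemma params_alg_indep (s : 'I_d -> R) :
  (forall p, poly_eval s p = 0 -> p = 0) ->
  forall p, poly_eval y p = 0 -> p = 0.
Proof.
move=> sind p ep; apply/eqP; apply: contraT => p0.
have [q [b [e [hb _ gb]]]] := params_basis hR hy1 hrad.
have [E hE] : exists E, forall i, Rle E (s i).
  have /choice [E hE] : forall i, exists E, Rle E (s i).
    by move=> i; apply: Rle_exists.
  exists (\max_i E i)%N => i; apply: Rle_leq (hE i); exact: leq_bigmax.
have NF := relation_normal_form p0 ep.
pose mu := mlead p; pose B := mdeg mu.
(* [Rle N] lies in the span of the products of a basis element and a monomial of
   degree at most [N] that has some exponent smaller than that of the leading
   monomial [mu]; [M] makes the [M ^ d] monomials in [s] with exponents below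
   [M], which all lie in [Rle N], outnumber them. *)
pose M := (q * d * B * (d * E).+1 ^ d.-1).+1.
pose N := (E * (d * M))%N.
pose T2 := ('I_q * ('I_d * 'I_B * {ffun 'I_d.-1 -> 'I_N.+1}))%type.
pose mon (i : 'I_d) (l : nat) (g : {ffun 'I_d.-1 -> 'I_N.+1}) : 'X_{1..d} :=
  [multinom (if unlift i j is Some h then val (g h) else l) | j < d].
pose v (z : T2) : R := mmap1 y (mon z.2.1.1 z.2.1.2 z.2.2) * b z.1.
pose inSpan r := exists C : T2 -> k, r = \sum_z C z *: v z.
have span0 : inSpan 0.
  by exists (fun _ => 0); rewrite big1 // => z _; rewrite scale0r.
have spanL c r1 r2 : inSpan r1 -> inSpan r2 -> inSpan (c *: r1 + r2).
  move=> [C1 ->] [C2 ->]; exists (fun z => c * C1 z + C2 z).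
  rewrite scaler_sumr -big_split; apply: eq_bigr => z _.
  by rewrite scalerDl scalerA.
have spanS (I : eqType) (r : seq I) (c : I -> k) (F : I -> R) :
    (forall i, i \in r -> inSpan (F i)) -> inSpan (\sum_(i <- r) c i *: F i).
  move=> hF; rewrite big_seq; elim/big_rec: _ => [|i x ir hx]; first exact: span0.
  by apply: spanL => //; apply: hF.
have span_normal j m : ~~ (mu <= m)%MM -> (mdeg m <= N)%N ->
    inSpan (mmap1 y m * b j).
  move=> nm mN; have [i mi] : exists i, (m i < mu i)%N.
    apply/existsP; apply: contraNT nm; rewrite negb_exists => /forallP h.
    by apply/mnm_lepP => i; have := h i; rewrite -leqNgt.
  have leN i' : (m i' < N.+1)%N.
    by rewrite ltnS (leq_trans _ mN) // mdegE (bigD1 i') //= leq_addr.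
  have lB : (m i < B)%N.
    by apply: leq_trans mi _; rewrite /B mdegE (bigD1 i) //= leq_addr.
  pose g := [ffun h : 'I_d.-1 => Ordinal (leN (lift i h))].
  have em : mon i (m i) g = m.
    apply/mnmP => j'; rewrite mnmE; case: unliftP => [h ->|-> //].
    by rewrite ffunE.
  pose z : T2 := (j, (i, Ordinal lB, g)).
  exists (fun z' => (z' == z)%:R); rewrite (bigD1 z) //= eqxx scale1r big1.
    by rewrite addr0 /v /= em.
  by move=> z' /negbTE ->; rewrite scale0r.
have span_mon j m : (mdeg m <= N)%N -> inSpan (mmap1 y m * b j).
  move=> mN; have [Q [<- hQ]] := NF m.
  rewrite poly_evalE mulr_suml; under eq_bigr do rewrite -scalerAl.
  apply: (spanS) => m'; rewrite mcoeff_msupp => /hQ [nm' m'm].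
  by apply: span_normal => //; apply: leq_trans mN.
have span_le r : Rle N r -> inSpan r.
  move=> hr; have [S [_ -> _]] := gprojE gRG r.
  under eq_bigr do rewrite -[gproj _ _ _]scale1r.
  apply: (spanS) => t _.
  have [Nt|tN] := ltP N%:Z t; first by rewrite hr.
  have [P [hP ->]] := gb _ _ (gproj_in gRG t r).
  under eq_bigr do rewrite -[_ * _]scale1r.
  apply: (spanS) => j _; rewrite poly_evalE mulr_suml.
  under eq_bigr do rewrite -scalerAl.
  apply: (spanS) => m; rewrite mcoeff_msupp => /((homog_degP _ _).1 (hP j)) hm.
  apply: span_mon; lia.
pose fm (f : {ffun 'I_d -> 'I_M}) : 'X_{1..d} := [multinom val (f i) | i < d].
have fm_inj : injective fm.
  move=> f g /mnmP h; apply/ffunP => i; apply: val_inj.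
  by have := h i; rewrite !mnmE.
have /choice [C hC] : forall f, inSpan (mmap1 s (fm f)).
  move=> f; apply: span_le; apply: (Rle_leq _ (Rle_mmap1 hE)).
  rewrite leq_mul2l; apply/orP; right; rewrite mdegE.
  rewrite -[X in (_ <= X * _)%N]card_ord -sum_nat_const; apply: leq_sum => i _.
  by rewrite mnmE ltnW // ltn_ord.
have card_lt : (#|{: T2}| < #|{: {ffun 'I_d -> 'I_M}}|)%N.
  rewrite !card_prod !card_ffun !card_ord.
  have [d0|dpos] := posnP d; first by rewrite [X in (_ * (X * _ * _))%N]d0 !mul0n muln0 d0.
  have N1 : (N.+1 <= (d * E).+1 * M)%N.
    by rewrite /N mulnCA mulnA mulSn -add1n leq_add.
  apply: (@leq_ltn_trans (q * (d * B * ((d * E).+1 * M) ^ d.-1))).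
    rewrite !leq_mul2l; case: (d.-1) => [|f]; first by rewrite !expn0 !orbT.
    by rewrite leq_exp2r // N1 !orbT.
  rewrite -[X in (_ < _ ^ X)%N](prednK dpos) expnS expnMn !mulnA.
  by rewrite ltn_pmul2r ?expn_gt0.
have [c [[f cf] ec]] := linear_dependence card_lt hC.
have z : \sum_f c f *: 'X_[fm f] = 0 :> {mpoly k[d]}.
  apply: sind; rewrite poly_eval_sum -[RHS]ec; apply: eq_bigr => g _.
  by rewrite poly_evalZ poly_evalX.
have := congr1 (mcoeff (fm f)) z; rewrite raddf_sum mcoeff0 /= (bigD1 f) //=.
rewrite mcoeffZ mcoeffX eqxx mulr1 big1 ?addr0 => [e0|g gf].
  by rewrite e0 eqxx in cf.
by rewrite mcoeffZ mcoeffX (inj_eq fm_inj) (negbTE gf) mulr0.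
Qed.

End Growth.

(** * Prime ideals and going up *)

Section PrimeAvoiding.
Variables (R : comNzRingType) (I S : set R).
Hypotheses (hI : ideal I) (S1 : S 1) (SM : forall a b, S a -> S b -> S (a * b)).
Hypothesis IS : forall a, I a -> ~ S a.

(** Krull: by Zorn there is an ideal maximal among those that contain [I] and
    avoid the multiplicative set [S], and such an ideal is prime. *)
Lemma prime_avoiding :
  exists P, [/\ prime_ideal P, I `<=` P & forall a, P a -> ~ S a].
Proof.
pose good X := [/\ ideal X, I `<=` X & forall a, X a -> ~ S a].
have [|A [A0 Amax]] := @Zorn_bigcup _ [set X | X = set0 \/ good X].
  move=> F FP Ftot; case: (pselect (exists2 X, F X & good X)) => [[X FX gX]|nX].
    right; split.
    - apply/idealP; split; first by exists X => //; case: gX => /submod0 X0 _ _.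
      move=> a u v [X1 F1 u1] [X2 F2 v2].
      have gd Z z : F Z -> Z z -> ideal Z.
        by move=> /FP /= [-> //|[]].
      case: (Ftot _ _ F1 F2) => [s12|s21].
        exists X2 => //; apply: (@submodD R R^o _ _ _ (gd _ _ F2 v2)) => //.
        exact: (ideal_mull _ (gd _ _ F2 v2) (s12 _ u1)).
      exists X1 => //; apply: (@submodD R R^o _ _ _ (gd _ _ F1 u1)) => //.
        exact: (ideal_mull _ (gd _ _ F1 u1) u1).
      exact: s21.
    - by move=> a Ia; exists X => //; case: gX => _ h _; apply: h.
    - by move=> a [Z /FP [->//|[_ _ h]]]; apply: h.
  left; apply/seteqP; split=> // a [Z FZ Za].
  by case: (FP _ FZ) => [Z0|gZ]; [move: Za; rewrite Z0|case: nX; exists Z].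
have gI : good I by split.
case: A0 => [A0|[hA IA AS]].
  case: (Amax I); last by right.
  split; first by rewrite A0.
  by rewrite A0 => /(_ 0 (@submod0 R R^o _ hI)).
exists A; split=> //; apply/prime_idealP; split=> //; first by move/AS.
have big u : ~ A u -> exists a r, A a /\ S (a + r * u).
  move=> nu; apply: contrapT => h.
  pose B := [set x | exists a r, A a /\ x = a + r * u].
  have AB : A `<=` B by move=> a Aa; exists a, 0; rewrite mul0r addr0.
  apply: (Amax B).
    split=> // BA; apply: nu; apply: BA; exists 0, 1.
    by rewrite mul1r add0r; split=> //; apply: (@submod0 R R^o _ hA).
  right; split.
  - apply/idealP; split; first by apply: AB; apply: (@submod0 R R^o _ hA).
    move=> c _ _ [a1 [r1 [A1 ->]]] [a2 [r2 [A2 ->]]].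
    exists (c * a1 + a2), (c * r1 + r2); split; last by ring.
    by apply: (@submodD R R^o _ _ _ hA) => //; apply: ideal_mull.
  - by move=> a /IA /AB.
  - by move=> _ [a [r [Aa ->]]] Sx; apply: h; exists a, r.
move=> u v Auv; apply: contrapT => /not_orP [/big [a [r [Aa Sa]]] /big [b [t [Ab Sb]]]].
apply: (AS _ _ (SM Sa Sb)).
have -> : (a + r * u) * (b + t * v) =
  (b + t * v) * a + ((r * u) * b + (r * t) * (u * v)) by ring.
apply: (@submodD R R^o _ _ _ hA); first exact: ideal_mull.
by apply: (@submodD R R^o _ _ _ hA); apply: ideal_mull.
Qed.

End PrimeAvoiding.

Lemma prime_above (R : comNzRingType) (I : set R) : ideal I -> ~ I 1 ->
  exists P, prime_ideal P /\ I `<=` P.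
Proof.
move=> hI I1; have [||a Ia a1|P [pP IP _]] := @prime_avoiding R I [set 1] hI.
- by [].
- by move=> a b -> ->; rewrite mulr1.
- by apply: I1; rewrite -a1.
- by exists P.
Qed.

Lemma top_of_chain_maximal (R : comNzRingType) d (P : nat -> set R) :
  krull_dim R d -> prime_chain d P -> maximal_ideal (P d).
Proof.
move=> [_ nchain] [pP sP]; have [iP nP _] := (prime_idealP _).1 (pP d (leqnn d)).
split; first exact/proper_idealP.
move=> Q /proper_idealP [iQ nQ] PQ; have [P' [pP' QP']] := prime_above iQ nQ.
apply: contrapT => nQP; apply: nchain.
exists (fun i => if (i <= d)%N then P i else P'); split=> i.
  by case: ifP => [id _|_ _] //; apply: pP.
move=> h; have /predU1P [->|id] : (i == d) || (i < d)%N by rewrite -leq_eqVlt -ltnS.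
  rewrite leqnn ltnn; split=> [a /PQ /QP' //|P'P].
  by apply: nQP => a /QP' /P'P.
by rewrite (ltnW id) id; apply: sP.
Qed.

Lemma chain_le_height (R : comNzRingType) d h (P : nat -> set R) :
  prime_chain d P -> prime_height (P d) h -> (d <= h)%N.
Proof.
move=> [pP sP] [_ nc]; rewrite leqNgt; apply/negP => hd; apply: nc.
exists (fun i => P (d - h.+1 + i)%N); rewrite subnK //; split=> //; split=> i ih.
  by apply: pP; rewrite -[X in (_ <= X)%N](subnK hd) leq_add2l.
by rewrite addnS; apply: sP; rewrite -[X in (_ < X)%N](subnK hd) ltn_add2l.
Qed.

(** The chain bounds the height of its last prime from below, and at a maximal
    ideal of a Cohen-Macaulay ring the height is the grade. *)
Lemma cm_regular_seq (R : comNzRingType) d (P : nat -> set R) :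
  cohen_macaulay R -> prime_chain d P -> maximal_ideal (P d) ->
  exists s, [/\ regular_seq s, [set` s] `<=` P d & (d <= size s)%N].
Proof.
move=> cm cP /cm [h [hh [[s [rs sP ss]] _]]]; exists s; split=> //.
by rewrite ss; apply: chain_le_height hh.
Qed.

(** The case of a single element [b], equal to [1], which lies outside the ideal
    generated by the sequence. *)
Lemma regular_seq_alg_indep (k : fieldType) (R : comAlgType k) (d : nat) (s : seq R) :
  regular_seq s -> (d <= size s)%N ->
  forall p : {mpoly k[d]}, poly_eval (fun i : 'I_d => s`_i) p = 0 -> p = 0.
Proof.
move=> [s1 rs] ds p ep.
pose I t : set R := ideal_gen [set` take t s].
have iI t : ideal (I t) by exact: ideal_gen_ideal.
apply: (@regular_chain_indep k R d 1 (fun i : 'I_d => s`_i) I (fun _ => 1) iI _ _ _ _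
  (fun _ => p) _ ord0).
- move=> t; apply: ideal_gen_sub; first exact: iI.
  move=> x /= xt; apply: sub_ideal_gen => /=.
  by move: xt; rewrite -(take_takel s (leqnSn t)) => /mem_take.
- move=> t r; apply: (ideal_mulr _ (iI _)).
  apply: sub_ideal_gen => /=; have ts : (t < size s)%N by apply: leq_trans ds.
  by rewrite (take_nth 0) // mem_rcons mem_head.
- by move=> t r; apply: rs; apply: leq_trans ds.
- move=> c; rewrite big_ord1 => hc j; rewrite (ord1 j).
  apply/eqP; apply: contra_notT s1 => c0.
  have := ideal_mull ((c ord0)^-1)%:A (iI d) hc.
  rewrite mulr_algl scalerA mulVf // scale1r.
  apply: ideal_gen_sub; first exact: ideal_gen_ideal.
  by move=> x /= /mem_take xs; apply: sub_ideal_gen.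
- by rewrite big_ord1 ep mul0r; apply: (@submod0 R R^o _ (iI 0%N)).
Qed.

Lemma poly_eval_comp (k : fieldType) (R : comAlgType k) (n d : nat)
    (z : 'I_d -> R) (w : 'I_n -> {mpoly k[d]}) p :
  poly_eval z (poly_eval w p) = poly_eval (fun j => poly_eval z (w j)) p.
Proof.
rewrite [poly_eval w p]poly_evalE poly_eval_sum [RHS]poly_evalE; apply: eq_bigr => m _.
rewrite poly_evalZ; congr (_ *: _).
rewrite /mmap1 (big_morph (poly_eval z) (poly_evalM z) (poly_eval1 z)).
by apply: eq_bigr => i _; rewrite poly_evalXn.
Qed.

Lemma eq_poly_eval (k : fieldType) (R : comAlgType k) (n : nat)
    (z w : 'I_n -> R) p : z =1 w -> poly_eval z p = poly_eval w p.
Proof.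
by move=> zw; rewrite !poly_evalE; apply: eq_bigr => m _; rewrite (mmap1_eq _ zw).
Qed.

Lemma poly_eval_id (k : fieldType) (n : nat) (p : {mpoly k[n]}) :
  poly_eval (fun j => 'X_j : {mpoly k[n]}) p = p.
Proof.
by rewrite poly_evalE [RHS]mpolyE; apply: eq_bigr => m _; rewrite mmap1_id.
Qed.

(** The Cayley-Hamilton argument. *)
Lemma finite_integral (k : fieldType) (R : comAlgType k) (d q : nat)
    (y : 'I_d -> R) (b : 'I_q -> R) :
  (forall r, exists P : 'I_q -> {mpoly k[d]}, r = \sum_j poly_eval y (P j) * b j) ->
  forall r, exists (N : nat) (c : 'I_N -> {mpoly k[d]}),
    r ^+ N + \sum_i poly_eval y (c i) * r ^+ i = 0.
Proof.
move=> gb r; have /choice [C hC] := fun j => gb (r * b j).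
pose f := mmap (in_alg R) y : {rmorphism {mpoly k[d]} -> R}.
pose A : 'M[{mpoly k[d]}]_q := \matrix_(i, j) C i j.
pose chi := char_poly A; pose chiR := map_poly f chi.
have rootchi : chiR.[r] = 0.
  pose B : 'M[R]_q := r%:M - map_mx f A.
  have detB : chiR.[r] = \det B.
    rewrite /chiR map_char_poly /char_poly -/(horner_eval r _) -det_map_mx.
    congr (\det _); apply/matrixP => i j; rewrite !mxE.
    by rewrite -/(horner_eval r _) rmorphB rmorphMn /= /horner_eval hornerX hornerC.
  pose bc : 'cV[R]_q := \col_j b j.
  have Bb : B *m bc = 0.
    apply/colP => i; rewrite mulmxBl mxE mul_scalar_mx !mxE hC.
    apply/eqP; rewrite subr_eq0; apply/eqP; apply: eq_bigr => j _.
    by rewrite !mxE.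
  have db j : \det B * b j = 0.
    have : \adj B *m (B *m bc) = 0 by rewrite Bb mulmx0.
    by rewrite mulmxA mul_adj_mx mul_scalar_mx => /colP/(_ j); rewrite !mxE.
  have [P e1] := gb 1; rewrite detB -[LHS]mulr1 e1 mulr_sumr big1 // => j _.
  by rewrite mulrCA db mulr0.
have sz : size chiR = q.+1.
  rewrite /chiR size_map_poly_id0 ?size_char_poly //.
  by rewrite (monicP (char_poly_monic A)) rmorph1 oner_eq0.
exists q, (fun i => chi`_i); rewrite -[RHS]rootchi horner_coef sz big_ord_recr /= [RHS]addrC.
congr (_ + _).
  have lc : chi`_q = 1 by have := monicP (char_poly_monic A); rewrite lead_coefE size_char_poly.
  by rewrite /chiR coef_map /= lc rmorph1 mul1r.
by apply: eq_bigr => i _; rewrite /chiR coef_map.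
Qed.

Section GoingUp.
Variables (k : fieldType) (R : comAlgType k) (d : nat) (y : 'I_d -> R).
Hypothesis yind : forall p : {mpoly k[d]}, poly_eval y p = 0 -> p = 0.
Hypothesis yint : forall r, exists (N : nat) (c : 'I_N -> {mpoly k[d]}),
  r ^+ N + \sum_i poly_eval y (c i) * r ^+ i = 0.

(** Substitution of zero for the first [i] variables; its kernel is the prime
    ideal generated by them. *)
Let kill (i : nat) (p : {mpoly k[d]}) : {mpoly k[d]} :=
  poly_eval (fun j : 'I_d => if (j < i)%N then 0 else 'X_j) p.

Let kill_next i p : kill i p = 0 -> kill i.+1 p = 0.
Proof.
move=> e; have -> : kill i.+1 p = kill i.+1 (kill i p).
  rewrite /kill poly_eval_comp; apply: eq_poly_eval => j.
  case: ifP => ji; case: ifP => ji'; rewrite ?poly_eval0 ?poly_evalXU ?ji //.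
  by rewrite ltnS ltnW // in ji.
by rewrite e /kill poly_eval0.
Qed.

(** A prime contracting to the ideal of the first [i] variables; the chain is
    built by going up along these primes of the polynomial ring. *)
Let lies_over i (P : set R) := [/\ prime_ideal P,
  forall p, P (poly_eval y p) -> kill i p = 0
  & forall j : 'I_d, (j < i)%N -> P (y j)].

Let subrXX_ideal (P : set R) u v n : ideal P -> P (u - v) -> P (u ^+ n - v ^+ n).
Proof. by move=> iP Puv; rewrite subrXX; apply: ideal_mulr. Qed.

(** If [poly_eval y p = u + y j * r] with [u] in [P], then an integral equation
    for [r] over the polynomials in [y] gives one for [y j * r], which reads
    modulo [P] as a relation [p ^ N + ... = 0] whose other terms are divisible
    by the variable [j]. *)
Let lies_over_next (j : 'I_d) P : lies_over j P ->
  exists P', lies_over j.+1 P' /\ P `<=` P'.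
Proof.
move=> [pP over hP]; have [iP nP _] := (prime_idealP P).1 pP.
pose I := [set x | exists u r, P u /\ x = u + y j * r].
have PI : P `<=` I by move=> u Pu; exists u, 0; rewrite mulr0 addr0.
have [||||P' [pP' IP' disj]] :=
    @prime_avoiding R I [set x | exists p, kill j.+1 p != 0 /\ x = poly_eval y p].
- apply/idealP; split; first by apply: PI; apply: (@submod0 R R^o _ iP).
  move=> c _ _ [u1 [r1 [P1 ->]]] [u2 [r2 [P2 ->]]].
  exists (c * u1 + u2), (c * r1 + r2); split; last by ring.
  by apply: (@submodD R R^o _ _ _ iP) => //; apply: ideal_mull.
- by exists 1; rewrite /kill !poly_eval1 oner_eq0.
- move=> _ _ [p [p0 ->]] [p' [p'0 ->]]; exists (p * p'); rewrite -poly_evalM; split=> //.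
  by rewrite /kill poly_evalM mulf_neq0.
- move=> _ [u [r [Pu ->]]] [p [p0 ep]].
  have [N [c ec]] := yint r.
  pose p' := p ^+ N + \sum_i c i * 'X_j ^+ (N - i) * p ^+ i.
  have key : (y j * r) ^+ N +
      \sum_i poly_eval y (c i) * y j ^+ (N - i) * (y j * r) ^+ i = 0.
    have := congr1 ( *%R (y j ^+ N)) ec.
    rewrite mulr0 mulrDr -exprMn mulr_sumr => e; rewrite -[RHS]e.
    congr (_ + _); apply: eq_bigr => i _.
    have -> : y j ^+ N = y j ^+ (N - i) * y j ^+ i by rewrite -exprD subnK // ltnW.
    by rewrite exprMn; ring.
  have Pp' : P (poly_eval y p').
    have -> : poly_eval y p' = (poly_eval y p ^+ N - (y j * r) ^+ N) +
       \sum_i poly_eval y (c i) * y j ^+ (N - i) *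
         (poly_eval y p ^+ i - (y j * r) ^+ i).
      under [in RHS]eq_bigr do rewrite mulrBr.
      rewrite sumrB addrACA -opprD key subr0 poly_evalD poly_evalXn poly_eval_sum.
      congr (_ + _); apply: eq_bigr => i _.
      by rewrite !poly_evalM !poly_evalXn poly_evalXU.
    have Puy n : P (poly_eval y p ^+ n - (y j * r) ^+ n).
      by apply: subrXX_ideal => //; rewrite -ep addrK.
    apply: (@submodD R R^o _ _ _ iP) => //.
    by apply: (@submod_sum R R^o _ _ _ _ _ iP) => i _; apply: ideal_mull.
  have := kill_next (over _ Pp'); rewrite /kill poly_evalD poly_evalXn poly_eval_sum.
  rewrite big1 ?addr0 => [/eqP|i _].
    by rewrite expf_eq0 => /andP [_]; apply/negP.
  rewrite !poly_evalM poly_evalXn poly_evalXU ltnSn expr0n.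
  by rewrite subn_eq0 leqNgt ltn_ord mulr0 mul0r.
exists P'; split; last by move=> u /PI /IP'.
split=> // [p Pp|i].
  by apply/eqP; apply: contraPT Pp => p0 /disj; apply; exists p.
rewrite ltnS leq_eqVlt => /predU1P [e|ij]; last by apply/IP'/PI/hP.
rewrite (val_inj e : i = j); apply: IP'; exists 0, 1.
by rewrite mulr1 add0r; split=> //; apply: (@submod0 R R^o _ iP).
Qed.

(** The zero ideal of the polynomial ring is contracted from a prime because the
    elements [y] are algebraically independent; the inclusions are strict as the
    contractions differ. *)
Lemma going_up_chain : exists P : nat -> set R,
  prime_chain d P /\ forall j : 'I_d, P d (y j).
Proof.
suff main i : (i <= d)%N -> exists P : nat -> set R,
    (forall j, (j <= i)%N -> lies_over j (P j)) /\
    (forall j, (j < i)%N -> P j `<=` P j.+1).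
  have [P [hP sP]] := main d (leqnn d); exists P; split; last first.
    by move=> j; case: (hP d (leqnn d)) => _ _; apply.
  split=> [i /hP [] //|i id]; split; first exact: sP.
  move=> PP; case: (hP _ (ltnW id)) => _ over _.
  case: (hP _ id) => _ _ /(_ (Ordinal id) (ltnSn _)) /PP.
  rewrite -(poly_evalXU y) => /over; rewrite /kill poly_evalXU /= ltnn => e.
  have := congr1 (mcoeff U_(Ordinal id)) e; rewrite mcoeffX eqxx mcoeff0 => /eqP.
  by rewrite oner_eq0.
elim: i => [_|i IH id].
  have [||||P [pP IP disj]] := @prime_avoiding R [set 0]
    [set x | exists p, p != 0 /\ x = poly_eval y p].
  - by apply/idealP; split=> // a u v -> ->; rewrite mulr0 addr0.
  - by exists 1; rewrite oner_eq0 poly_eval1.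
  - move=> _ _ [p [p0 ->]] [p' [p'0 ->]]; exists (p * p').
    by rewrite mulf_neq0 // poly_evalM.
  - by move=> _ -> [p [p0 /esym /yind]] p00; rewrite p00 eqxx in p0.
  exists (fun _ => P); split=> // j; rewrite leqn0 => /eqP ->; split=> // p Pp.
  have -> : p = 0 by apply/eqP; apply: contraPT Pp => p0 /disj; apply; exists p.
  by rewrite /kill poly_eval0.
have [P [hP sP]] := IH (ltnW id).
have [P' [hP' PP']] := lies_over_next (hP i (leqnn i) : lies_over (Ordinal id) (P i)).
exists (fun j => if (j <= i)%N then P j else P'); split=> j.
  move=> h; have /predU1P [->|ji] : (j == i.+1) || (j <= i)%N by rewrite -leq_eqVlt.
    by rewrite ltnn.
  by rewrite ji; apply: hP.
move=> h; have /predU1P [->|ji] : (j == i) || (j < i)%N by rewrite -leq_eqVlt -ltnS.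
  by rewrite leqnn ltnn.
by rewrite (ltnW ji) ji; apply: sP.
Qed.

End GoingUp.

(** * Koszul cohomology *)

Section Koszul.
Variable R : comNzRingType.
Implicit Types (ys : seq R) (c b : seq bool -> R) (l : seq bool) (I : set R).

(** The Koszul differential.  A cochain assigns ring elements to the subsets of
    [ys], encoded as bit lists of the same length; the complex of [y :: ys] is
    the cone of multiplication by [y] on the complex of [ys]. *)
Fixpoint kd ys c l : R :=
  match ys, l with
  | y :: ys', false :: l' => kd ys' (fun w => c (false :: w)) l'
  | y :: ys', true :: l' =>
      y * c (false :: l') - kd ys' (fun w => c (true :: w)) l'
  | _, _ => 0
  end.

(** Contraction against the [j]-th element, a homotopy from zero to
    multiplication by it. *)
Fixpoint kh ys j c l : R :=
  match ys, j, l with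
  | y :: ys', 0%N, false :: l' => c (true :: l')
  | y :: ys', j'.+1, false :: l' => kh ys' j' (fun w => c (false :: w)) l'
  | y :: ys', j'.+1, true :: l' => - kh ys' j' (fun w => c (true :: w)) l'
  | _, _, _ => 0
  end.

Definition kidx ys i l := (size l == size ys) && (count id l == i).

Lemma kidx_true y ys i l : kidx (y :: ys) i.+1 (true :: l) = kidx ys i l.
Proof. by []. Qed.

Lemma kd_linear ys (a : R) c b l :
  kd ys (fun w => a * c w + b w) l = a * kd ys c l + kd ys b l.
Proof.
elim: ys c b l => [|y ys IH] c b [|[] l] /=; rewrite ?mulr0 ?addr0 // ?IH //.
ring.
Qed.

Lemma kd_ext ys c b l : c =1 b -> kd ys c l = kd ys b l.
Proof.
elim: ys c b l => [|y ys IH] c b [|[] l] //= h; last by apply: IH => w.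
by rewrite h (IH _ (fun w => b (true :: w))).
Qed.

Lemma kd0 ys l : kd ys (fun _ => 0) l = 0.
Proof.
have e := kd_linear ys (-1) (fun _ => 0) (fun _ => 0) l.
rewrite [X in _ = X + _]mulN1r [RHS]addNr in e.
by apply: etrans _ e; apply: kd_ext => w; rewrite mulr0 addr0.
Qed.

Lemma kdZ ys (a : R) c l : kd ys (fun w => a * c w) l = a * kd ys c l.
Proof.
rewrite -[RHS]addr0 -[X in _ = _ + X](kd0 ys l) -kd_linear.
by apply: kd_ext => w; rewrite addr0.
Qed.

Lemma kdD ys c b l : kd ys (fun w => c w + b w) l = kd ys c l + kd ys b l.
Proof.
by rewrite -[X in _ = X + _]mul1r -kd_linear; apply: kd_ext => w; rewrite mul1r.
Qed.

Lemma kdN ys c l : kd ys (fun w => - c w) l = - kd ys c l.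
Proof. by rewrite -[RHS]mulN1r -kdZ; apply: kd_ext => w; rewrite mulN1r. Qed.

Lemma kdB ys c b l : kd ys (fun w => c w - b w) l = kd ys c l - kd ys b l.
Proof. by rewrite kdD kdN. Qed.

Lemma kd_sum ys (J : Type) (r : seq J) (F : J -> seq bool -> R) l :
  kd ys (fun w => \sum_(j <- r) F j w) l = \sum_(j <- r) kd ys (F j) l.
Proof.
elim: r => [|j r IH].
  by rewrite big_nil -[RHS](kd0 ys l); apply: kd_ext => w; rewrite big_nil.
by rewrite big_cons -IH -kdD; apply: kd_ext => w; rewrite big_cons.
Qed.

Lemma kd_count0 ys c l : count id l = 0%N -> kd ys c l = 0.
Proof.
elim: l c ys => [|[] l IHl] c [|y ys] //=.
by rewrite add0n; apply: IHl.
Qed.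

Lemma kd_mem ys i I c l : ideal I -> kidx ys i.+1 l ->
  (forall w, kidx ys i w -> I (c w)) -> I (kd ys c l).
Proof.
move=> hI; have I0 : I 0 by apply: (@submod0 R R^o _ hI).
elim: ys i c l => [|y ys IH] i c [|[] l] // hl h /=; last first.
  by apply: (IH i) => // w hw; apply: h.
rewrite kidx_true in hl; apply: (@submodB R R^o _ _ _ hI).
  by apply: ideal_mull => //; apply: h.
case: i hl h => [|i] hl h; last by apply: (IH i) => // w hw; apply: h.
by case/andP: hl => _ /eqP h0; rewrite kd_count0.
Qed.

Lemma kd_local ys i I c b l : ideal I -> kidx ys i.+1 l ->
  (forall w, kidx ys i w -> I (c w - b w)) -> I (kd ys c l - kd ys b l).
Proof. by move=> hI hl h; rewrite -kdB; apply: kd_mem hl _. Qed.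

Lemma kdK ys c l : size l = size ys -> kd ys (kd ys c) l = 0.
Proof.
elim: ys c l => [|y ys IH] c [|[] l] //= [sl]; last exact: IH.
by rewrite kdB kdZ IH // subr0 subrr.
Qed.

Lemma kh_mem ys j i I c l : ideal I -> kidx ys i l ->
  (forall w, kidx ys i.+1 w -> I (c w)) -> I (kh ys j c l).
Proof.
move=> hI; have I0 : I 0 by apply: (@submod0 R R^o _ hI).
elim: ys j i c l => [|y ys IH] [|j] i c [|[] l] hl h //=.
- exact: h.
- case: i hl h => [|i] hl h; first by case/andP: hl.
  apply: (@submodN R R^o _ _ hI).
  by apply: (IH j i) => // w hw; apply: h.
- by apply: (IH j i) => // w hw; apply: h.
Qed.

Lemma kh_linear ys j (a : R) c b l :
  kh ys j (fun w => a * c w + b w) l = a * kh ys j c l + kh ys j b l.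
Proof.
elim: ys j c b l => [|y ys IH] [|j] c b [|[] l] /=; rewrite ?mulr0 ?addr0 // ?IH //.
ring.
Qed.

Lemma kh_ext ys j c b l : c =1 b -> kh ys j c l = kh ys j b l.
Proof.
elim: ys j c b l => [|y ys IH] [|j] c b [|[] l] //= h; last by apply: IH => w.
by rewrite (IH _ _ (fun w => b (true :: w))).
Qed.

Lemma khN ys j c l : kh ys j (fun w => - c w) l = - kh ys j c l.
Proof.
have h0 : kh ys j (fun _ => 0) l = 0.
  have e := kh_linear ys j (-1) (fun _ => 0) (fun _ => 0) l.
  rewrite [X in _ = X + _]mulN1r [RHS]addNr in e.
  by apply: etrans _ e; apply: kh_ext => w; rewrite mulr0 addr0.
rewrite -mulN1r -[RHS]addr0 -[X in _ = _ + X]h0 -kh_linear.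
by apply: kh_ext => w; rewrite mulN1r addr0.
Qed.

Lemma kh_sub ys j (a : R) c b l :
  kh ys j (fun w => a * c w - b w) l = a * kh ys j c l - kh ys j b l.
Proof. by rewrite kh_linear khN. Qed.

Lemma kh_homotopy ys j c l : size l = size ys -> (j < size ys)%N ->
  kd ys (kh ys j c) l + kh ys j (kd ys c) l = ys`_j * c l.
Proof.
elim: ys j c l => [|y ys IH] [|j] c [|[] l] //= [sl] js.
- by rewrite kd0 subr0 addr0.
- by rewrite addrC subrK.
- have e := IH j (fun w => c (true :: w)) l sl js.
  by rewrite -[RHS]e kdN opprK kh_sub; ring.
- by rewrite IH.
Qed.

(** Vanishing of cohomology in degree [i] with coefficients in the quotient by
    [I]; congruences modulo [I] spare the construction of the quotient ring. *)
Definition koszul_vanish i ys I := forall c,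
  (forall l, kidx ys i.+1 l -> I (kd ys c l)) ->
  exists b, forall l, kidx ys i l -> I (c l - kd ys b l).

(** Multiplication by [x] is nilpotent on cohomology since a power of [x] lies
    in the ideal of [ys]; it is injective in degree [i] by the long exact
    sequence of a regular element. *)
Lemma koszul_vanish_next i ys (I I' : set R) x N : ideal I ->
  (forall v, I' v <-> exists u e, I u /\ v = u + x * e) ->
  (forall r, I (x * r) -> I r) ->
  ideal_gen [set` ys] (x ^+ N) ->
  (forall j, i = j.+1 -> koszul_vanish j ys I') ->
  koszul_vanish i ys I.
Proof.
move=> hI hI' reg hN prev.
have divide c : (forall l, kidx ys i.+1 l -> I (kd ys c l)) ->
    (exists b, forall l, kidx ys i l -> I (x * c l - kd ys b l)) ->
    exists e, forall l, kidx ys i l -> I (c l - kd ys e l).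
  move=> cc [b hb]; case: i prev cc hb => [|i] prev cc hb.
    exists (fun _ => 0) => l hl; have /andP [_ /eqP cl] := hl.
    have := hb _ hl; rewrite !(@kd_count0 _ _ l) // !subr0.
    exact: reg.
  have [l hl|b' hb'] := prev i erefl b.
    apply/hI'; exists (kd ys b l - x * c l), (c l).
    split; last by rewrite subrK.
    by rewrite -opprB; apply: (@submodN R R^o _ _ hI); apply: hb.
  have /choice [e he] : forall l, exists e, kidx ys i l ->
      I (b l - (kd ys b' l + x * e)).
    move=> l; have [/hb'/hI' [u [e [Iu eu]]]|] := boolP (kidx ys i l); last by exists 0.
    by exists e => _; rewrite opprD addrA eu addrK.
  exists e => l hl; apply: reg.
  have /andP [/eqP sl _] := hl.
  have := kd_local hI hl he; rewrite kdD kdK // add0r kdZ => h.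
  have := @submodD R R^o _ _ _ hI (hb _ hl) h.
  by rewrite addrA subrK -mulrBr.
have [a ea] : exists a : 'I_(size ys) -> R, x ^+ N = \sum_j a j * ys`_j.
  have : ideal_gen (range (fun j : 'I_(size ys) => ys`_j)) (x ^+ N).
    move: hN; apply: ideal_gen_sub; first exact: ideal_gen_ideal.
    move=> y /= ys_y; apply: sub_ideal_gen.
    have ly : (index y ys < size ys)%N by rewrite index_mem.
    by exists (Ordinal ly) => //=; rewrite nth_index.
  by move/ideal_gen_rangeP.
move=> c cc.
have powN n : (n <= N)%N -> exists b, forall l, kidx ys i l ->
    I (x ^+ (N - n) * c l - kd ys b l).
  elim: n => [_|n IH nN].
    exists (fun w => \sum_j a j * kh ys j c w) => l hl.
    have /andP [/eqP sl _] := hl; rewrite subn0 ea kd_sum mulr_suml -sumrB.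
    apply: (@submod_sum R R^o _ _ _ _ _ hI) => j _.
    rewrite kdZ -mulrA -mulrBr -(kh_homotopy c sl (ltn_ord j)) addrAC subrr add0r.
    apply: ideal_mull => //; apply: (@kh_mem ys j i) => //.
  have [b hb] := IH (ltnW nN).
  apply: (divide (fun w => x ^+ (N - n.+1) * c w)).
    by move=> l hl; rewrite kdZ; apply: ideal_mull => //; apply: cc.
  by exists b => l hl; rewrite mulrA -exprS -subSn // subSS; apply: hb.
have [b hb] := powN N (leqnn N); exists b => l hl.
by have := hb l hl; rewrite subnn expr0 mul1r.
Qed.

Lemma ideal_gen_rcons (s : seq R) x v :
  ideal_gen [set` rcons s x] v <->
  exists u e, ideal_gen [set` s] u /\ v = u + x * e.
Proof.
split; last first.
  move=> [u [e [hu ->]]]; apply: (@submodD R R^o _ _ _ (ideal_gen_ideal _)).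
    move: hu; apply: ideal_gen_sub; first exact: ideal_gen_ideal.
    by move=> z /= zs; apply: sub_ideal_gen; rewrite /= mem_rcons inE zs orbT.
  by apply: ideal_gen_mulr; apply: sub_ideal_gen; rewrite /= mem_rcons mem_head.
suff sub : ideal_gen [set` rcons s x] `<=`
    [set v | exists u e, ideal_gen [set` s] u /\ v = u + x * e] by move/sub.
have h0 : ideal_gen [set` s] 0 by exact: (@submod0 R R^o _ (ideal_gen_ideal _)).
apply: ideal_gen_sub.
  apply/idealP; split; first by exists 0, 0; rewrite mulr0 addr0.
  move=> a _ _ [u1 [e1 [h1 ->]]] [u2 [e2 [h2 ->]]].
  exists (a * u1 + u2), (a * e1 + e2); split; last by ring.
  apply: (@submodD R R^o _ _ _ (ideal_gen_ideal _)) => //.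
  exact: ideal_gen_mull.
move=> z /=; rewrite mem_rcons inE => /predU1P [->|zs].
  by exists 0, 1; rewrite mulr1 add0r.
by exists z, 0; rewrite mulr0 addr0; split=> //; apply: sub_ideal_gen.
Qed.

(** Induction from the top of the sequence down: the quotient by the first [t]
    elements gains one degree of vanishing from the quotient by one element
    more. *)
Lemma regular_seq_koszul (s ys : seq R) : regular_seq s ->
  (forall x, x \in s -> exists N, ideal_gen [set` ys] (x ^+ N)) ->
  forall i, (i < size s)%N -> koszul_vanish i ys [set 0].
Proof.
move=> [_ rs] nil i si.
suff main u : (u <= size s)%N -> forall i, (i < u)%N ->
    koszul_vanish i ys (ideal_gen [set` take (size s - u) s]).
  have := main (size s) (leqnn _) i si; rewrite subnn take0.
  have -> // : ideal_gen [set` [::] : seq R] = [set 0].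
  apply/seteqP; split; last first.
    by move=> _ ->; exact: (@submod0 R R^o _ (ideal_gen_ideal _)).
  apply: ideal_gen_sub => //.
  by apply/idealP; split=> // a _ _ -> ->; rewrite mulr0 addr0.
elim: u => [//|u IH us] {si}i iu.
have ts : (size s - u.+1 < size s)%N by lia.
have te : (size s - u = (size s - u.+1).+1)%N by lia.
have [N hN] := nil _ (mem_nth 0 ts).
apply: (@koszul_vanish_next i ys _ (ideal_gen [set` take (size s - u) s]) _ N
          (ideal_gen_ideal _) _ _ hN) => [v|r|j ej].
- by rewrite te (take_nth 0) //; apply: ideal_gen_rcons.
- exact: rs.
- by apply: IH; [apply: ltnW|rewrite -ltnS -ej].
Qed.

(** With [kd_top_surj], this identifies the top cohomology with the quotient by
    the ideal of [ys]. *)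
Lemma kd_top ys c : ideal_gen [set` ys] (kd ys c (nseq (size ys) true)).
Proof.
have i0 (zs : seq R) : ideal_gen [set` zs] 0.
  exact: (@submod0 R R^o _ (ideal_gen_ideal _)).
elim: ys c => [|y ys IH] c /=; first exact: i0.
apply: (@submodB R R^o _ _ _ (ideal_gen_ideal _)).
  by apply: ideal_gen_mulr; apply: sub_ideal_gen; rewrite /= mem_head.
apply: ideal_gen_sub (IH (fun w => c (true :: w))); first exact: ideal_gen_ideal.
by move=> z /= zs; apply: sub_ideal_gen; rewrite /= inE zs orbT.
Qed.

Lemma kd_top_surj ys v : ideal_gen [set` ys] v ->
  exists c, kd ys c (nseq (size ys) true) = v.
Proof.
suff sub : ideal_gen [set` ys] `<=`
    [set v | exists c, kd ys c (nseq (size ys) true) = v] by move/sub.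
apply: ideal_gen_sub.
  apply/idealP; split; first by exists (fun _ => 0); rewrite kd0.
  move=> a _ _ [c <-] [b <-]; exists (fun w => a * c w + b w).
  by rewrite kd_linear.
elim: ys {v} => [//|y ys IH] v /=; rewrite inE => /predU1P [->|/IH [c <-]].
  exists (fun l => if l is false :: _ then 1 else 0).
  by rewrite mulr1 kd0 subr0.
exists (fun l => if l is true :: l' then - c l' else 0).
by rewrite mulr0 sub0r kdN opprK.
Qed.

(** A relation [y * x = kd ys b] makes [x] and [b] together a cocycle of degree
    [size ys] of the complex of [y :: ys]. *)
Lemma koszul_top_regular y ys x :
  koszul_vanish (size ys) (y :: ys) [set 0] ->
  ideal_gen [set` ys] (y * x) -> ideal_gen [set` ys] x.
Proof.
move=> van /kd_top_surj [b hb].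
pose C l := match l with false :: _ => x | true :: l' => b l' | _ => 0 end.
have top i zs l : kidx zs i l -> (size zs <= i)%N -> l = nseq (size zs) true.
  move=> /andP [/eqP <- /eqP <-] le.
  have : all (pred1 true) l.
    have := le; rewrite -(count_predC id l) -{2}[count id l]addn0 leq_add2l leqn0.
    by rewrite eqn0Ngt -has_count -all_predC => /allP h; apply/allP => z /h /= /negPn ->.
  by move/all_pred1P.
have [l hl|c hc] := van C.
  have := top _ _ _ hl (leqnn _); move=> -> /=.
  by rewrite hb subrr.
have := hc (false :: nseq (size ys) true).
rewrite /kidx /= size_nseq eqxx count_nseq mul1n add0n eqxx => /(_ isT) /= /eqP.
by rewrite subr_eq0 => /eqP ->; apply: kd_top.
Qed.

End Koszul.

Section GradedKoszul.
Variables (k : fieldType) (R : comAlgType k) (RG : int -> set R).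
Hypothesis hR : standard_graded RG.
Let gRG := sg_grading hR.

(** Truncation to degrees below [T], which commutes with multiplication by linear
    forms up to a shift of [T]: it makes cochains bounded. *)
Let tau (T : nat) (r : R) : R := \sum_(t < T) gproj RG t%:Z r.

Let tau_linear T y c b : tau T (y + c - b) = tau T y + tau T c - tau T b.
Proof.
rewrite /tau -big_split -sumrB; apply: eq_bigr => t _.
by rewrite (gprojB gRG) (gprojD gRG).
Qed.

Let tauM T y r : RG 1 y -> tau T.+1 (y * r) = y * tau T r.
Proof.
move=> hy; rewrite /tau mulr_sumr big_ord_recl (gprojM hR _ _ hy) (gproj_neg hR) //.
rewrite mulr0 add0r; apply: eq_bigr => t _; rewrite (gprojM hR _ _ hy).
by rewrite lift0 -addn1 PoszD addrK.
Qed.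

Let tau_id T r : (forall t, T%:Z <= t -> gproj RG t r = 0) -> tau T r = r.
Proof.
move=> h; apply/eqP; rewrite -subr_eq0; apply/eqP/(gproj_eq0 gRG) => t.
rewrite (gprojB gRG) (gproj_bigsum gRG).
under eq_bigr do rewrite (gproj_id gRG _ (gproj_in gRG _ _)).
case: t => [t|t]; last first.
  by rewrite [X in _ - X](gproj_neg hR) // subr0 big1.
have [tT|Tt] := ltnP t T; last first.
  rewrite [X in _ - X]h // subr0 big1 // => i _; case: eqP => // -[e].
  by have := ltn_ord i; rewrite -e ltnNge Tt.
rewrite (bigD1 (Ordinal tT)) //= eqxx big1 ?addr0 ?subrr // => i ne.
by case: eqP => // -[e]; case/eqP: ne; apply: val_inj.
Qed.

Let tau0 T : tau T 0 = 0.
Proof. by rewrite /tau big1 // => i _; apply: gproj0. Qed.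

Let kd_tau ys c T l : (forall y, y \in ys -> RG 1 y) ->
  kd ys (fun w => tau T (c w)) l = tau T.+1 (kd ys c l).
Proof.
elim: ys c l => [|y ys IH] c [|[] l] hys /=; rewrite ?tau0 //.
  have -> : y * c (false :: l) - kd ys (fun w => c (true :: w)) l =
     y * c (false :: l) + 0 - kd ys (fun w => c (true :: w)) l by rewrite addr0.
  rewrite tau_linear tau0 addr0 tauM ?IH //; last by apply: hys; rewrite mem_head.
  by move=> z zs; apply: hys; rewrite inE zs orbT.
by apply: IH => z zs; apply: hys; rewrite inE zs orbT.
Qed.

(** If the cohomology of [y :: ys] vanishes in degree [i.+1], then [y] is
    surjective on the cohomology of [ys] in degree [i], which is bounded below
    in the internal grading and hence zero. *)
Lemma koszul_vanish_tail i y ys : RG 1 y -> (forall z, z \in ys -> RG 1 z) ->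
  koszul_vanish i.+1 (y :: ys) [set 0] -> koszul_vanish i ys [set 0].
Proof.
move=> hy hys van c cc.
have main T : forall c, (forall l, kidx ys i.+1 l -> kd ys c l = 0) ->
    (forall l t, kidx ys i l -> T%:Z <= t -> gproj RG t (c l) = 0) ->
    exists b, forall l, kidx ys i l -> c l = kd ys b l.
  elim: T => {cc}[|T IH] {}c cc cT.
    exists (fun _ => 0) => l hl; rewrite kd0; apply: (gproj_eq0 gRG) => t.
    by have [/(gproj_neg hR)|] := ltP t 0 => // t0; apply: cT.
  pose C l := if l is true :: l' then c l' else 0.
  have [l hl|E hE] := van C.
    case: l hl => [//|[] l] hl /=; last by rewrite kd0.
    by rewrite mulr0 sub0r cc ?oppr0.
  pose a w := E (false :: w); pose b w := E (true :: w).
  have ha l : kidx ys i.+1 l -> kd ys a l = 0.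
    move=> hl; have := hE (false :: l) hl; rewrite /= sub0r => /eqP.
    by rewrite oppr_eq0 => /eqP.
  have hc l : kidx ys i l -> c l = y * a l + 0 - kd ys b l.
    by move=> hl; have /eqP := hE (true :: l) hl; rewrite addr0 subr_eq0 => /eqP.
  have [l hl|l t hl Tt|e he] := IH (fun w => tau T (a w)).
  - by rewrite kd_tau // ha // tau0.
  - rewrite /tau (gproj_bigsum gRG) big1 // => j _.
    rewrite (gproj_id gRG _ (gproj_in gRG _ _)); case: eqP => // e.
    by move: Tt; rewrite e lez_nat leqNgt ltn_ord.
  exists (fun w => y * e w - tau T (b w)) => l hl.
  rewrite kdB kdZ kd_tau // -he // -(tauM _ _ hy).
  rewrite -[LHS](@tau_id T.+1); last by move=> t; apply: cT.
  by rewrite hc // tau_linear tau0 addr0.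
have /choice [T hT] := fun l : (size ys).-tuple bool => Rle_exists hR (c l).
have [|l t hl Tt|b hb] := main (\max_l T l).+1 c.
- exact: cc.
- have sl : size l == size ys by case/andP: hl.
  apply: (hT (Tuple sl)); apply: lt_le_trans Tt.
  by rewrite ltz_nat ltnS; apply: leq_bigmax.
by exists b => l hl; rewrite /= hb // subrr.
Qed.

Variables (d : nat) (y : 'I_d -> R).
Hypothesis hy1 : forall i, RG 1 (y i).
Hypothesis hrad : radical (ideal_gen (range y)) = irrelevant_ideal RG.

(** The first [t] parameters, the last one in front so that adding a parameter
    is a cone on the Koszul complex. *)
Fixpoint params_rev (t : nat) : seq R :=
  if t is t'.+1 then
    (if insub t' is Some j then y j else 0) :: params_rev t'
  else [::].

Lemma size_params_rev t : size (params_rev t) = t.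
Proof. by elim: t => //= t ->. Qed.

Lemma params_revS (t : 'I_d) : params_rev t.+1 = y t :: params_rev t.
Proof. by rewrite /= valK. Qed.

Lemma mem_params_rev t : (t <= d)%N ->
  forall z, z \in params_rev t <-> exists2 j : 'I_d, (j < t)%N & z = y j.
Proof.
elim: t => [_ z|t IH td z]; first by split=> // -[].
have := params_revS (Ordinal td) => /= ->; rewrite inE.
split=> [/predU1P [->|/(IH (ltnW td)) [j jt ->]]|[j jt ->]].
- by exists (Ordinal td).
- by exists j => //; apply: ltnW.
have /predU1P [jt'|jt'] : (j == t :> nat) || (j < t)%N by rewrite -leq_eqVlt.
  by rewrite (_ : j = Ordinal td) ?eqxx //; apply: val_inj.
by apply/orP; right; apply/IH; [apply: ltnW|exists j].
Qed.

(** The regular sequence in the irrelevant ideal, whose elements are nilpotent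
    modulo the parameters, kills the Koszul cohomology of the [d] parameters
    below degree [d]; peeling off parameters gives vanishing below degree [t]
    for the first [t] of them, and the last degree says that the next one is
    regular. *)
Lemma params_regular (s : seq R) : regular_seq s ->
  [set` s] `<=` irrelevant_ideal RG -> (d <= size s)%N ->
  forall (t : 'I_d) r, ideal_gen [set` params_rev t] (y t * r) ->
    ideal_gen [set` params_rev t] r.
Proof.
move=> rs sm ds t r.
have linear u z : (u <= d)%N -> z \in params_rev u -> RG 1 z.
  by move=> ud /(mem_params_rev ud) [j _ ->].
have vd i : (i < d)%N -> koszul_vanish i (params_rev d) [set 0].
  move=> id; apply: (regular_seq_koszul rs); last exact: leq_trans ds.
  move=> x xs; have : radical (ideal_gen (range y)) x by rewrite hrad; apply: sm.
  move=> [N hN]; exists N; move: hN; apply: ideal_gen_sub.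
    exact: ideal_gen_ideal.
  move=> _ [j _ <-]; apply: sub_ideal_gen => /=.
  by apply/mem_params_rev => //; exists j.
have van u i : (u <= d)%N -> (i < d - u)%N ->
    koszul_vanish i (params_rev (d - u)) [set 0].
  elim: u i => [|u IH] i; first by rewrite subn0 => _; apply: vd.
  move=> ud iu; have tlt : (d - u.+1 < d)%N by lia.
  have te : (d - u = (Ordinal tlt).+1)%N by rewrite /=; lia.
  have := IH i.+1 (ltnW ud); rewrite te params_revS => h.
  apply: koszul_vanish_tail (hy1 _) _ _; last by apply: h; rewrite ltnS.
  by move=> z; apply: linear; apply: ltnW.
apply: koszul_top_regular; rewrite size_params_rev -params_revS.
have te : (t.+1 = d - (d - t.+1))%N by have := ltn_ord t; lia.
by rewrite te; apply: van; [apply: leq_subr|rewrite -te].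
Qed.

End GradedKoszul.

(** * Freeness over the parameter subalgebra *)

Section Freeness.
Variables (k : fieldType) (R : comAlgType k) (RG : int -> set R) (d : nat).
Hypotheses (hR : standard_graded RG) (hCM : cohen_macaulay R).
Variable y : 'I_d -> R.
Hypothesis hy : linear_sop RG y.
Let gRG := sg_grading hR.

Let hdim : krull_dim R d. Proof. by case: hy. Qed.
Let hy1 : forall i, RG 1 (y i). Proof. by case: hy. Qed.
Let hrad : radical (ideal_gen (range y)) = irrelevant_ideal RG.
Proof. by case: hy. Qed.

(** Modulo the irrelevant ideal every element is a constant. *)
Lemma irrelevant_top (Q : set R) : ideal Q -> ~ Q 1 ->
  irrelevant_ideal RG `<=` Q -> Q `<=` irrelevant_ideal RG.
Proof.
move=> iQ nQ mQ r Qr.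
have gr : irrelevant_ideal RG (r - gproj RG 0 r).
  rewrite -[irrelevant_ideal RG](_ : Rge RG 1 = _); last first.
    rewrite -(irrelevant_pow hR 1) ideal_powS; apply/seteqP; split.
      apply: (@submod_mul_sub R R^o); first exact: irrelevant_ideal_ideal.
      by move=> a b ha _; exact: (ideal_mulr _ (ideal_gen_ideal _) ha).
    by move=> a ha; rewrite -[a]mulr1; apply: mem_ideal_mul.
  move=> t t1; rewrite (gprojB gRG) (gproj_id gRG _ (gproj_in gRG 0 r)).
  case: eqP => [->|t0]; first by rewrite subrr.
  by rewrite subr0; apply: (gproj_neg hR); lia.
have [c hc] : exists c : k, c%:A = gproj RG 0 r.
  have := gproj_in gRG 0 r; case: hR => _ -> _ [c _ e]; by exists c.
have Qc : Q (c%:A).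
  rewrite hc -[gproj RG 0 r](subKr r); apply: (@submodB R R^o _ _ _ iQ) => //.
  exact: mQ.
have c0 : c = 0.
  apply/eqP; apply: contra_notT nQ => c0; have := ideal_mull (c^-1)%:A iQ Qc.
  by rewrite mulr_algl scalerA mulVf // scale1r.
by move: gr; rewrite -hc c0 scale0r subr0.
Qed.

Lemma irrelevant_proper : ~ irrelevant_ideal RG 1.
Proof.
move=> /(irrelevant_sub hR)/(_ 0 isT).
by rewrite (gproj_id gRG _ (sg_one hR)) eqxx => /eqP; rewrite oner_eq0.
Qed.

Lemma irrelevant_maximal : maximal_ideal (irrelevant_ideal RG).
Proof.
split; first by apply/proper_idealP; split;
  [exact: irrelevant_ideal_ideal|exact: irrelevant_proper].
by move=> Q /proper_idealP [iQ nQ]; apply: irrelevant_top.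
Qed.

(** A chain of primes of length [d] yields a regular sequence of length [d],
    hence [d] algebraically independent elements. *)
Lemma sop_alg_indep p : poly_eval y p = 0 -> p = 0.
Proof.
have [[P cP] _] := hdim.
have [s [rs _ ds]] := cm_regular_seq hCM cP (top_of_chain_maximal hdim cP).
exact: (params_alg_indep hR hy1 hrad (regular_seq_alg_indep rs ds)).
Qed.

Lemma sop_integral r : exists (N : nat) (c : 'I_N -> {mpoly k[d]}),
  r ^+ N + \sum_i poly_eval y (c i) * r ^+ i = 0.
Proof.
have [q [b [e [hb _ gb]]]] := params_basis hR hy1 hrad.
by apply: (@finite_integral k R d q y b); apply: (params_generate hR gb).
Qed.

(** Going up produces a chain of [d] inclusions of primes ending at the
    irrelevant ideal, whose grade is therefore at least [d]. *)
Lemma sop_regular (t : 'I_d) r : ideal_gen [set` params_rev y t] (y t * r) ->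
  ideal_gen [set` params_rev y t] r.
Proof.
have [P [cP yP]] := going_up_chain sop_alg_indep sop_integral.
have [pP _] := cP; have pd := pP d (leqnn d).
have [iP nP _] := (prime_idealP _).1 pd.
have mP : irrelevant_ideal RG `<=` P d.
  rewrite -hrad => x [n hn]; apply: (prime_idealX pd (n := n)).
  by move: hn; apply: ideal_gen_sub => // _ [j _ <-].
have eP : P d = irrelevant_ideal RG.
  by apply/seteqP; split=> //; apply: irrelevant_top.
have := cm_regular_seq hCM cP; rewrite eP => /(_ irrelevant_maximal) [s [rs sm ds]].
exact: (params_regular hR hy1 hrad rs sm ds).
Qed.

Lemma params_rev_range : ideal_gen [set` params_rev y d] = ideal_gen (range y).
Proof.
apply/seteqP; split; (apply: ideal_gen_sub; first exact: ideal_gen_ideal).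
  by move=> z /= /(mem_params_rev y (leqnn d) z) [j _ ->]; apply: sub_ideal_gen; exists j.
move=> _ [j _ <-]; apply: sub_ideal_gen => /=.
by apply/mem_params_rev => //; exists j.
Qed.

(** A basis of [R] modulo the parameters generates by Nakayama and is
    independent since the parameters form a regular sequence. *)
Theorem sop_free_basis : exists (q : nat) (b : 'I_q -> R) (e : 'I_q -> nat)
    (pi : 'I_q -> R -> {mpoly k[d]}),
  [/\ forall j, RG (e j)%:Z (b j),
      forall r, r = \sum_j poly_eval y (pi j r) * b j,
      forall j p r s, pi j (poly_eval y p * r + s) = p * pi j r + pi j s,
      forall j t r, RG t r -> homog_deg (t - (e j)%:Z) (pi j r)
    & forall j l, pi j (b l) = (j == l)%:R].
Proof.
have [q [b [e [hb ib gb]]]] := params_basis hR hy1 hrad.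
have ind (P : 'I_q -> {mpoly k[d]}) :
    \sum_j poly_eval y (P j) * b j = 0 -> forall j, P j = 0.
  pose I t : set R := ideal_gen [set` params_rev y t].
  have iI t : ideal (I t) by exact: ideal_gen_ideal.
  move=> hP; apply: (@regular_chain_indep k R d q y I b iI _ _ _ _ P).
  - move=> t; apply: ideal_gen_sub; first exact: iI.
    by move=> z zt; apply: sub_ideal_gen; rewrite /= inE [z \in _]zt orbT.
  - move=> t r; apply: (ideal_mulr _ (iI _)); apply: sub_ideal_gen.
    by rewrite params_revS /= mem_head.
  - by move=> t r; apply: sop_regular.
  - by move=> c; rewrite /I params_rev_range; apply: ib.
  - by rewrite hP; apply: (@submod0 R R^o _ (iI 0%N)).
have uniq (P Q : 'I_q -> {mpoly k[d]}) : \sum_j poly_eval y (P j) * b j =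
    \sum_j poly_eval y (Q j) * b j -> forall j, P j = Q j.
  move=> ePQ j; apply/eqP; rewrite -subr_eq0; apply/eqP.
  apply: (ind (fun j => P j - Q j)).
  under eq_bigr do rewrite poly_eval_is_additive mulrBl.
  by rewrite sumrB ePQ subrr.
have /choice [pi hpi] := params_generate hR gb.
exists q, b, e, (fun j r => pi r j); split=> //.
- move=> j p r s; apply: (uniq _ (fun j => p * pi r j + pi s j)); rewrite -hpi.
  under eq_bigr do rewrite poly_evalD poly_evalM mulrDl -mulrA.
  by rewrite big_split -mulr_sumr -!hpi.
- move=> j t r hr; have [P [hP er]] := gb t r hr.
  by rewrite (uniq (pi r) P) // -hpi.
- move=> j l; apply: (uniq _ (fun j => (j == l)%:R)); rewrite -hpi (bigD1 l) //=.
  rewrite eqxx poly_eval1 mul1r big1 ?addr0 // => i /negbTE ->.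
  by rewrite poly_eval0 mul0r.
Qed.

End Freeness.

(** * Laurent functions *)

Section LinearExtension.
Variables (k : fieldType) (n : nat) (V : lmodType k) (G : 'X_{1..n} -> V).
Implicit Types p q : {mpoly k[n]}.

Definition linext p : V := \sum_(m <- msupp p) p@_m *: G m.

Lemma linext_wide s p : uniq s -> {subset msupp p <= s} ->
  linext p = \sum_(m <- s) p@_m *: G m.
Proof.
move=> us ps; rewrite [RHS](bigID (mem (msupp p))) /= [X in _ + X]big1 ?addr0.
  rewrite -big_filter; apply: perm_big; apply: uniq_perm; rewrite ?filter_uniq ?msupp_uniq //.
  by move=> m; rewrite mem_filter; case: (boolP (m \in msupp p)) => //= /ps.
by move=> m /memN_msupp_eq0 ->; rewrite scale0r.
Qed.

Lemma linext_linear (c : k) p q : linext (c *: p + q) = c *: linext p + linext q.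
Proof.
pose s := undup (msupp p ++ msupp q).
have hs := undup_uniq (msupp p ++ msupp q).
rewrite !(linext_wide hs) => [|m mq|m mp|m].
- rewrite scaler_sumr -big_split; apply: eq_bigr => m _.
  by rewrite mcoeffD mcoeffZ scalerDl scalerA.
- by rewrite mem_undup mem_cat mq orbT.
- by rewrite mem_undup mem_cat mp.
- move/msuppD_le; rewrite mem_undup !mem_cat => /orP [/msuppZ_le ->//|->].
  by rewrite orbT.
Qed.

Lemma linextD p q : linext (p + q) = linext p + linext q.
Proof. by rewrite -[p in LHS]scale1r linext_linear scale1r. Qed.

Lemma linext0 : linext 0 = 0.
Proof. by rewrite /linext msupp0 big_nil. Qed.

Lemma linextX m : linext 'X_[m] = G m.
Proof. by rewrite /linext msuppX big_seq1 mcoeffX eqxx scale1r. Qed.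

End LinearExtension.

Lemma mpoly_linear_ind (k : fieldType) (n : nat) (P : {mpoly k[n]} -> Prop) :
  (forall m, P 'X_[m]) -> P 0 ->
  (forall c p q, P p -> P q -> P (c *: p + q)) -> forall p, P p.
Proof. by move=> PX P0 PL; elim/mpolyind => // c m p _ _ Pp; apply: PL. Qed.

(** Functions on the lattice of exponents, on which polynomials act by shifts
    and which contain all modules needed to compute the Ext groups: power
    series, inverse power series and mixtures of both. *)
Definition laurent (k : fieldType) (n : nat) : Type := ('I_n -> int) -> k.

Section LaurentModule.
Variables (k : fieldType) (n : nat).
Local Notation U := (laurent k n).

HB.instance Definition _ := gen_eqMixin U.
HB.instance Definition _ := gen_choiceMixin U.

Let lzero : U := fun _ => 0.
Let ladd (u v : U) : U := fun e => u e + v e.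
Let lopp (u : U) : U := fun e => - u e.

Let laddA : associative ladd.
Proof. by move=> u v w; apply/funext => e; apply: addrA. Qed.
Let laddC : commutative ladd.
Proof. by move=> u v; apply/funext => e; apply: addrC. Qed.
Let ladd0 : left_id lzero ladd.
Proof. by move=> u; apply/funext => e; apply: add0r. Qed.
Let laddN : left_inverse lzero lopp ladd.
Proof. by move=> u; apply/funext => e; apply: addNr. Qed.

HB.instance Definition _ := GRing.isZmodule.Build U laddA laddC ladd0 laddN.

Lemma laurentD (u v : U) e : (u + v) e = u e + v e. Proof. by []. Qed.
Lemma laurentN (u : U) e : (- u) e = - u e. Proof. by []. Qed.
Lemma laurent0 e : (0 : U) e = 0. Proof. by []. Qed.
Lemma laurentB (u v : U) e : (u - v) e = u e - v e. Proof. by []. Qed.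

Lemma laurent_sum (I : Type) (r : seq I) (P : pred I) (F : I -> U) e :
  (\sum_(i <- r | P i) F i) e = \sum_(i <- r | P i) F i e.
Proof.
by rewrite (big_morph (fun u : U => u e) (fun u v => laurentD u v e) (laurent0 e)).
Qed.

Definition mshift (e : 'I_n -> int) (m : 'X_{1..n}) : 'I_n -> int :=
  fun i => e i - (m i)%:Z.

Lemma mshift0 e : mshift e 0%MM = e.
Proof. by apply/funext => i; rewrite /mshift mnm0E subr0. Qed.

Lemma mshiftD e m1 m2 : mshift e (m1 + m2)%MM = mshift (mshift e m1) m2.
Proof.
by apply/funext => i; rewrite /mshift mnmDE PoszD opprD addrA.
Qed.

Let lact (p : {mpoly k[n]}) (u : U) : U :=
  fun e => linext (fun m => u (mshift e m) : k^o) p.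

Let lactX m u e : lact 'X_[m] u e = u (mshift e m).
Proof. by rewrite /lact linextX. Qed.

Let lact_linear (c : k) p q u e : lact (c *: p + q) u e = c * lact p u e + lact q u e.
Proof. by rewrite /lact linext_linear. Qed.

Let lact0l u e : lact 0 u e = 0.
Proof. by rewrite /lact linext0. Qed.

Let lactDr p : {morph lact p : u v / u + v}.
Proof.
move=> u v; apply/funext => e; rewrite laurentD /lact /linext -big_split.
by apply: eq_bigr => m _; apply: mulrDr.
Qed.

Let lactDl u : {morph lact^~ u : p q / p + q}.
Proof. by move=> p q; apply/funext => e; rewrite laurentD /lact linextD. Qed.

Let lact1 u : lact 1 u = u.
Proof. by apply/funext => e; rewrite -mpolyX0 lactX mshift0. Qed.

Let lactA p q u : lact p (lact q u) = lact (p * q) u.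
Proof.
apply/funext => e; elim/mpoly_linear_ind: p => [m||c p p' IHp IHp'].
- rewrite lactX; elim/mpoly_linear_ind: q => [m'||c q q' IHq IHq'].
  + by rewrite -mpolyXD !lactX mshiftD.
  + by rewrite mulr0 !lact0l.
  + by rewrite lact_linear IHq IHq' mulrDr -scalerAr lact_linear.
- by rewrite mul0r !lact0l.
- by rewrite lact_linear IHp IHp' mulrDl -scalerAl lact_linear.
Qed.

HB.instance Definition _ := GRing.Zmodule_isLmodule.Build {mpoly k[n]} U
  lactA lact1 lactDr lactDl.

Lemma laurentX m (u : U) e : ('X_[m] *: u) e = u (mshift e m).
Proof. exact: lactX. Qed.

Lemma laurentE p (u : U) e :
  (p *: u) e = \sum_(m <- msupp p) p@_m * u (mshift e m).
Proof. by []. Qed.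

Lemma laurentC (c : k) p (u : U) e : ((c *: p) *: u) e = c * (p *: u) e.
Proof.
by have := lact_linear c p 0 u e; rewrite addr0 lact0l addr0.
Qed.

Lemma laurentCP (c : k) (u : U) e : (c%:MP *: u) e = c * u e.
Proof. by rewrite -[c%:MP]mulr1 mul_mpolyC laurentC scale1r. Qed.

Lemma mpoly_act_laurent (c : k) p q (u : U) e :
  ((c *: p + q) *: u) e = c * (p *: u) e + (q *: u) e.
Proof. by rewrite scalerDl laurentD laurentC. Qed.

End LaurentModule.

Section Stages.
Variables (k : fieldType) (n : nat).
Local Notation U := (laurent k n).
Implicit Types (u v : U) (e : 'I_n -> int).

(** Stage [p] of the computation concerns functions supported on nonnegative
    exponents in the first [p] variables, considered at negative exponents in
    the others.  At stage [n] these are the power series. *)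
Definition nneg_supp (p : nat) u :=
  forall e, (exists2 i : 'I_n, (i < p)%N & e i < 0) -> u e = 0.

Definition neg_region (p : nat) e := forall i : 'I_n, (p <= i)%N -> e i < 0.

Definition zero_on (p : nat) u := forall e, neg_region p e -> u e = 0.

Lemma neg_region_shift p e m : neg_region p e -> neg_region p (mshift e m).
Proof. by move=> h i /h; rewrite /mshift; lia. Qed.

Lemma neg_regionW p q e : (p <= q)%N -> neg_region p e -> neg_region q e.
Proof. by move=> pq h i qi; apply: h; apply: leq_trans qi. Qed.

Lemma nneg_suppW p q u : (p <= q)%N -> nneg_supp q u -> nneg_supp p u.
Proof.
move=> pq h e [i ip ei]; apply: h; exists i => //; exact: leq_trans pq.
Qed.

Lemma nneg_supp0 p : nneg_supp p 0. Proof. by []. Qed.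

Lemma nneg_suppD p u v : nneg_supp p u -> nneg_supp p v -> nneg_supp p (u + v).
Proof. by move=> hu hv e he; rewrite laurentD hu // hv // addr0. Qed.

Lemma nneg_suppN p u : nneg_supp p u -> nneg_supp p (- u).
Proof. by move=> hu e he; rewrite laurentN hu // oppr0. Qed.

Lemma nneg_suppZ p (P : {mpoly k[n]}) u : nneg_supp p u -> nneg_supp p (P *: u).
Proof.
move=> hu e [i ip ei]; rewrite laurentE big1 // => m _; rewrite hu ?mulr0 //.
by exists i => //; rewrite /mshift; lia.
Qed.

Lemma nneg_supp_sum p (I : Type) (r : seq I) (P : pred I) (F : I -> U) :
  (forall i, P i -> nneg_supp p (F i)) -> nneg_supp p (\sum_(i <- r | P i) F i).
Proof.
move=> hF; elim/big_rec: _ => [|i x Pi hx]; first exact: nneg_supp0.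
by apply: nneg_suppD => //; apply: hF.
Qed.

Lemma zero_on0 p : zero_on p 0. Proof. by []. Qed.

Lemma zero_onD p u v : zero_on p u -> zero_on p v -> zero_on p (u + v).
Proof. by move=> hu hv e he; rewrite laurentD hu // hv // addr0. Qed.

Lemma zero_onN p u : zero_on p u -> zero_on p (- u).
Proof. by move=> hu e he; rewrite laurentN hu // oppr0. Qed.

Lemma zero_onB p u v : zero_on p u -> zero_on p v -> zero_on p (u - v).
Proof. by move=> hu hv; apply/zero_onD/zero_onN. Qed.

Lemma zero_onZ p (P : {mpoly k[n]}) u : zero_on p u -> zero_on p (P *: u).
Proof.
move=> hu e he; rewrite laurentE big1 // => m _; rewrite hu ?mulr0 //.
exact: neg_region_shift.
Qed.

Lemma zero_on_sum p (I : Type) (r : seq I) (P : pred I) (F : I -> U) :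
  (forall i, P i -> zero_on p (F i)) -> zero_on p (\sum_(i <- r | P i) F i).
Proof.
move=> hF; elim/big_rec: _ => [|i x Pi hx]; first exact: zero_on0.
by apply: zero_onD => //; apply: hF.
Qed.

Lemma zero_onW p q u : (p <= q)%N -> zero_on q u -> zero_on p u.
Proof. by move=> pq h e he; apply: h; apply: neg_regionW he. Qed.

(** At stage [t] the last variable of stage [t.+1] has nonnegative exponents
    only, so nothing is left of it. *)
Lemma supp_zero_on (t : 'I_n) u : nneg_supp t.+1 u -> zero_on t u.
Proof. by move=> hu e he; apply: hu; exists t => //; apply: he. Qed.

Definition cut_at (t : 'I_n) u : U := fun e => if e t < 0 then 0 else u e.

Lemma cut_at_supp (t : 'I_n) u : nneg_supp t u -> nneg_supp t.+1 (cut_at t u).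
Proof.
move=> hu e [i it ei]; rewrite /cut_at; case: ifPn => // et.
apply: hu; exists i => //; have : (i <= t)%N by rewrite -ltnS.
by rewrite leq_eqVlt => /predU1P [ie|//]; move: et; rewrite -(val_inj ie) ei.
Qed.

(** A function that vanishes at stage [t] comes from stage [t.+1]. *)
Lemma cut_at_eq (t : 'I_n) u : zero_on t u -> zero_on t.+1 (u - cut_at t u).
Proof.
move=> hu e he; rewrite laurentB /cut_at; case: ifP => et; last by rewrite subrr.
rewrite subr0; apply: hu => i; rewrite leq_eqVlt => /predU1P [ie|/he //].
by rewrite -(val_inj ie).
Qed.

End Stages.

(** * Dimension shifting *)

Section Cochains.
Variables (k : fieldType) (n : nat).
Local Notation U := (laurent k n).
Local Notation S := {mpoly k[n]}.

Definition mxact r r' (D : 'M[S]_(r', r)) (c : 'I_r -> U) : 'I_r' -> U :=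
  fun j => \sum_l D j l *: c l.

Lemma mxactM r r' r'' (A : 'M[S]_(r'', r')) (B : 'M[S]_(r', r)) c j :
  mxact (A *m B) c j = mxact A (mxact B c) j.
Proof.
rewrite /mxact; under [RHS]eq_bigr do rewrite scaler_sumr.
rewrite exchange_big; apply: eq_bigr => l _; rewrite mxE scaler_suml.
by apply: eq_bigr => i _; rewrite scalerA.
Qed.

Lemma mxactDl r r' (A B : 'M[S]_(r', r)) c j :
  mxact (A + B) c j = mxact A c j + mxact B c j.
Proof.
by rewrite /mxact -big_split; apply: eq_bigr => l _; rewrite mxE scalerDl.
Qed.

Lemma mxact_scalar r (f : S) (c : 'I_r -> U) j : mxact f%:M c j = f *: c j.
Proof.
rewrite /mxact (bigD1 j) //= mxE eqxx mulr1n big1 ?addr0 // => l lj.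
by rewrite mxE eq_sym (negbTE lj) mulr0n scale0r.
Qed.

Lemma mxact_linear r r' (D : 'M[S]_(r', r)) (P : S) (c b : 'I_r -> U) j :
  mxact D (fun l => P *: c l + b l) j = P *: mxact D c j + mxact D b j.
Proof.
rewrite /mxact scaler_sumr -big_split; apply: eq_bigr => l _.
by rewrite scalerDr !scalerA mulrC.
Qed.

Lemma mxactB r r' (D : 'M[S]_(r', r)) (c b : 'I_r -> U) j :
  mxact D (fun l => c l - b l) j = mxact D c j - mxact D b j.
Proof.
by rewrite /mxact -sumrB; apply: eq_bigr => l _; rewrite scalerBr.
Qed.

Lemma mxact_supp p r r' (D : 'M[S]_(r', r)) c :
  (forall l, nneg_supp p (c l)) -> forall j, nneg_supp p (mxact D c j).
Proof. by move=> hc j; apply: nneg_supp_sum => l _; apply: nneg_suppZ. Qed.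

Lemma mxact_zero p r r' (D : 'M[S]_(r', r)) c :
  (forall l, zero_on p (c l)) -> forall j, zero_on p (mxact D c j).
Proof. by move=> hc j; apply: zero_on_sum => l _; apply: zero_onZ. Qed.

End Cochains.

Section Invertible.
Variables (k : fieldType) (n d : nat) (t : 'I_n) (N : nat) (g : {mpoly k[n]}).
Hypothesis dt : (d <= t)%N.
Hypothesis hg : forall m, m \in msupp g -> exists2 i : 'I_n, (i < d)%N & m i != 0%N.
Local Notation U := (laurent k n).
Local Notation f := ('X_[U_(t) *+ N] + g).

(** The total exponent in the first [d] variables, along which [f] is inverted. *)
Let wt (e : 'I_n -> int) : nat := \sum_(i < n | (i < d)%N) `|e i|%N.

Let up (e : 'I_n -> int) : 'I_n -> int := fun i => e i + (if i == t then N%:Z else 0).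
Let down (e : 'I_n -> int) : 'I_n -> int := mshift e (U_(t) *+ N).

Let downK e : up (down e) = e.
Proof.
apply/funext => i; rewrite /up /down /mshift mulmnE mnm1E eq_sym.
by case: eqP => _; rewrite ?mul1n ?mul0n ?subrK // subr0 addr0.
Qed.

Let upK e : down (up e) = e.
Proof.
apply/funext => i; rewrite /up /down /mshift mulmnE mnm1E eq_sym.
by case: eqP => _; rewrite ?mul1n ?mul0n ?addrK // subr0 addr0.
Qed.

Let nd (i : 'I_n) : (i < d)%N -> (i == t) = false.
Proof. by move=> id; apply/eqP => it; rewrite it ltnNge dt in id. Qed.

Let up_low e (i : 'I_n) : (i < t)%N -> up e i = e i.
Proof.
move=> it; rewrite /up; case: eqP => [e1|_]; last by rewrite addr0.
by rewrite e1 ltnn in it.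
Qed.

Let wt_up e : wt (up e) = wt e.
Proof. by apply: eq_bigr => i id; rewrite /up nd // addr0. Qed.

Let nneg (e : 'I_n -> int) := forall i : 'I_n, (i < d)%N -> 0 <= e i.

Let wt_drop e m : m \in msupp g -> nneg (mshift e m) ->
  (wt (mshift e m) < wt e)%N.
Proof.
move=> /hg [i id mi] hn; rewrite /wt [X in (X < _)%N](bigD1 i) //=.
rewrite [X in (_ < X)%N](bigD1 i) //= -addSn; apply: leq_add.
  by have := hn i id; rewrite /mshift; lia.
by apply: leq_sum => j /andP [jd _]; have := hn j jd; rewrite /mshift; lia.
Qed.

Let zero_neg (u : U) e : nneg_supp t u -> ~ nneg e -> u e = 0.
Proof.
move=> hu ne; apply: hu; apply: contrapT => h; apply: ne => i id.
rewrite leNgt; apply/negP => ei; apply: h; exists i => //.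
exact: leq_trans id dt.
Qed.

Let factE (v : U) e : (f *: v) e = v (down e) + (g *: v) e.
Proof. by rewrite scalerDl laurentD laurentX. Qed.

(** The leading term of [f] is a unit on functions without constraint on the
    exponent of the variable [t], and the other terms lower the total exponent
    in the first [d] variables, which is nonnegative. *)
Lemma stage_injective (v : U) : nneg_supp t v -> zero_on t.+1 (f *: v) ->
  zero_on t.+1 v.
Proof.
move=> hv fv e; have [w ew] : exists w, (wt e < w)%N by exists (wt e).+1.
elim: w e ew => // w IH e ew he.
have upr : neg_region t.+1 (up e).
  move=> i ti; have := he i ti; rewrite /up; case: eqP => [it|_].
    by rewrite it ltnn in ti.
  by rewrite addr0.
have := fv _ upr; rewrite factE upK laurentE big_seq big1 ?addr0 // => m mg.
have [hn|hn] := pselect (nneg (mshift (up e) m)); last by rewrite zero_neg ?mulr0.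
rewrite IH ?mulr0 //; last exact: neg_region_shift.
by apply: leq_trans (wt_drop mg hn) _; rewrite wt_up -ltnS.
Qed.

(** The inverse of [f] is a geometric series in [g] divided by the leading term,
    each coefficient of which is a finite sum. *)
Lemma stage_surjective (u : U) : nneg_supp t u ->
  exists v, nneg_supp t v /\ f *: v = u.
Proof.
move=> hu.
pose step (v : U) : U := fun e => u (up e) - (g *: v) (up e).
pose V K : U := iter K step 0.
have VS K e : V K.+1 e = u (up e) - (g *: V K) (up e) by [].
have hV K : nneg_supp t (V K).
  elim: K => [//|K IH] e [i it ei]; rewrite VS hu; last first.
    by exists i => //; rewrite up_low.
  have := nneg_suppZ g IH; move=> -> ; first by rewrite subr0.
  by exists i => //; rewrite up_low.
have stable K e : (wt e < K)%N -> V K.+1 e = V K e.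
  elim: K e => // K IH e eK; rewrite VS [RHS]VS; congr (_ - _).
  rewrite !laurentE big_seq [RHS]big_seq; apply: eq_bigr => m mg; congr (_ * _).
  have [hn|hn] := pselect (nneg (mshift (up e) m)); last by rewrite !zero_neg.
  by apply: IH; apply: leq_trans (wt_drop mg hn) _; rewrite wt_up -ltnS.
(* The iterates are stationary at [e] from [(wt e).+1] on. *)
pose v : U := fun e => V (wt e).+1 e.
have vE K e : (wt e < K)%N -> V K e = v e.
  elim: K => // K IH; rewrite ltnS leq_eqVlt => /predU1P [<- //|eK].
  by rewrite stable // IH.
exists v; split; first by move=> e he; apply: hV.
apply/funext => e; rewrite factE.
pose K := ((\max_(m <- msupp g) wt (mshift e m)) + wt (down e)).+1.
rewrite -(vE K.+1) ?VS; last by rewrite /K !ltnS -addSn leq_addl.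
rewrite downK (_ : (g *: v) e = (g *: V K) e) ?subrK //.
rewrite !laurentE big_seq [RHS]big_seq; apply: eq_bigr => m mg.
rewrite vE // /K ltnS; apply: leq_trans (leq_addr _ _).
exact: (leq_bigmax_seq _ mg).
Qed.

End Invertible.

Section Resolution.
Variables (k : fieldType) (R : comAlgType k) (RG : int -> set R) (n d : nat).
Variables (x : 'I_n -> R) (F : free_seq k n) (e : 'I_(rk F 0) -> R).
Hypothesis hF : graded_free_resolution RG x e.
Local Notation S := {mpoly k[n]}.
Local Notation U := (laurent k n).

Definition augmentation (v : 'rV[S]_(rk F 0)) : R :=
  \sum_j poly_eval x (v 0 j) * e j.

Lemma aug_surj r : exists v, augmentation v = r.
Proof. by case: hF => _ _ h _ _; apply: h. Qed.

Lemma aug_ker v : augmentation v = 0 <-> exists w, v = w *m df F 0.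
Proof. by case: hF => _ _ _ h _; apply: h. Qed.

Lemma augmentation_linear p v w :
  augmentation (p *: v + w) = poly_eval x p * augmentation v + augmentation w.
Proof.
rewrite /augmentation mulr_sumr -big_split; apply: eq_bigr => j _.
by rewrite !mxE poly_evalD poly_evalM mulrDl mulrA.
Qed.

Lemma augmentation0 : augmentation 0 = 0.
Proof. by rewrite /augmentation big1 // => j _; rewrite mxE poly_eval0 mul0r. Qed.

Lemma augmentationB v w : augmentation (v - w) = augmentation v - augmentation w.
Proof.
by rewrite addrC -scaleN1r augmentation_linear poly_evalN poly_eval1 mulN1r addrC.
Qed.

Lemma df_exact i r (A : 'M_(r, rk F i.+1)) : A *m df F i = 0 ->
  exists B, A = B *m df F i.+1.
Proof.
case: hF => _ _ _ _ ex hA.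
have /choice [B hB] : forall j, exists w : 'rV_(rk F i.+2), row j A = w *m df F i.+1.
  by move=> j; apply/ex; rewrite -row_mul hA row0.
exists (\matrix_j B j); apply/row_matrixP => j.
by rewrite row_mul rowK hB.
Qed.

Lemma dfK i : df F i.+1 *m df F i = 0.
Proof.
case: hF => _ _ _ _ ex; apply/row_matrixP => j; rewrite row_mul row0.
by apply/ex; exists (delta_mx 0 j); rewrite rowE.
Qed.

Lemma null_homotopy0 f : poly_eval x f = 0 ->
  exists h : 'M_(rk F 0, rk F 1), h *m df F 0 = f%:M.
Proof.
move=> hf; have /choice [h hh] : forall j : 'I_(rk F 0),
    exists w : 'rV[S]_(rk F 1), f *: delta_mx 0 j = w *m df F 0.
  move=> j; apply/aug_ker; rewrite -[f *: _]addr0 augmentation_linear hf mul0r add0r.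
  by rewrite /augmentation big1 // => l _; rewrite mxE poly_eval0 mul0r.
exists (\matrix_j h j); apply/row_matrixP => j; rewrite row_mul rowK -hh.
by apply/rowP => l; rewrite !mxE eq_sym; case: (j == l); rewrite ?mulr1 ?mulr0.
Qed.

(** Multiplication by [f] on the resolution lifts the zero endomorphism of [R]. *)
Lemma null_homotopy f : poly_eval x f = 0 -> forall i,
  exists (h' : 'M_(rk F i.+1, rk F i.+2)) (h : 'M_(rk F i, rk F i.+1)),
    h' *m df F i.+1 + df F i *m h = f%:M.
Proof.
move=> hf; elim=> [|i [h' [h eh]]].
  have [h eh] := null_homotopy0 hf.
  have [|h' eh'] := @df_exact 0 _ (f%:M - df F 0 *m h).
    by rewrite mulmxBl -mulmxA eh mul_scalar_mx mul_mx_scalar subrr.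
  by exists h', h; rewrite -eh' subrK.
have [|h'' eh''] := @df_exact i.+1 _ (f%:M - df F i.+1 *m h').
  rewrite mulmxBl -mulmxA -[h' *m _](addrK (df F i *m h)) eh mulmxBr.
  by rewrite mul_scalar_mx mul_mx_scalar mulmxA dfK mul0mx subr0 subrr.
by exists h'', h'; rewrite -eh'' subrK.
Qed.

Definition cocycle_on p i (c : 'I_(rk F i) -> U) :=
  (forall j, nneg_supp p (c j)) /\ forall j, zero_on p (mxact (df F i) c j).

Definition coboundary_on p i : ('I_(rk F i) -> U) -> Prop :=
  match i return ('I_(rk F i) -> U) -> Prop with
  | 0%N => fun c => forall j, zero_on p (c j)
  | i'.+1 => fun c => exists b, (forall j, nneg_supp p (b j)) /\
      forall j, zero_on p (c j - mxact (df F i') b j)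
  end.

Hypothesis hx : forall t : 'I_n, exists N g, [/\ poly_eval x ('X_[U_(t) *+ N] + g) = 0
  & forall m, m \in msupp g -> exists2 i : 'I_n, (i < d)%N & m i != 0%N].

(** The polynomial that [hx] supplies for the variable [t] is null-homotopic on
    the resolution, and it is invertible on functions unconstrained in [t]. *)
Lemma ext_vanish (t : 'I_n) i (c : 'I_(rk F i) -> U) : (d <= t)%N ->
  (forall j, nneg_supp t (c j)) ->
  (forall j, zero_on t.+1 (mxact (df F i) c j)) ->
  match i return ('I_(rk F i) -> U) -> Prop with
  | 0%N => fun c => forall j, zero_on t.+1 (c j)
  | i'.+1 => fun c => exists b, (forall j, nneg_supp t (b j)) /\
      forall j, zero_on t.+1 (c j - mxact (df F i') b j)
  end c.
Proof.
move=> dt hc dc; have [N [g [hf hg]]] := hx t.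
set f := 'X_[U_(t) *+ N] + g in hf.
case: i c hc dc => [|i] c hc dc.
  have [h eh] := null_homotopy0 hf.
  move=> j; apply: (@stage_injective _ _ _ _ N _ dt hg _ (hc j)).
  rewrite -/f -mxact_scalar -eh mxactM; exact: mxact_zero.
have [h' [h eh]] := null_homotopy hf i.
have hb l : nneg_supp t (mxact h c l) by apply: mxact_supp.
have /choice [b hb'] := fun l => @stage_surjective _ _ _ _ N _ dt hg _ (hb l).
exists b; split=> [l|j]; first by case: (hb' l).
apply: (@stage_injective _ _ _ _ N _ dt hg).
  apply: nneg_suppD => //; apply: nneg_suppN; apply: mxact_supp => l.
  by case: (hb' l).
rewrite -/f scalerBr.
have -> : f *: mxact (df F i) b j = mxact (df F i *m h) c j.
  rewrite mxactM -[LHS]addr0.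
  have := mxact_linear (df F i) f b (fun=> 0) j.
  have -> : mxact (df F i) (fun=> 0 : U) j = 0.
    by rewrite /mxact big1 // => l _; rewrite scaler0.
  move=> <-; apply: eq_bigr => l _; congr (_ *: _); rewrite addr0.
  by case: (hb' l).
rewrite -mxact_scalar -eh mxactDl addrK mxactM; exact: mxact_zero.
Qed.

(** Functions without constraint in the variable [t] are an extension of those
    of stage [t] by those of stage [t.+1]; as they have no cohomology, the
    connecting homomorphism from stage [t] to stage [t.+1], which raises the
    degree by one, is bijective. *)
Lemma cocycle_down (t : 'I_n) i (c : 'I_(rk F i.+1) -> U) : (d <= t)%N ->
  cocycle_on t.+1 c -> exists b : 'I_(rk F i) -> U, cocycle_on t b /\
    forall j, zero_on t.+1 (c j - mxact (df F i) b j).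
Proof.
move=> dt [hc dc]; have [|b [hb cb]] := ext_vanish dt _ dc.
  by move=> j; apply: nneg_suppW (leqnSn t) _.
exists b; split=> //; split=> // j.
rewrite -[mxact _ _ _](subKr (c j)); apply: zero_onB; first exact: supp_zero_on.
exact: zero_onW (leqnSn t) _.
Qed.

Lemma cocycle_up (t : 'I_n) i (b : 'I_(rk F i) -> U) :
  cocycle_on t b -> exists c : 'I_(rk F i.+1) -> U, cocycle_on t.+1 c /\
    forall j, zero_on t.+1 (c j - mxact (df F i) b j).
Proof.
move=> [hb db]; exists (fun j => cut_at t (mxact (df F i) b j)).
have cut j : zero_on t.+1 (mxact (df F i) b j - cut_at t (mxact (df F i) b j)).
  exact: cut_at_eq.
split; last by move=> j; rewrite -opprB; apply: zero_onN.
split=> j; first by apply: cut_at_supp; apply: mxact_supp.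
rewrite -[mxact _ _ _](subKr (mxact (df F i.+1) (mxact (df F i) b) j)).
rewrite -mxactB; apply: zero_onB; last exact: mxact_zero.
by rewrite -mxactM dfK /mxact big1 // => l _; rewrite mxE scale0r.
Qed.

Lemma coboundary_down (t : 'I_n) i (c : 'I_(rk F i.+1) -> U) (b : 'I_(rk F i) -> U) :
  (d <= t)%N -> cocycle_on t b ->
  (forall j, zero_on t.+1 (c j - mxact (df F i) b j)) ->
  coboundary_on t.+1 c <-> coboundary_on t b.
Proof.
move=> dt [hb db] hc; split; last first.
  move=> cb; suff [e' [he' ebe]] : exists e' : 'I_(rk F i) -> U,
      (forall l, nneg_supp t (e' l)) /\ (forall l, zero_on t (b l - e' l)) /\
      forall j, mxact (df F i) e' j = 0.
    have cut l := cut_at_eq (ebe.1 l).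
    exists (fun l => cut_at t (b l - e' l)); split=> [l|j].
      apply: cut_at_supp; apply: nneg_suppD => //; exact: nneg_suppN.
    have -> : c j - mxact (df F i) (fun l => cut_at t (b l - e' l)) j =
       (c j - mxact (df F i) b j) +
       mxact (df F i) (fun l => (b l - e' l) - cut_at t (b l - e' l)) j.
      by rewrite !mxactB ebe.2 subr0 addrA subrK.
    by apply: zero_onD => //; apply: mxact_zero.
  case: i c b hb db hc cb => [|i] c b hb db hc cb.
    exists (fun _ => 0); split=> //; split=> [l|j]; first by rewrite subr0; apply: cb.
    by rewrite /mxact big1 // => l _; rewrite scaler0.
  have [a [ha ca]] := cb; exists (mxact (df F i) a); split=> [l|].
    exact: mxact_supp.
  split=> // j; rewrite -mxactM dfK /mxact big1 // => l _.
  by rewrite mxE scale0r.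
move=> [a [ha ca]].
have d0 j : zero_on t.+1 (mxact (df F i) (fun l => b l - a l) j).
  rewrite mxactB -[X in zero_on _ X](subrKA (c j)) addrC; apply: zero_onD => //.
  by rewrite -opprB; apply: zero_onN.
have hba l : nneg_supp t (b l - a l).
  apply: nneg_suppD => //; apply: nneg_suppN; exact: nneg_suppW (leqnSn t) _.
have az l : zero_on t (a l) by apply: supp_zero_on.
have := ext_vanish dt hba d0.
case: i c b a {hb db hc ca d0 hba ha} az => [|i] c b a az /= h.
  move=> j; rewrite -[b j](subrK (a j)); apply: zero_onD => //.
  exact: zero_onW (leqnSn t) _.
have [e' [he' ce']] := h; exists e'; split=> // j.
have -> : b j - mxact (df F i) e' j = (b j - a j - mxact (df F i) e' j) + a j.
  by rewrite addrAC subrK.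
apply: zero_onD => //; exact: zero_onW (leqnSn t) _.
Qed.

End Resolution.

(** * Graded and polynomial cochains *)

Section Components.
Variables (k : fieldType) (R : comAlgType k) (RG : int -> set R) (n : nat).
Variables (x : 'I_n -> R) (F : free_seq k n) (e : 'I_(rk F 0) -> R).
Hypothesis hF : graded_free_resolution RG x e.
Local Notation S := {mpoly k[n]}.
Local Notation U := (laurent k n).

Lemma cocycle_on_linear p i (P : S) (c b : 'I_(rk F i) -> U) :
  cocycle_on p c -> cocycle_on p b -> cocycle_on p (fun j => P *: c j + b j).
Proof.
move=> [hc dc] [hb db]; split=> j.
  by apply: nneg_suppD => //; apply: nneg_suppZ.
by rewrite mxact_linear; apply: zero_onD => //; apply: zero_onZ.
Qed.

Definition lcomp (t : int) (u : U) : U :=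
  fun f => if \sum_i f i == t then u f else 0.

Lemma lcomp_supp p t u : nneg_supp p u -> nneg_supp p (lcomp t u).
Proof. by move=> hu f hf; rewrite /lcomp hu //; case: ifP. Qed.

Lemma lcomp_zero p t u : zero_on p u -> zero_on p (lcomp t u).
Proof. by move=> hu f hf; rewrite /lcomp hu //; case: ifP. Qed.

Lemma lcompB t u v : lcomp t (u - v) = lcomp t u - lcomp t v.
Proof.
apply/funext => f; rewrite laurentB /lcomp laurentB.
by case: ifP; rewrite ?subr0.
Qed.

Lemma lcomp_sum t (I : Type) (r : seq I) (P : pred I) (G : I -> U) :
  lcomp t (\sum_(i <- r | P i) G i) = \sum_(i <- r | P i) lcomp t (G i).
Proof.
apply/funext => f; rewrite laurent_sum /lcomp laurent_sum.
by case: ifP => // _; rewrite big1.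
Qed.

Lemma sum_mshift (f : 'I_n -> int) m :
  \sum_i mshift f m i = \sum_i f i - (mdeg m)%:Z.
Proof. by rewrite sumrB mdegE (big_morph Posz PoszD erefl). Qed.

Lemma lcompZ t r (P : S) u : homog_deg r P -> lcomp t (P *: u) = P *: lcomp (t - r) u.
Proof.
move=> /homog_degP hP; apply/funext => f; rewrite /lcomp !laurentE.
case: ifPn => ft.
  rewrite big_seq [RHS]big_seq; apply: eq_bigr => m; rewrite mcoeff_msupp => /hP mr.
  by rewrite sum_mshift mr (eqP ft) eqxx.
rewrite big_seq big1 // => m; rewrite mcoeff_msupp => /hP mr.
rewrite sum_mshift mr; case: eqP => [e'|_]; last by rewrite mulr0.
by case/eqP: ft; move: e' => /(congr1 (fun z => z + r)); rewrite !subrK.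
Qed.

Definition ccomp (T : int) i (c : 'I_(rk F i) -> U) : 'I_(rk F i) -> U :=
  fun j => lcomp (sh F i j + T) (c j).

Lemma ccomp_mxact T i (c : 'I_(rk F i) -> U) j :
  mxact (df F i) (ccomp T c) j = ccomp T (mxact (df F i) c) j.
Proof.
case: hF => hd _ _ _ _; rewrite /ccomp lcomp_sum; apply: eq_bigr => l _.
rewrite (lcompZ _ _ (hd i j l)); congr (_ *: lcomp _ _); ring.
Qed.

Lemma cocycle_on_ccomp p T i (c : 'I_(rk F i) -> U) :
  cocycle_on p c -> cocycle_on p (ccomp T c).
Proof.
move=> [hc dc]; split=> j; first exact: lcomp_supp.
by rewrite ccomp_mxact; apply: lcomp_zero.
Qed.

Definition mabs (f : 'I_n -> int) : 'X_{1..n} := [multinom `|f i|%N | i < n].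

Definition lpoly (p : S) : U :=
  fun f => if [forall i, 0 <= f i] then p@_(mabs f) else 0.

Lemma lpoly_linear (c : k) p q f : lpoly (c *: p + q) f = c * lpoly p f + lpoly q f.
Proof.
by rewrite /lpoly; case: ifP => _; rewrite ?mulr0 ?addr0 // mcoeffD mcoeffZ.
Qed.

Lemma lpoly0 : lpoly 0 = 0.
Proof. by apply/funext => f; rewrite /lpoly mcoeff0; case: ifP. Qed.

Lemma lpolyD p q : lpoly (p + q) = lpoly p + lpoly q.
Proof.
by apply/funext => f; rewrite -[p in LHS]scale1r lpoly_linear mul1r.
Qed.

Lemma lpoly_sum (I : Type) (r : seq I) (P : pred I) (G : I -> S) :
  lpoly (\sum_(i <- r | P i) G i) = \sum_(i <- r | P i) lpoly (G i).
Proof. exact: (big_morph _ lpolyD lpoly0). Qed.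

Lemma lpolyM p q : lpoly (p * q) = p *: lpoly q.
Proof.
apply/funext => f; elim/mpoly_linear_ind: p => [m||c p p' IHp IHp'].
- rewrite laurentX /lpoly.
  have [/forallP f0|nf0] := boolP [forall i, 0 <= mshift f m i].
    have fm i : (m i)%:Z <= f i by have := f0 i; rewrite /mshift subr_ge0.
    have -> : [forall i, 0 <= f i] by apply/forallP => i; apply: le_trans (fm i).
    have em : mabs f = (m + mabs (mshift f m))%MM.
      apply/mnmP => i; rewrite mnmDE !mnmE; have := fm i; rewrite /mshift; lia.
    by rewrite em mulrC mcoeffMX.
  case: ifP => // /forallP f0; apply: memN_msupp_eq0.
  rewrite mulrC (perm_mem (msuppMX _ _)); apply/mapP => -[m' _ em].
  case/negP: nf0; apply/forallP => i; have := congr1 (fun z : 'X_{1..n} => z i) em.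
  rewrite mnmE mnmDE /mshift; have := f0 i; lia.
- by rewrite mul0r scale0r lpoly0.
- by rewrite mulrDl -scalerAl lpoly_linear IHp IHp' mpoly_act_laurent.
Qed.

Lemma lpoly_supp p q : nneg_supp q (lpoly p).
Proof.
move=> f [i _ fi]; rewrite /lpoly; case: ifP => // /forallP/(_ i).
by rewrite leNgt fi.
Qed.

Lemma lpoly_eq0 p : zero_on n (lpoly p) -> p = 0.
Proof.
move=> h; apply/mpolyP => m; rewrite mcoeff0.
have reg : neg_region n (fun i => (m i)%:Z) by move=> i; rewrite leqNgt ltn_ord.
have := h _ reg; rewrite /lpoly.
have -> : [forall i, 0 <= (m i)%:Z] by apply/forallP.
by have -> : mabs (fun i => (m i)%:Z) = m by apply/mnmP => i; rewrite mnmE.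
Qed.

Lemma lcomp_lpoly t p : lcomp t (lpoly p) = lpoly (hpart t p).
Proof.
apply/funext => f; rewrite /lcomp /lpoly mcoeff_hpart.
case: ifP => ft; case: ifP => // /forallP f0.
  have -> : (mdeg (mabs f))%:Z = t; last by rewrite eqxx.
  rewrite mdegE (big_morph Posz PoszD erefl) -(eqP ft); apply: eq_bigr => i _.
  by rewrite mnmE gez0_abs.
case: eqP => // e'; case/eqP: ft; rewrite -e' mdegE (big_morph Posz PoszD erefl).
by apply: eq_bigr => i _; rewrite mnmE gez0_abs.
Qed.

(** There are finitely many nonnegative exponents of a given total degree. *)
Lemma lcomp_is_lpoly t u : nneg_supp n u -> exists p,
  homog_deg t p /\ lcomp t u = lpoly p.
Proof.
move=> hu; case: t => [t|t]; last first.
  exists 0; split=> //; apply/funext => f; rewrite lpoly0 /lcomp; case: eqP => // ft.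
  apply: hu; apply: contrapT => h.
  have : 0 <= \sum_i f i.
    apply: sumr_ge0 => i _; rewrite leNgt; apply/negP => fi; apply: h.
    by exists i.
  by rewrite ft.
pose p : S := \sum_(m : 'X_{1..n < t.+1}) lcomp t%:Z u (fun i => (m i)%:Z) *: 'X_[m].
have pE m : p@_m = lcomp t%:Z u (fun i => (m i)%:Z).
  have [mt|tm] := ltnP (mdeg m) t.+1.
    exact: (mcoeff_mpoly (fun m => lcomp t%:Z u (fun i => (m i)%:Z)) mt).
  rewrite raddf_sum big1 /=; last first.
    move=> m' _; rewrite mcoeffZ mcoeffX; case: eqP => [e'|_]; last by rewrite mulr0.
    by have := bmdeg m'; rewrite e' ltnNge tm.
  rewrite /lcomp -(big_morph Posz PoszD erefl) -mdegE eqz_nat.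
  by case: eqP => // e'; rewrite e' ltnn in tm.
exists p; split.
  apply/homog_degP => m; rewrite pE /lcomp -(big_morph Posz PoszD erefl) -mdegE.
  by case: (_ =P t%:Z) => //; rewrite eqxx.
apply/funext => f; rewrite /lpoly pE; case: ifPn => [/forallP f0|].
  by congr (lcomp _ u _); apply/funext => i; rewrite mnmE gez0_abs.
rewrite negb_forall => /existsP [i]; rewrite -ltNge => fi.
rewrite /lcomp; case: ifP => // _; apply: hu; by exists i.
Qed.

Definition lcochain i (c : 'cV[S]_(rk F i)) : 'I_(rk F i) -> U :=
  fun j => lpoly (c j 0).

Lemma mxact_lcochain i (c : 'cV[S]_(rk F i)) j :
  mxact (df F i) (lcochain c) j = lpoly ((df F i *m c) j 0).
Proof. by rewrite mxE lpoly_sum; apply: eq_bigr => l _; rewrite lpolyM. Qed.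

Lemma cocycle_lcochain i (c : 'cV[S]_(rk F i)) :
  cocycle c <-> cocycle_on n (lcochain c).
Proof.
split=> [hc|[_ dc]].
  split=> j; first exact: lpoly_supp.
  by rewrite mxact_lcochain hc mxE lpoly0.
apply/colP => j; rewrite [RHS]mxE; apply: lpoly_eq0.
by rewrite -mxact_lcochain.
Qed.

Lemma ccomp_lcochain T i (c : 'cV[S]_(rk F i)) :
  (forall j, homog_deg (sh F i j + T) (c j 0)) ->
  ccomp T (lcochain c) = lcochain c.
Proof.
by move=> hc; apply/funext => j; rewrite /ccomp /lcochain lcomp_lpoly hpart_id.
Qed.

Lemma ccomp_is_lcochain T i (c : 'I_(rk F i) -> U) : cocycle_on n c ->
  exists c' : 'cV[S]_(rk F i), (forall j, homog_deg (sh F i j + T) (c' j 0)) /\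
    ccomp T c = lcochain c'.
Proof.
move=> [hc _]; have /choice [p hp] := fun j => lcomp_is_lpoly (sh F i j + T) (hc j).
exists (\col_j p j); split=> [j|]; first by rewrite mxE; case: (hp j).
by apply/funext => j; rewrite /lcochain mxE; case: (hp j).
Qed.

(** A power series cochain bounding [c] can be replaced by its homogeneous
    component of the same degree as [c], which is polynomial. *)
Lemma coboundary_lcochain T i (c : 'cV[S]_(rk F i)) :
  (forall j, homog_deg (sh F i j + T) (c j 0)) ->
  coboundary_on n (lcochain c) -> coboundary c.
Proof.
case: i c => [|i] c hc.
  by move=> h; apply/colP => j; rewrite [RHS]mxE; apply: lpoly_eq0; apply: h.
move=> [b [hb cb]].
have /choice [p hp] := fun j => lcomp_is_lpoly (sh F i j + T) (hb j).
exists (\col_j p j); apply/colP => j; apply/eqP; rewrite -subr_eq0; apply/eqP.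
apply: lpoly_eq0; rewrite lpolyD -[- (_ *m _) j 0]mulN1r lpolyM scaleN1r.
rewrite -mxact_lcochain.
have -> : lcochain (\col_j p j) = ccomp T b.
  by apply/funext => l; rewrite /lcochain mxE; case: (hp l).
rewrite ccomp_mxact -[lpoly (c j 0)]/(lcochain c j) -(ccomp_lcochain hc).
by rewrite /ccomp -lcompB; apply: lcomp_zero.
Qed.

End Components.

Section Connecting.
Variables (k : fieldType) (R : comAlgType k) (RG : int -> set R) (n d : nat).
Variables (x : 'I_n -> R) (F : free_seq k n) (e : 'I_(rk F 0) -> R).
Hypothesis hF : graded_free_resolution RG x e.
Hypothesis hx : forall t : 'I_n, exists N g, [/\ poly_eval x ('X_[U_(t) *+ N] + g) = 0
  & forall m, m \in msupp g -> exists2 i : 'I_n, (i < d)%N & m i != 0%N].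
Variable s : nat.
Hypothesis ds : (d <= s)%N.
Local Notation S := {mpoly k[n]}.
Local Notation U := (laurent k n).

(** The iterated connecting homomorphism between the cohomology in degree
    [q + i] at stage [q + s] and the one in degree [i] at stage [s], as a
    relation between cocycles. *)
Fixpoint connected q i : ('I_(rk F (q + i)) -> U) -> ('I_(rk F i) -> U) -> Prop :=
  match q return ('I_(rk F (q + i)) -> U) -> ('I_(rk F i) -> U) -> Prop with
  | 0%N => fun c c0 => forall j, zero_on s (c j - c0 j)
  | q'.+1 => fun c c0 => exists b : 'I_(rk F (q' + i)) -> U,
      [/\ cocycle_on (q' + s) b,
          forall j, zero_on (q' + s).+1 (c j - mxact (df F (q' + i)) b j)
        & connected b c0]
  end.

Lemma connected_total q i (c : 'I_(rk F (q + i)) -> U) : (q + s <= n)%N ->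
  cocycle_on (q + s) c ->
  exists c0 : 'I_(rk F i) -> U, cocycle_on s c0 /\ connected c c0.
Proof.
elim: q c => [|q IH] c qn hc; first by exists c; split=> // j; rewrite subrr.
have dt : (d <= Ordinal qn)%N by apply: leq_trans ds (leq_addl _ _).
have [b [hb cb]] := cocycle_down hF hx dt hc.
have [c0 [h0 bc0]] := IH b (ltnW qn) hb.
by exists c0; split=> //; exists b.
Qed.

Lemma connected_surj q i (c0 : 'I_(rk F i) -> U) : (q + s <= n)%N ->
  cocycle_on s c0 ->
  exists c : 'I_(rk F (q + i)) -> U, cocycle_on (q + s) c /\ connected c c0.
Proof.
elim: q => [|q IH] qn hc; first by exists c0; split=> // j; rewrite subrr.
have [b [hb bc0]] := IH (ltnW qn) hc.
have [c [hc' cb]] := @cocycle_up _ _ _ _ _ _ _ hF (Ordinal qn) _ _ hb.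
by exists c; split=> //; exists b.
Qed.

Lemma connected_coboundary q i (c : 'I_(rk F (q + i)) -> U) c0 : (q + s <= n)%N ->
  connected c c0 -> coboundary_on (q + s) c <-> coboundary_on s c0.
Proof.
elim: q c => [|q IH] c qn.
  case: i c c0 => [|i] c c0 cc0.
    split=> h j; last by rewrite -[c j](subrK (c0 j)); apply: zero_onD.
    by rewrite -[c0 j](subKr (c j)); apply: zero_onB.
  split=> -[b [hb bc]]; exists b; split=> // j.
    have -> : c0 j - mxact (df F i) b j =
       (c j - mxact (df F i) b j) - (c j - c0 j).
      by rewrite opprB [RHS]addrC addrA subrK.
    exact: zero_onB.
  rewrite -[X in zero_on _ X](subrKA (c0 j)); exact: zero_onD.
case=> b [hb cb bc0]; have dt : (d <= Ordinal qn)%N by apply: leq_trans ds (leq_addl _ _).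
rewrite -(IH _ (ltnW qn) bc0).
exact: (coboundary_down hF hx dt hb cb).
Qed.

Lemma connected_linear q i (P : S) (c c' : 'I_(rk F (q + i)) -> U) c0 c0' :
  connected c c0 -> connected c' c0' ->
  connected (fun j => P *: c j + c' j) (fun j => P *: c0 j + c0' j).
Proof.
have lin p (u v u' v' : U) : zero_on p (u - v) -> zero_on p (u' - v') ->
    zero_on p (P *: u + u' - (P *: v + v')).
  move=> h h'; rewrite opprD addrACA -scalerBr.
  by apply: zero_onD => //; apply: zero_onZ.
elim: q c c' => [|q IH] c c'; first by move=> h h' j; apply: lin.
case=> b [hb cb bc0] [b' [hb' cb' bc0']].
exists (fun j => P *: b j + b' j); split.
- exact: cocycle_on_linear.
- by move=> j; rewrite mxact_linear; apply: lin.
- exact: IH.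
Qed.

Lemma connected_ccomp T q i (c : 'I_(rk F (q + i)) -> U) c0 :
  connected c c0 -> connected (ccomp T c) (ccomp T c0).
Proof.
elim: q c => [|q IH] c; first by move=> h j; rewrite -lcompB; apply: lcomp_zero.
case=> b [hb cb bc0]; exists (ccomp T b); split.
- exact: (cocycle_on_ccomp hF).
- by move=> j; rewrite (ccomp_mxact hF) -lcompB; apply: lcomp_zero.
- exact: IH.
Qed.

End Connecting.

(** * Functionals over the parameter subalgebra *)

Lemma mpoly_var_ind (k : fieldType) (n : nat) (P : {mpoly k[n]} -> Prop) :
  P 0 -> P 1 -> (forall i p, P p -> P ('X_i * p)) ->
  (forall c p q, P p -> P q -> P (c *: p + q)) -> forall p, P p.
Proof.
move=> P0 P1 PX PL; apply: mpoly_linear_ind => // m; elim/mnm_add_ind: m => [|i m hm].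
  by rewrite mpolyX0.
by rewrite mpolyXD; apply: PX.
Qed.

Section Residue.
Variables (k : fieldType) (n d : nat) (le_dn : (d <= n)%N).
Local Notation S := {mpoly k[n]}.
Local Notation U := (laurent k n).
Local Notation wid := (widen_ord le_dn).

(** The exponent with nonnegative part [m] in the first [d] variables and [-1] in
    the others: the coefficients there form the residue. *)
Definition pt (m : 'X_{1..d}) : 'I_n -> int :=
  fun i => if insub (val i) is Some j then (m j)%:Z else -1.

Lemma pt_low m (j : 'I_d) : pt m (wid j) = (m j)%:Z.
Proof. by rewrite /pt /= valK. Qed.

Lemma pt_high m (i : 'I_n) : (d <= i)%N -> pt m i = -1.
Proof. by move=> di; rewrite /pt insubF // ltnNge di. Qed.

Lemma pt_region m : neg_region d (pt m).
Proof. by move=> i di; rewrite pt_high. Qed.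

Lemma low_wid (i : 'I_n) : (i < d)%N -> exists j : 'I_d, i = wid j.
Proof. by move=> id; exists (Ordinal id); apply: val_inj. Qed.

Lemma wid_eq (j l : 'I_d) : (wid j == wid l) = (j == l).
Proof. by []. Qed.

Lemma laurent_pt_low (u : U) m (j : 'I_d) : nneg_supp d u ->
  ('X_(wid j) *: u) (pt m) = if m j == 0%N then 0 else u (pt (m - U_(j))).
Proof.
move=> hu; rewrite laurentX; case: eqP => mj.
  apply: hu; exists (wid j) => /=; first exact: ltn_ord.
  by rewrite /mshift pt_low mnm1E eqxx mj.
congr (u _); apply/funext => i; rewrite /mshift.
have [/low_wid [l ->]|di] := ltnP i d.
  rewrite !pt_low mnmBE !mnm1E wid_eq; case: eqP => [<-|_]; last by rewrite subn0 subr0.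
  by move/eqP: mj; rewrite -lt0n => mj; rewrite -subzn.
rewrite !pt_high // mnm1E; case: eqP => [e|_]; last by rewrite subr0.
by move: di; rewrite -e /= leqNgt ltn_ord.
Qed.

Lemma sum_pt m : \sum_i pt m i = (mdeg m)%:Z - (n - d)%:Z.
Proof.
pose G (i : nat) : int := if insub i is Some j then (m j)%:Z else -1.
rewrite -[LHS]/(\sum_(i < n) G i) -(big_mkord xpredT G) (big_cat_nat _ le_dn) //=.
congr (_ + _).
  rewrite big_mkord mdegE (big_morph Posz PoszD erefl); apply: eq_bigr => i _.
  by rewrite /G valK.
rewrite (eq_big_nat _ _ (F2 := fun _ => -1)) ?sumr_const_nat ?mulNrn ?natz //.
by move=> i /andP [di _]; rewrite /G insubF // ltnNge di.
Qed.

Definition gam (f : 'I_n -> int) : 'X_{1..n} :=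
  [multinom (if (i < d)%N then 0%N else `|(f i + 1)%R|%N) | i < n].

Definition mlowpart (f : 'I_n -> int) : 'X_{1..d} := [multinom `|f (wid j)|%N | j < d].

Definition has_neg (f : 'I_n -> int) := [exists i : 'I_n, (i < d)%N && (f i < 0)].

Lemma has_negP f : reflect (exists2 i : 'I_n, (i < d)%N & f i < 0) (has_neg f).
Proof.
by apply: (iffP existsP) => [[i /andP []]|[i h1 h2]]; exists i => //; apply/andP.
Qed.

Lemma pt_lowpart f : neg_region d f -> ~~ has_neg f ->
  mshift (pt (mlowpart f)) (gam f) = f.
Proof.
move=> hf hn; apply/funext => l; rewrite /mshift mnmE.
case: ifPn => [/low_wid [l' ->]|ld].
  rewrite subr0 pt_low mnmE gez0_abs // leNgt; apply: contra hn => fl.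
  by apply/has_negP; exists (wid l') => //=; apply: ltn_ord.
have := hf l; rewrite pt_high leqNgt ld // => /(_ isT); lia.
Qed.

(** A functional [Psi] with values in series over the first [d] variables, linear
    over the polynomials in these variables, extends to the Laurent function
    whose coefficients are the values of [Psi] at the monomials in the remaining
    variables. *)
Variable Psi : S -> 'X_{1..d} -> k.
Hypothesis PsiL : forall (c : k) p q m, Psi (c *: p + q) m = c * Psi p m + Psi q m.
Hypothesis PsiX : forall (j : 'I_d) p m,
  Psi ('X_(wid j) * p) m = if m j == 0%N then 0 else Psi p (m - U_(j)).

Definition coind : U := fun f => if has_neg f then 0 else Psi 'X_[gam f] (mlowpart f).

Lemma coind_supp : nneg_supp d coind.
Proof. by move=> f hf; rewrite /coind; have /has_negP -> := hf. Qed.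

Let Psi0 m : Psi 0 m = 0.
Proof.
have h : Psi (-1 *: 0 + 0) m = 0 by rewrite PsiL mulN1r addNr.
by rewrite scaler0 addr0 in h.
Qed.

Lemma coindP p f : neg_region d f ->
  (p *: coind) f = if has_neg f then 0 else Psi ('X_[gam f] * p) (mlowpart f).
Proof.
elim/mpoly_var_ind: p f => [||i p IH|c p q IHp IHq] f hf.
- by rewrite scale0r laurent0 mulr0 Psi0; case: ifP.
- by rewrite scale1r mulr1.
- rewrite -scalerA laurentX IH; last exact: neg_region_shift.
  have [/low_wid [j ei]|di] := ltnP i d.
    have gs : gam (mshift f U_(i)) = gam f.
      apply/mnmP => l; rewrite !mnmE /mshift; case: ifPn => // ld.
      rewrite mnm1E; case: eqP => [il|]; last by rewrite subr0.
      by case/negP: ld; rewrite -il ei /= ltn_ord.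
    have [hn|hn] := boolP (has_neg f).
      have -> // : has_neg (mshift f U_(i)).
      have [l ld fl] := elimT (has_negP _) hn; apply/has_negP; exists l => //.
      by rewrite /mshift; lia.
    have fpos (l : 'I_d) : 0 <= f (wid l).
      rewrite leNgt; apply: contra hn => fl; apply/has_negP.
      by exists (wid l) => //=; exact: ltn_ord.
    rewrite ei mulrCA PsiX mnmE; case: eqP => f0.
      have -> // : has_neg (mshift f U_(wid j)).
      apply/has_negP; exists (wid j); rewrite /= ?ltn_ord // /mshift mnm1E eqxx.
      by have := fpos j; lia.
    rewrite ifF; last first.
      apply: negbTE; apply/negP => /has_negP [l /low_wid [l' ->]]; rewrite /mshift mnm1E wid_eq.
      by case: eqP => [<-|_]; have := fpos j; have := fpos l'; lia.
    rewrite -ei gs; congr (Psi _ _); apply/mnmP => l.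
    rewrite mnmBE !mnmE /mshift ei mnm1E wid_eq.
    by have := fpos l; case: eqP => [<-|_] /=; lia.
  have -> : has_neg (mshift f U_(i)) = has_neg f.
    apply: eq_existsb => l; case: (ltnP l d) => //= ld; rewrite /mshift mnm1E.
    by case: eqP => [il|]; rewrite ?subr0 //; rewrite -il ltnNge di in ld.
  case: ifP => // _.
  have -> : mlowpart (mshift f U_(i)) = mlowpart f.
    apply/mnmP => l; rewrite !mnmE /mshift mnm1E; case: eqP => [il|].
      by move: di; rewrite il /= leqNgt ltn_ord.
    by rewrite subr0.
  rewrite mulrA -mpolyXD; congr (Psi ('X_[_] * _) _); apply/mnmP => l.
  rewrite mnmDE !mnmE /mshift mnm1E; case: ifP => ld.
    by case: eqP => // il; rewrite -il ltnNge di in ld.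
  have := hf l; rewrite leqNgt ld => /(_ isT).
  by case: eqP => [<-|_] /=; lia.
- rewrite mpoly_act_laurent IHp // IHq // mulrDr -scalerAr PsiL.
  by case: ifP; rewrite ?mulr0 ?addr0.
Qed.

End Residue.

(** * Contracting the resolution over the parameter subalgebra *)

Section Contraction.
Variables (k : fieldType) (n d : nat) (le_dn : (d <= n)%N).
Local Notation S := {mpoly k[n]}.
Local Notation U := (laurent k n).
Local Notation wid := (widen_ord le_dn).

Definition low_linear r r' (T : 'rV[S]_r -> 'rV[S]_r') :=
  (forall (c : k) u v, T (c%:MP *: u + v) = c%:MP *: T u + T v) /\
  (forall (j : 'I_d) u, T ('X_(wid j) *: u) = 'X_(wid j) *: T u).

Section LowLinear.
Variables (r r' : nat) (T : 'rV[S]_r -> 'rV[S]_r').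
Hypothesis hT : low_linear T.

Lemma low_linear0 : T 0 = 0.
Proof.
case: hT => h _; have := h (-1) 0 0; rewrite scaler0 addr0 => ->.
by rewrite mpolyCN mpolyC1 scaleN1r addNr.
Qed.

Lemma low_linearD u v : T (u + v) = T u + T v.
Proof.
by case: hT => h _; have := h 1 u v; rewrite mpolyC1 !scale1r.
Qed.

Lemma low_linear_sum (I : Type) (s : seq I) (P : pred I) (G : I -> 'rV[S]_r) :
  T (\sum_(i <- s | P i) G i) = \sum_(i <- s | P i) T (G i).
Proof. exact: (big_morph _ low_linearD low_linear0). Qed.

Definition mlow (m : 'X_{1..n}) : 'X_{1..n} :=
  [multinom (if (i < d)%N then m i else 0%N) | i < n].
Definition mhigh (m : 'X_{1..n}) : 'X_{1..n} :=
  [multinom (if (i < d)%N then 0%N else m i) | i < n].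

Lemma mlow_high m : m = (mlow m + mhigh m)%MM.
Proof. by apply/mnmP => i; rewrite mnmDE !mnmE; case: ifP; rewrite ?addn0. Qed.

Lemma mlow_wid (i : 'I_d) m : mlow (U_(wid i) + m) = (U_(wid i) + mlow m)%MM.
Proof.
apply/mnmP => l; rewrite mnmDE !mnmE; case: ifPn => // nl.
by case: eqP => // e; case/negP: nl; rewrite -e /= ltn_ord.
Qed.

Lemma low_linear_mon m u : T ('X_[mlow m] *: u) = 'X_[mlow m] *: T u.
Proof.
elim/mnm_add_ind: m => [|i m IH].
  have -> : mlow 0 = 0%MM by apply/mnmP => i; rewrite mnmE mnm0E; case: ifP.
  by rewrite mpolyX0 !scale1r.
have [id|di] := boolP (i < d)%N; last first.
  have -> // : mlow (U_(i) + m) = mlow m.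
  apply/mnmP => l; rewrite !mnmE; case: ifP => // ld; case: eqP => // il.
  by case/negP: di; rewrite il.
have [j ->] := low_wid le_dn id.
by rewrite mlow_wid mpolyXD -!scalerA hT.2 IH.
Qed.

End LowLinear.

Lemma row_linear_ind r (P : 'rV[S]_r -> Prop) :
  (forall m l, P ('X_[m] *: delta_mx 0 l)) -> P 0 ->
  (forall (c : k) u v, P u -> P v -> P (c%:MP *: u + v)) -> forall v, P v.
Proof.
move=> PX P0 PL v.
have PD u w : P u -> P w -> P (u + w).
  by move=> hu hw; have := PL 1 u w hu hw; rewrite mpolyC1 scale1r.
rewrite [v]row_sum_delta; elim/big_rec: _ => // l w _ hw; apply: PD => //.
elim/mpoly_linear_ind: (v 0 l) => [m||c p q hp hq]; first exact: PX.
  by rewrite scale0r.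
by rewrite scalerDl -mul_mpolyC -scalerA; apply: PL.
Qed.

(** A map linear over the polynomials in the first [d] variables, with values
    in the row space of [D], factors through multiplication by [D]: it suffices
    to lift the values at the monomials in the remaining variables. *)
Lemma low_linear_lift r r' r'' (T : 'rV[S]_r -> 'rV[S]_r'') (D : 'M[S]_(r', r'')) :
  low_linear T -> (forall v, exists w, T v = w *m D) ->
  exists s : 'rV[S]_r -> 'rV[S]_r', low_linear s /\ forall v, s v *m D = T v.
Proof.
move=> hT im.
have /choice [G hG] : forall z : 'I_r * 'X_{1..n}, exists w : 'rV[S]_r',
    T ('X_[mhigh z.2] *: delta_mx 0 z.1) = w *m D by move=> z; apply: im.
pose g l (m : 'X_{1..n}) := G (l, mhigh m).
have hg l m : T ('X_[mhigh m] *: delta_mx 0 l) = g l m *m D.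
  rewrite /g -hG /=; congr (T ('X_[_] *: _)); apply/mnmP => i; rewrite !mnmE.
  by case: ifP.
pose s (v : 'rV[S]_r) : 'rV[S]_r' :=
  \row_j \sum_l linext (fun m => 'X_[mlow m] * g l m 0 j) (v 0 l).
have sL (c : k) u v : s (c%:MP *: u + v) = c%:MP *: s u + s v.
  apply/rowP => j; rewrite !mxE mulr_sumr -big_split; apply: eq_bigr => l _.
  by rewrite !mxE !mul_mpolyC linext_linear.
have s0 : s 0 = 0.
  by apply/rowP => j; rewrite !mxE big1 // => l _; rewrite mxE linext0.
have sX m l : s ('X_[m] *: delta_mx 0 l) = 'X_[mlow m] *: g l m.
  apply/rowP => j; rewrite !mxE (bigD1 l) //= big1 => [|l' l'l].
    by rewrite !mxE !eqxx mulr1 linextX addr0.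
  by rewrite !mxE (negbTE l'l) andbF mulr0 linext0.
exists s; split.
  split=> // i; apply: row_linear_ind => [m l||c u v hu hv].
  - rewrite scalerA -mpolyXD !sX scalerA -mpolyXD.
    rewrite mlow_wid; congr (_ *: G (l, _)); apply/mnmP => l'; rewrite !mnmE; case: ifPn => // nl.
    by case: eqP => // e; case/negP: nl; rewrite -e /= ltn_ord.
  - by rewrite scaler0 s0 scaler0.
  - by rewrite sL scalerDr scalerA mulrC -scalerA sL hu hv scalerDr !scalerA mulrC.
apply: row_linear_ind => [m l||c u v hu hv].
- rewrite sX -scalemxAl -hg -(low_linear_mon hT) scalerA -mpolyXD.
  by rewrite -mlow_high.
- by rewrite (low_linear0 hT) s0 mul0mx.
- by rewrite sL mulmxDl -scalemxAl hu hv hT.1.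
Qed.

Definition rowact r (c : 'I_r -> U) (v : 'rV[S]_r) : U := \sum_l v 0 l *: c l.

Lemma rowact_linear r (c : 'I_r -> U) p u v :
  rowact c (p *: u + v) = p *: rowact c u + rowact c v.
Proof.
rewrite /rowact scaler_sumr -big_split; apply: eq_bigr => l _.
by rewrite !mxE scalerDl scalerA.
Qed.

Lemma rowact0 r (c : 'I_r -> U) : rowact c 0 = 0.
Proof. by rewrite /rowact big1 // => l _; rewrite mxE scale0r. Qed.

Lemma rowactB r (c : 'I_r -> U) u v : rowact c (u - v) = rowact c u - rowact c v.
Proof.
by rewrite -sumrB; apply: eq_bigr => l _; rewrite !mxE scalerBl.
Qed.

Lemma rowact_mul r r' (c : 'I_r -> U) (w : 'rV[S]_r') (D : 'M[S]_(r', r)) :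
  rowact c (w *m D) = \sum_j w 0 j *: mxact D c j.
Proof.
rewrite /rowact; under [RHS]eq_bigr do rewrite scaler_sumr.
rewrite exchange_big; apply: eq_bigr => l _; rewrite mxE scaler_suml.
by apply: eq_bigr => i _; rewrite scalerA.
Qed.

Lemma rowact_delta r (c : 'I_r -> U) l : rowact c (delta_mx 0 l) = c l.
Proof.
rewrite /rowact (bigD1 l) //= mxE !eqxx scale1r big1 ?addr0 // => i il.
by rewrite mxE (negbTE il) andbF scale0r.
Qed.

Lemma rowact_supp p r (c : 'I_r -> U) v : (forall l, nneg_supp p (c l)) ->
  nneg_supp p (rowact c v).
Proof. by move=> hc; apply: nneg_supp_sum => l _; apply: nneg_suppZ. Qed.

Variables (R : comAlgType k) (RG : int -> set R).
Variables (x : 'I_n -> R) (y : 'I_d -> R) (F : free_seq k n) (e : 'I_(rk F 0) -> R).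
Hypothesis hF : graded_free_resolution RG x e.
Hypothesis hxy : forall j, x (wid j) = y j.
Variables (q : nat) (b : 'I_q -> R) (pi : 'I_q -> R -> {mpoly k[d]}).
Hypothesis pib : forall r, r = \sum_j poly_eval y (pi j r) * b j.
Hypothesis piL : forall j p r s, pi j (poly_eval y p * r + s) = p * pi j r + pi j s.

(** [R] and all terms of the resolution are free over the polynomials in the
    first [d] variables, so the resolution splits over them. *)
Lemma contraction i : exists s : 'rV[S]_(rk F i) -> 'rV[S]_(rk F i.+1),
  low_linear s /\ forall v : 'rV_(rk F i.+1),
    s (v *m df F i) *m df F i = v *m df F i.
Proof.
elim: i => [|i [s [hs es]]].
  have /choice [u hu] := fun j => aug_surj hF (b j).
  pose iota (p : {mpoly k[d]}) : S := poly_eval (fun j => 'X_(wid j)) p.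
  pose sigma r : 'rV[S]_(rk F 0) := \sum_j iota (pi j r) *: u j.
  have aug_lin := augmentation_linear x e.
  have augS (f : 'I_q -> S) : augmentation x e (\sum_j f j *: u j) =
      \sum_j poly_eval x (f j) * b j.
    elim/big_rec2: _ => [|j r v _ <-]; first exact: augmentation0.
    by rewrite aug_lin hu.
  have aug_sigma r : augmentation x e (sigma r) = r.
    rewrite augS [RHS]pib; apply: eq_bigr => j _; congr (_ * _).
    rewrite /iota poly_eval_comp; apply: eq_poly_eval => l.
    by rewrite poly_evalXU hxy.
  have sigmaL p r r' : sigma (poly_eval y p * r + r') = iota p *: sigma r + sigma r'.
    rewrite /sigma scaler_sumr -big_split; apply: eq_bigr => j _.
    by rewrite piL /iota poly_evalD poly_evalM scalerDl scalerA.
  have sigma0 : sigma 0 = 0.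
    rewrite /sigma big1 // => l _; have := piL l (-1) 0 0.
    by rewrite mulr0 addr0 mulN1r addNr => ->; rewrite /iota poly_eval0 scale0r.
  pose T v := v - sigma (augmentation x e v).
  have [||s [hs es]] := @low_linear_lift _ _ _ T (df F 0).
  - split=> [c u' v|j v]; rewrite /T.
      rewrite aug_lin poly_evalC -(poly_evalC y) sigmaL /iota poly_evalC.
      have -> : c%:A = c%:MP :> S by rewrite -mul_mpolyC mulr1.
      by rewrite scalerBr opprD addrACA.
    rewrite -['X_(wid j) *: v]addr0 aug_lin poly_evalXU hxy.
    rewrite -(poly_evalXU y) sigmaL /iota poly_evalXU addr0.
    by rewrite augmentation0 sigma0 addr0 scalerBr.
  - by move=> v; apply/(aug_ker hF); rewrite /T augmentationB aug_sigma subrr.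
  exists s; split=> // v; rewrite es /T.
  have -> : augmentation x e (v *m df F 0) = 0 by apply/(aug_ker hF); exists v.
  by rewrite sigma0 subr0.
pose T v := v - s (v *m df F i).
have [||s' [hs' es']] := @low_linear_lift _ _ _ T (df F i.+1).
- split=> [c u v|j v]; rewrite /T.
    by rewrite mulmxDl -scalemxAl hs.1 scalerBr opprD addrACA.
  by rewrite -scalemxAl hs.2 scalerBr.
- move=> v; apply: (df_exact hF); by rewrite /T mulmxBl es subrr.
exists s'; split=> // v; rewrite es' /T -mulmxA (dfK hF) mulmx0.
by rewrite (low_linear0 hs) subr0.
Qed.

(** Composing a cocycle with the contraction gives functionals linear over the
    polynomials in the first [d] variables; the Laurent functions that they
    coinduce bound the cocycle. *)
Lemma ext_vanish_high i (c : 'I_(rk F i.+1) -> U) :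
  cocycle_on d c -> coboundary_on d c.
Proof.
move=> [hc dc]; have [s [hs es]] := contraction i.
pose Psi l (p : S) (m : 'X_{1..d}) : k := rowact c (s (p *: delta_mx 0 l)) (pt m).
have PsiL l (a : k) p p' m : Psi l (a *: p + p') m = a * Psi l p m + Psi l p' m.
  rewrite /Psi scalerDl -mul_mpolyC -scalerA hs.1 rowact_linear laurentD.
  by rewrite laurentCP.
have PsiX l (j : 'I_d) p m : Psi l ('X_(wid j) * p) m =
    if m j == 0%N then 0 else Psi l p (m - U_(j))%MM.
  rewrite /Psi -scalerA hs.2 -[_ *: s _]addr0 rowact_linear rowact0 addr0.
  by rewrite laurent_pt_low //; apply: rowact_supp.
exists (fun l => coind le_dn (Psi l)); split=> [l|j f hf]; first exact: coind_supp.
rewrite laurentB /mxact laurent_sum.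
under eq_bigr do rewrite (coindP (PsiL _) (PsiX _) _ hf).
have [hn|hn] := boolP (has_neg d f).
  rewrite big1 // subr0; apply: hc; exact/has_negP.
have -> : \sum_l Psi l ('X_[gam d f] * df F i j l) (mlowpart le_dn f) =
    rowact c (s (('X_[gam d f] *: delta_mx 0 j) *m df F i)) (pt (mlowpart le_dn f)).
  rewrite /Psi -[LHS](@laurent_sum k n _ _ xpredT
    (fun l => rowact c (s (('X_[gam d f] * df F i j l) *: delta_mx 0 l)))).
  suff -> : \sum_l rowact c (s (('X_[gam d f] * df F i j l) *: delta_mx 0 l)) =
    rowact c (s (('X_[gam d f] *: delta_mx 0 j) *m df F i)) by [].
  rewrite -scalemxAl -rowE.
  rewrite [X in s X](_ : _ = \sum_l ('X_[gam d f] * df F i j l) *: delta_mx 0 l).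
    rewrite (low_linear_sum hs) /rowact exchange_big; apply: eq_bigr => l' _.
    by rewrite summxE scaler_suml.
  by rewrite [LHS]row_sum_delta; apply: eq_bigr => l _; rewrite !mxE.
set v := 'X_[gam d f] *: delta_mx 0 j.
have [w hw] : exists w, v - s (v *m df F i) = w *m df F i.+1.
  by apply: (df_exact hF); rewrite mulmxBl es subrr.
have -> : s (v *m df F i) = v - w *m df F i.+1 by rewrite -hw subKr.
have z : zero_on d (rowact c (w *m df F i.+1)).
  by rewrite rowact_mul; apply: zero_on_sum => l _; apply: zero_onZ.
rewrite rowactB laurentB z; last exact: pt_region.
rewrite subr0 -[v]addr0 rowact_linear rowact_delta laurentD laurentX.
by rewrite rowact0 laurent0 addr0 pt_lowpart // subrr.
Qed.

End Contraction.

(** * Duality for the canonical module *)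

Section Duality.
Variables (k : fieldType) (R : comAlgType k) (RG : int -> set R).
Hypothesis hR : standard_graded RG.
Variables (d : nat) (y : 'I_d -> R).
Hypothesis hrad : radical (ideal_gen (range y)) = irrelevant_ideal RG.
Variables (q : nat) (b : 'I_q -> R) (pi : 'I_q -> R -> {mpoly k[d]}).
Hypothesis pib : forall r, r = \sum_j poly_eval y (pi j r) * b j.
Hypothesis piL : forall j p r s, pi j (poly_eval y p * r + s) = p * pi j r + pi j s.
Variables (n : nat) (le_dn : (d <= n)%N) (x : 'I_n -> R).
Hypothesis hx : linear_generators RG x.
Local Notation wid := (widen_ord le_dn).
Hypothesis hxy : forall j, x (wid j) = y j.
Variables (F : free_seq k n) (e : 'I_(rk F 0) -> R).
Hypothesis hF : graded_free_resolution RG x e.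
Variables (W : lmodType R) (WG : int -> set W).
Hypothesis hW : graded_module RG WG.
Local Notation S := {mpoly k[n]}.
Local Notation U := (laurent k n).
Let gRG := sg_grading hR.
Let gWG : is_grading WG. Proof. by case: hW. Qed.

(** A power of the generator [x t] lies in the ideal of the parameters, which
    are the first [d] generators. *)
Lemma power_relation (t : 'I_n) : exists N g,
  [/\ poly_eval x ('X_[U_(t) *+ N] + g) = 0
  & forall m, m \in msupp g -> exists2 i : 'I_n, (i < d)%N & m i != 0%N].
Proof.
have : radical (ideal_gen (range y)) (x t).
  by rewrite hrad; apply: (@irrelevant_homog _ _ _ 1) => //; apply: hx.1.
move=> [N /ideal_gen_rangeP [a ea]].
have /choice [A hA] := fun j => hx.2 (a j).
exists N, (- \sum_j A j * 'X_(wid j)); split.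
  rewrite poly_evalD -mpolyXn poly_evalXn poly_evalXU ea poly_evalN poly_eval_sum.
  apply/eqP; rewrite subr_eq0; apply/eqP; apply: eq_bigr => j _.
  by rewrite poly_evalM poly_evalXU hxy hA.
move=> m; rewrite (perm_mem (msuppN _)) => /msupp_sum_le /flatten_mapP [j _].
rewrite (perm_mem (msuppMX _ _)) => /mapP [m' _ ->].
exists (wid j); first by rewrite /= ltn_ord.
by rewrite mnmDE mnm1E eqxx.
Qed.

(** Below degree [n - d] the Ext modules vanish because [R] is annihilated by
    polynomials that are invertible on Laurent functions; above it they vanish
    because [R] is free over the parameter subalgebra. *)
Lemma ext_vanish_off g (c : 'I_(rk F g) -> U) : g != (n - d)%N ->
  cocycle_on n c -> coboundary_on n c.
Proof.
have main p q' s i (c' : 'I_(rk F (q' + i)) -> U) : p = (q' + s)%N ->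
    (q' + s <= n)%N -> (d <= s)%N ->
    (forall c0 : 'I_(rk F i) -> U, cocycle_on s c0 -> coboundary_on s c0) ->
    cocycle_on p c' -> coboundary_on p c'.
  move=> -> qsn ds hs hc.
  have [c0 [h0 cc0]] := connected_total hF power_relation ds qsn hc.
  by apply/(connected_coboundary hF power_relation ds qsn cc0)/hs.
rewrite neq_ltn => /orP [hg|hg].
  move: c; rewrite -(addn0 g) => c; pose s := (n - g)%N.
  have tn : (s.-1 < n)%N by rewrite /s; lia.
  apply: (main _ _ s); rewrite /s; [lia|lia|lia|].
  move=> c0; rewrite -/s (_ : s = (Ordinal tn).+1) => [[h0 d0]|]; last by rewrite /= /s; lia.
  have dt : (d <= Ordinal tn)%N by rewrite /= /s; lia.
  apply: (ext_vanish hF power_relation dt _ d0) => j.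
  exact: nneg_suppW (leqnSn _) _.
have [i ei] : exists i, g = (n - d + i.+1)%N by exists (g - (n - d)).-1; lia.
move: c {hg}; rewrite ei => c; apply: (main _ _ d); [lia|lia|by []|].
exact: (ext_vanish_high hF hxy pib piL).
Qed.

Section Ext.
Variable g : nat.
Variable psi : 'cV[S]_(rk F g) -> W.
Hypothesis psiL : forall (p : S) c c', cocycle c -> cocycle c' ->
  psi (p *: c + c') = poly_eval x p *: psi c + psi c'.
Hypothesis psi_surj : forall w, exists c, cocycle c /\ psi c = w.
Hypothesis psi_ker : forall c, cocycle c -> (psi c = 0 <-> coboundary c).
Hypothesis psi_deg : forall t c, cocycle c -> cochain_deg (- n%:Z) t c -> WG t (psi c).

Lemma cocycle0 : cocycle (0 : 'cV[S]_(rk F g)).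
Proof. by rewrite /cocycle mulmx0. Qed.

Lemma cocycleD (p : S) (c c' : 'cV[S]_(rk F g)) :
  cocycle c -> cocycle c' -> cocycle (p *: c + c').
Proof.
by rewrite /cocycle => hc hc'; rewrite mulmxDr -scalemxAr hc hc' scaler0 addr0.
Qed.

Lemma psi0 : psi 0 = 0.
Proof.
have := psiL 1 cocycle0 cocycle0.
rewrite scaler0 addr0 poly_eval1 scale1r => h.
by apply: (addrI (psi 0)); rewrite addr0 -h.
Qed.

Let hc_part (t : int) (c : 'cV[S]_(rk F g)) : 'cV[S]_(rk F g) :=
  \col_j hpart (sh F g j + t - n%:Z) (c j 0).

Let hc_part_cocycle t c : cocycle c -> cocycle (hc_part t c).
Proof.
case: hF => hd _ _ _ _ hc; apply/colP => j; rewrite [RHS]mxE.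
have h : hpart (sh F g.+1 j + t - n%:Z) ((df F g *m c) j 0) = 0.
  by rewrite (hc : df F g *m c = 0) mxE hpart0.
rewrite -[RHS]h !mxE hpart_bigsum; apply: eq_bigr => l _; rewrite mxE.
rewrite (hpartM _ _ (hd g j l)); congr (_ * hpart _ _); ring.
Qed.

(** The given isomorphism maps homogeneous cocycles to homogeneous elements, so
    the component of degree [t] of [psi c] is the image of a homogeneous part of
    [c]. *)
Lemma homogeneous_cocycle t w : WG t w -> exists c,
  [/\ cocycle c, forall j, homog_deg (sh F g j + (t - n%:Z)) (c j 0) & psi c = w].
Proof.
move=> hw; have [c [hc ew]] := psi_surj w.
pose deg j (m : 'X_{1..n}) : int := (mdeg m)%:Z - (sh F g j - n%:Z).
pose s := undup (flatten [seq [seq deg j m | m <- msupp (c j 0)] | j <- enum 'I_(rk F g)]).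
have us : uniq s by apply: undup_uniq.
have ec : c = \sum_(T <- s) hc_part T c.
  apply/colP => j; rewrite summxE; apply/mpolyP => m; rewrite raddf_sum /=.
  under eq_bigr do rewrite mxE mcoeff_hpart.
  have [m0|mc] := eqVneq (c j 0)@_m 0.
    by rewrite m0 big1 // => T _; case: ifP.
  have ms : deg j m \in s.
    rewrite mem_undup; apply/flatten_mapP; exists j; first by rewrite mem_enum.
    by apply/mapP; exists m => //; rewrite mcoeff_msupp.
  rewrite (bigD1_seq (deg j m)) //= big1 => [|T /negbTE Tm].
    by rewrite addr0 ifT // /deg; apply/eqP; ring.
  rewrite ifF //; apply: negbTE; apply: contraFN Tm => /eqP em.
  by rewrite /deg em; apply/eqP; ring.
have psi_sum (r : seq int) : cocycle (\sum_(T <- r) hc_part T c) /\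
    psi (\sum_(T <- r) hc_part T c) = \sum_(T <- r) psi (hc_part T c).
  elim: r => [|T r [IH1 IH2]].
    by rewrite !big_nil; split; [exact: cocycle0|exact: psi0].
  rewrite !big_cons -[hc_part T c]scale1r; split.
    by apply: cocycleD => //; apply: hc_part_cocycle.
  by rewrite psiL ?poly_eval1 ?scale1r ?IH2 //; apply: hc_part_cocycle.
have ew' : w = \sum_(T <- s) psi (hc_part T c) by rewrite -(psi_sum s).2 -ec.
have hp T : WG T (psi (hc_part T c)).
  apply: psi_deg; first exact: hc_part_cocycle.
  by move=> j; rewrite mxE; apply: homog_hpart.
have := gproj_sum gWG t us hp; rewrite -ew' (gproj_id gWG _ hw) eqxx.
case: ifP => _ ->.
  exists (hc_part t c); split=> //; first exact: hc_part_cocycle.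
  by move=> j; rewrite mxE addrA; apply: homog_hpart.
exists 0; split; [exact: cocycle0| |exact: psi0].
by move=> j; rewrite mxE; apply: homog_deg0.
Qed.

Lemma ext_degree t w : WG t w -> w != 0 -> g = (n - d)%N.
Proof.
move=> hw; have [c [hc dc <-]] := homogeneous_cocycle hw.
apply: contraNeq => gnd; apply/eqP/(psi_ker hc).
apply: (coboundary_lcochain hF dc); apply: ext_vanish_off => //.
exact/cocycle_lcochain.
Qed.

End Ext.

Section Residues.
Local Notation g := (n - d + 0)%N.
Variable psi : 'cV[S]_(rk F g) -> W.
Hypothesis psiL : forall (p : S) c c', cocycle c -> cocycle c' ->
  psi (p *: c + c') = poly_eval x p *: psi c + psi c'.
Hypothesis psi_surj : forall w, exists c, cocycle c /\ psi c = w.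
Hypothesis psi_ker : forall c, cocycle c -> (psi c = 0 <-> coboundary c).
Hypothesis psi_deg : forall t c, cocycle c -> cochain_deg (- n%:Z) t c -> WG t (psi c).

Let stage_n : (n - d + d)%N = n. Proof. exact: subnK. Qed.
Let stage_le : (n - d + d <= n)%N. Proof. by rewrite stage_n. Qed.

(** [w] and [c0] correspond to each other under the [n - d] connecting
    homomorphisms that lead from the power series cohomology in degree [n - d]
    to stage [d] in degree zero. *)
Definition represents (w : W) (c0 : 'I_(rk F 0) -> U) := exists c : 'cV[S]_(rk F g),
  [/\ cocycle c, psi c = w, cocycle_on d c0 & connected d (lcochain c) c0].

Let cocycle_stage (c : 'cV[S]_(rk F g)) : cocycle c -> cocycle_on (n - d + d) (lcochain c).
Proof. by rewrite stage_n => hc; apply/cocycle_lcochain. Qed.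

Lemma represents_total w : exists c0, represents w c0.
Proof.
have [c [hc ew]] := psi_surj w.
have [c0 [h0 cc0]] :=
  connected_total hF power_relation (leqnn d) stage_le (cocycle_stage hc).
by exists c0, c.
Qed.

Lemma represents_linear p w w' c0 c0' : represents w c0 -> represents w' c0' ->
  represents (poly_eval x p *: w + w') (fun j => p *: c0 j + c0' j).
Proof.
move=> [c [hc <- h0 cc0]] [c' [hc' <- h0' cc0']]; exists (p *: c + c'); split.
- exact: cocycleD.
- exact: psiL.
- exact: cocycle_on_linear.
- have := connected_linear p cc0 cc0'; congr connected; apply/funext => j.
  by rewrite /lcochain !mxE lpolyD lpolyM.
Qed.

Lemma represents_zero c0 : represents 0 c0 -> forall j, zero_on d (c0 j).
Proof.
move=> [c [hc /(psi_ker hc) cb h0 cc0]].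
apply/(connected_coboundary hF power_relation (leqnn d) stage_le cc0).
rewrite stage_n; move: (n - d + 0)%N c cb {hc h0 cc0} => [|i] c /=.
  by move=> -> j; rewrite /lcochain mxE lpoly0.
move=> [a ->]; exists (lcochain a); split=> j; first exact: lpoly_supp.
by rewrite mxact_lcochain /lcochain subrr.
Qed.

Lemma represents_unique w c0 c0' : represents w c0 -> represents w c0' ->
  forall j, zero_on d (c0 j - c0' j).
Proof.
move=> h h'; have := represents_linear (-1) h' h.
rewrite poly_evalN poly_eval1 scaleN1r addNr => /represents_zero z j.
by have := z j; rewrite scaleN1r addrC.
Qed.

Lemma represents_homog t w : WG t w -> exists c0,
  [/\ represents w c0, ccomp (t - n%:Z) c0 = c0
    & (forall j, zero_on d (c0 j)) -> w = 0].
Proof.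
move=> hw; have [c [hc dc ew]] := homogeneous_cocycle psiL psi_surj psi_deg hw.
have [c0 [h0 cc0]] :=
  connected_total hF power_relation (leqnn d) stage_le (cocycle_stage hc).
have cc0' := connected_ccomp hF (t - n%:Z) cc0.
rewrite (ccomp_lcochain dc) in cc0'.
exists (ccomp (t - n%:Z) c0); split.
- by exists c; split=> //; apply: (cocycle_on_ccomp hF).
- apply/funext => j; apply/funext => f; rewrite /ccomp /lcomp.
  by case: ifP => // ->.
- move=> z; rewrite -ew; apply/psi_ker => //; apply: (coboundary_lcochain hF dc).
  have := (connected_coboundary hF power_relation (leqnn d) stage_le cc0').2 z.
  by rewrite stage_n.
Qed.

Lemma represents_surj T c0 : cocycle_on d c0 -> exists w,
  WG (T + n%:Z) w /\ represents w (ccomp T c0).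
Proof.
move=> h0; have [c [hc cc0]] : exists c : 'I_(rk F g) -> U,
    cocycle_on (n - d + d) c /\ connected d c c0.
  exact: (connected_surj hF stage_le h0).
rewrite stage_n in hc.
have [c' [dc' ec']] := ccomp_is_lcochain T hc.
have cc' : cocycle c'.
  by apply/cocycle_lcochain; rewrite -ec'; apply: (cocycle_on_ccomp hF).
exists (psi c'); split.
  apply: psi_deg => // j; have := dc' j.
  by rewrite -addrA addrK.
exists c'; split=> //; first exact: (cocycle_on_ccomp hF).
by rewrite -ec'; apply: (connected_ccomp hF).
Qed.

Let lift r : 'rV[S]_(rk F 0) := sval (cid (aug_surj hF r)).
Let liftP r : augmentation x e (lift r) = r.
Proof. by rewrite /lift; case: cid. Qed.

Let form w : 'I_(rk F 0) -> U := sval (cid (represents_total w)).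
Let formP w : represents w (form w).
Proof. by rewrite /form; case: cid. Qed.

(** The coefficients at [-1] in the last [n - d] variables of the functional on
    [R] that corresponds to [w]. *)
Definition residue (w : W) (r : R) (m : 'X_{1..d}) : k :=
  rowact (form w) (lift r) (pt m).

(** Neither the representing cocycle nor the lift of [r] to the first term of
    the resolution matters, as cocycles vanish on the image of the differential. *)
Lemma residueE w c0 r v m : represents w c0 -> augmentation x e v = r ->
  residue w r m = rowact c0 v (pt m).
Proof.
move=> hc0 ev; have [_ [_ _ [_ d0] _]] := hc0; apply/eqP.
rewrite -subr_eq0 -laurentB /residue; apply/eqP.
have [w' hw'] : exists w', lift r - v = w' *m df F 0.
  by apply/(aug_ker hF); rewrite augmentationB liftP ev subrr.
have -> : rowact (form w) (lift r) - rowact c0 v =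
  (\sum_l lift r 0 l *: (form w l - c0 l)) + rowact c0 (lift r - v).
  rewrite rowactB addrA; congr (_ - _).
  by rewrite /rowact -big_split /=; apply: eq_bigr => l _; rewrite -scalerDr subrK.
rewrite laurentD (zero_on_sum (p := d)) ?add0r; last exact: pt_region.
  rewrite hw' rowact_mul; apply: (zero_on_sum (p := d)); last exact: pt_region.
  by move=> l _; apply: zero_onZ.
by move=> l _; apply: zero_onZ; exact: (represents_unique (formP w) hc0 l).
Qed.

Lemma residue_linear w (c : k) r s m :
  residue w (c *: r + s) m = c * residue w r m + residue w s m.
Proof.
rewrite (@residueE w (form w) _ (c%:MP *: lift r + lift s)) //.
  by rewrite rowact_linear laurentD laurentCP.
by rewrite augmentation_linear poly_evalC mulr_algl !liftP.
Qed.

Lemma residue_shift w (j : 'I_d) r m :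
  residue w (y j * r) m = if m j == 0%N then 0 else residue w r (m - U_(j)).
Proof.
rewrite (@residueE w (form w) _ ('X_(wid j) *: lift r + 0)) //; last first.
  by rewrite augmentation_linear poly_evalXU hxy liftP augmentation0 addr0.
rewrite rowact_linear rowact0 addr0 laurent_pt_low //; apply: rowact_supp.
by have [_ [_ _ [h _] _]] := formP w.
Qed.

Lemma residue_module r w w' s m :
  residue (r *: w + w') s m = residue w (r * s) m + residue w' s m.
Proof.
have [p <-] := hx.2 r.
rewrite (residueE m (represents_linear p (formP w) (formP w')) (liftP s)).
rewrite /rowact; under eq_bigr do rewrite scalerDr scalerA mulrC -scalerA.
rewrite big_split /= laurentD -scaler_sumr; congr (_ + _).
rewrite (@residueE w (form w) _ (p *: lift s + 0)) //; last first.
  by rewrite augmentation_linear liftP augmentation0 addr0.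
by rewrite rowact_linear rowact0 addr0.
Qed.

Lemma residue_degree t s w r m : WG t w -> RG s r -> residue w r m != 0 ->
  (mdeg m)%:Z = s + t - d%:Z.
Proof.
move=> hw hr; have [c0 [hc0 dc0 _]] := represents_homog hw.
have [v ev] := aug_surj hF r.
have hd : forall j, RG (sh F 0 j) (e j) by case: hF.
pose v' : 'rV[S]_(rk F 0) := \row_j hpart (s - sh F 0 j) (v 0 j).
have ev' : augmentation x e v' = r.
  have -> : r = gproj RG s r by rewrite (gproj_id gRG _ hr) eqxx.
  rewrite -ev (gproj_bigsum gRG); apply: eq_bigr => j _.
  by rewrite [in RHS]mulrC (gprojM hR _ _ (hd j)) (gproj_eval hR hx.1) mxE mulrC.
rewrite (residueE m hc0 ev') => nz.
have eT : rowact c0 v' = lcomp (s + (t - n%:Z)) (rowact c0 v').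
  rewrite /rowact lcomp_sum; apply: eq_bigr => j _.
  rewrite mxE (lcompZ _ _ (homog_hpart _ _)) -[in LHS]dc0 /ccomp.
  by congr (_ *: lcomp _ _); ring.
move: nz; rewrite eT /lcomp; case: (_ =P s + _) => [es _|_]; last by rewrite eqxx.
have := sum_pt le_dn m; rewrite es -subzn // => ?; lia.
Qed.

(** A Laurent function of stage [d] is determined by the residues of its
    multiples. *)
Lemma residue_nondegenerate t w : WG t w -> (forall r m, residue w r m = 0) -> w = 0.
Proof.
move=> hw z; have [c0 [hc0 _]] := represents_homog hw; apply=> j f hf.
have [_ [_ _ [h0 _] _]] := hc0.
have [/has_negP hn|hn] := boolP (has_neg d f); first exact: h0.
have := residueE (mlowpart le_dn f) hc0
  (erefl (augmentation x e ('X_[gam d f] *: delta_mx 0 j + 0))).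
rewrite z rowact_linear rowact_delta => /esym.
by rewrite rowact0 addr0 laurentX pt_lowpart.
Qed.

(** The Laurent functions coinduced by the map [phi] on the basis of the first
    term of the resolution form a cocycle, since [phi] is defined on [R]. *)
Lemma residue_surjective (t : int) (phi : R -> 'X_{1..d} -> k) :
  (forall (c : k) r s m, phi (c *: r + s) m = c * phi r m + phi s m) ->
  (forall (j : 'I_d) r m,
     phi (y j * r) m = if m j == 0%N then 0 else phi r (m - U_(j))%MM) ->
  (forall s r m, RG s r -> phi r m != 0 -> (mdeg m)%:Z = s + t - d%:Z) ->
  exists w, WG t w /\ forall r m, residue w r m = phi r m.
Proof.
move=> phiL phiX phi_deg.
pose Psi j (p : S) (m : 'X_{1..d}) := phi (poly_eval x p * e j) m.
have PsiL j (c : k) p p' m : Psi j (c *: p + p') m = c * Psi j p m + Psi j p' m.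
  by rewrite /Psi poly_evalD poly_evalZ mulrDl -scalerAl phiL.
have PsiX j (l : 'I_d) p m : Psi j ('X_(wid l) * p) m =
    if m l == 0%N then 0 else Psi j p (m - U_(l))%MM.
  by rewrite /Psi poly_evalM poly_evalXU hxy -mulrA phiX.
pose c0 j : U := coind le_dn (Psi j).
have phi0 m : phi 0 m = 0.
  have h : phi (-1 *: 0 + 0) m = 0 by rewrite phiL mulN1r addNr.
  by rewrite scaler0 addr0 in h.
have phi_sum (r : seq 'I_(rk F 0)) (G : 'I_(rk F 0) -> R) m :
    phi (\sum_(i <- r) G i) m = \sum_(i <- r) phi (G i) m.
  elim/big_rec2: _ => // i u v _ <-.
  by rewrite -[G i in LHS]scale1r phiL mul1r.
have rowactE v f : neg_region d f -> rowact c0 v f =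
    if has_neg d f then 0
    else phi (poly_eval x 'X_[gam d f] * augmentation x e v) (mlowpart le_dn f).
  move=> hf; rewrite /rowact laurent_sum.
  under eq_bigr do rewrite (coindP (PsiL _) (PsiX _) _ hf).
  case: ifP => _; first by rewrite big1.
  rewrite mulr_sumr phi_sum; apply: eq_bigr => l _.
  by rewrite /Psi poly_evalM mulrA.
have h0 : cocycle_on d c0.
  split=> j; first exact: coind_supp.
  move=> f hf; have -> : mxact (df F 0) c0 j = rowact c0 (delta_mx 0 j *m df F 0).
    by rewrite -rowE /rowact /mxact; apply: eq_bigr => l _; rewrite mxE.
  rewrite rowactE //; case: ifP => // _.
  have -> : augmentation x e (delta_mx 0 j *m df F 0) = 0.
    by apply/(aug_ker hF); exists (delta_mx 0 j).
  by rewrite mulr0 phi0.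
have [w [hw rw]] := represents_surj (t - n%:Z) h0.
rewrite subrK in hw; exists w; split=> // r m.
rewrite (residueE m rw (liftP r)).
have hd : forall j, RG (sh F 0 j) (e j) by case: hF.
have c0T j : zero_on d (ccomp (t - n%:Z) c0 j - c0 j).
  move=> f hf; rewrite laurentB /ccomp /lcomp.
  case: (_ =P sh F 0 j + _) => [_|ne]; first by rewrite subrr.
  rewrite sub0r; apply/eqP; rewrite oppr_eq0; apply: contra_notT ne.
  rewrite /c0 /coind; case: ifPn => [|hn]; first by rewrite eqxx.
  move=> nz; have := phi_deg _ _ _ (sg_mul hR (homog_eval hR hx.1 (homog_degX k _)) (hd j)) nz.
  have -> : \sum_i f i = (mdeg (mlowpart le_dn f))%:Z - (mdeg (gam d f))%:Z - (n - d)%:Z.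
    have := sum_mshift (pt (mlowpart le_dn f)) (gam d f); rewrite sum_pt // => es.
    by rewrite [RHS]addrAC -es pt_lowpart.
  by rewrite -subzn // => ->; ring.
have -> : rowact (ccomp (t - n%:Z) c0) (lift r) (pt m) = rowact c0 (lift r) (pt m).
  apply/eqP; rewrite -subr_eq0 -laurentB; apply/eqP.
  rewrite /rowact -sumrB; apply: (zero_on_sum (p := d)); last exact: pt_region.
  by move=> l _; rewrite -scalerBr; apply: zero_onZ.
rewrite rowactE; last exact: pt_region.
have -> : has_neg d (pt m : 'I_n -> int) = false.
  by apply: negbTE; apply/negP => /has_negP [l /(low_wid le_dn) [l' ->]]; rewrite pt_low.
have -> : gam d (pt m : 'I_n -> int) = 0%MM.
  apply/mnmP => l; rewrite mnm0E mnmE; case: ifPn => // ld.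
  by rewrite pt_high // leqNgt.
rewrite mpolyX0 poly_eval1 mul1r liftP; congr phi; apply/mnmP => l.
by rewrite mnmE pt_low.
Qed.

End Residues.
End Duality.

(** * Linear change of coordinates *)

Lemma extend_rows (k : fieldType) (d n : nat) (C : 'M[k]_(d, n)) (le_dn : (d <= n)%N) :
  row_free C -> exists G : 'M[k]_n, G \in unitmx /\
    forall i j, G (widen_ord le_dn i) j = C i j.
Proof.
move=> rC; have [r en] : exists r, n = (d + r)%N by exists (n - d)%N; rewrite subnKC.
move: C le_dn rC; rewrite {}en => C le_dn /eqP rC.
exists (block_mx (col_ebase C) 0 0 1%:M *m row_ebase C); split.
  rewrite unitmx_mul row_ebase_unit andbT unitmxE det_ublock det1 mulr1.
  by rewrite -unitmxE col_ebase_unit.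
move=> i j; have -> : widen_ord le_dn i = lshift r i by apply: val_inj.
have := mulmx_ebase C; rewrite rC => eC; rewrite -[in RHS]eC.
have -> : pid_mx d = row_mx 1%:M 0 :> 'M[k]_(d, d + r) by rewrite -pid_mx_row.
by rewrite mul_mx_row mulmx1 mulmx0 block_mxEv mul_col_mx col_mxEu.
Qed.

Section Substitution.
Variables (k : fieldType) (n : nat) (w : 'I_n -> {mpoly k[n]}).

Lemma homog_deg_mmap1 m : (forall j, homog_deg 1 (w j)) ->
  homog_deg (mdeg m)%:Z (mmap1 w m).
Proof.
move=> hw; rewrite /mmap1 mdegE (big_morph Posz PoszD erefl).
elim/big_rec2: _ => [|i a b _ IH]; first exact: dhomog1.
apply: homog_degM => //; elim: (m i) => [|e IHe]; first exact: dhomog1.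
by rewrite exprS -[e.+1]add1n PoszD; apply: homog_degM.
Qed.

Lemma homog_deg_subst t p : (forall j, homog_deg 1 (w j)) -> homog_deg t p ->
  homog_deg t (poly_eval w p).
Proof.
move=> hw /homog_degP hp; rewrite poly_evalE big_seq.
apply: homog_deg_sum => m; rewrite mcoeff_msupp => /hp <-.
by apply: homog_degZ; apply: homog_deg_mmap1.
Qed.

End Substitution.

Section Coordinates.
Variables (k : fieldType) (R : comAlgType k) (RG : int -> set R).
Hypothesis hR : standard_graded RG.
Variables (d : nat) (y : 'I_d -> R).
Hypothesis hy1 : forall i, RG 1 (y i).
Hypothesis yind : forall p : {mpoly k[d]}, poly_eval y p = 0 -> p = 0.
Variables (W : lmodType R) (WG : int -> set W).

Lemma linear_form n (x : 'I_n -> R) r : linear_generators RG x -> RG 1 r ->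
  exists c : 'I_n -> k, r = \sum_j c j *: x j.
Proof.
move=> hx hr; have [p [/homog_degP hp <-]] := sg_gen hR hx hr.
rewrite poly_evalE big_seq; elim/big_rec: _ => [|m v].
  by exists (fun _ => 0); rewrite big1 // => j _; rewrite scale0r.
rewrite mcoeff_msupp => /hp -[/eqP/mdeg1P [i /eqP ->]] [c ->].
exists (fun j => (if j == i then p@_U_(i) else 0) + c j).
under [RHS]eq_bigr do rewrite scalerDl.
rewrite big_split /=; congr (_ + _); rewrite (bigD1 i) //= eqxx mmap1U.
rewrite big1 ?addr0 // => j /negbTE ->.
by rewrite scale0r.
Qed.

(** The parameters, being algebraically independent, are linearly independent
    combinations of the given generators, so a linear change of variables turns
    them into the first [d] generators; the resolution and the isomorphism are
    transported along it. *)
Lemma adapted_presentation : graded_canonical_module RG WG ->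
  exists n (le_dn : (d <= n)%N) (x : 'I_n -> R) g (F : free_seq k n)
    (e : 'I_(rk F 0) -> R),
  [/\ linear_generators RG x, forall j, x (widen_ord le_dn j) = y j,
      graded_free_resolution RG x e
    & iso_graded_Ext x F (- n%:Z) g WG].
Proof.
move=> [_ [n [x [g [F [e [hx _ hF [psi [psiL psiS psiK psiD]]]]]]]]].
pose S := {mpoly k[n]}.
have /choice [C0 hC] := fun i => linear_form hx (hy1 i).
pose C : 'M[k]_(d, n) := \matrix_(i, j) C0 i j.
have rC : row_free C.
  apply: inj_row_free => v vC.
  have vy : \sum_i v 0 i *: y i = 0.
    under eq_bigr do rewrite hC scaler_sumr.
    rewrite exchange_big big1 // => j _; under eq_bigr do rewrite scalerA.
    rewrite -scaler_suml; have /rowP/(_ j) := vC; rewrite !mxE => e0.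
    rewrite (_ : \sum_i _ = 0) ?scale0r // -[RHS]e0; apply: eq_bigr => i _.
    by rewrite mxE.
  have z : \sum_i v 0 i *: 'X_i = 0 :> {mpoly k[d]}.
    apply: yind; rewrite poly_eval_sum -[RHS]vy; apply: eq_bigr => i _.
    by rewrite poly_evalZ poly_evalXU.
  apply/rowP => i; rewrite mxE; have := congr1 (mcoeff U_(i)) z.
  rewrite raddf_sum mcoeff0 (bigD1 i) //= mcoeffZ mcoeffXU eqxx mulr1.
  rewrite big1 ?addr0 // => j /negbTE ji.
  by rewrite mcoeffZ mcoeffXU ji mulr0.
have le_dn : (d <= n)%N by rewrite -(eqP rC) rank_leq_col.
have [G [uG hG]] := extend_rows le_dn rC.
pose wt (M : 'M[k]_n) (i : 'I_n) : S := \sum_j M i j *: 'X_j.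
pose th := mmap (in_alg S) (wt (invmx G)) : {rmorphism S -> S}.
pose eta := mmap (in_alg S) (wt G) : {rmorphism S -> S}.
have wtM (A B : 'M[k]_n) : A *m B = 1%:M -> forall p : S,
    poly_eval (wt B) (poly_eval (wt A) p) = p.
  move=> AB p; rewrite poly_eval_comp -[RHS]poly_eval_id; apply: eq_poly_eval => i.
  rewrite /wt poly_eval_sum.
  under eq_bigr do rewrite poly_evalZ poly_evalXU scaler_sumr.
  rewrite exchange_big; under eq_bigr do under eq_bigr do rewrite scalerA.
  under eq_bigr do rewrite -scaler_suml.
  have ABE j : \sum_l A i l * B l j = (i == j)%:R.
    by have /matrixP/(_ i j) := AB; rewrite !mxE.
  rewrite (bigD1 i) //= ABE eqxx scale1r big1 ?addr0 // => j /negbTE ji.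
  by rewrite ABE eq_sym ji scale0r.
have thK p : eta (th p) = p by apply: wtM; apply: mulVmx.
have etaK p : th (eta p) = p by apply: wtM; apply: mulmxV.
have wt_deg M j : homog_deg 1 (wt M j).
  by apply: homog_deg_sum => i _; apply: homog_degZ; apply: homog_degXU.
pose x' i := \sum_j G i j *: x j.
have evE p : poly_eval x' p = poly_eval x (eta p).
  rewrite [eta p]/(poly_eval (wt G) p) poly_eval_comp; apply: eq_poly_eval => i.
  rewrite /wt poly_eval_sum; apply: eq_bigr => j _.
  by rewrite poly_evalZ poly_evalXU.
have mapK r c (A : 'M[S]_(r, c)) : map_mx eta (map_mx th A) = A.
  by apply/matrixP => i j; rewrite !mxE.
have mapK' r c (A : 'M[S]_(r, c)) : map_mx th (map_mx eta A) = A.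
  by apply/matrixP => i j; rewrite !mxE.
pose F' := FreeSeq (sh F) (fun i => map_mx th (df F i)).
have augE (v : 'rV[S]_(rk F 0)) : \sum_j poly_eval x' (v 0 j) * e j =
    \sum_j poly_eval x ((map_mx eta v) 0 j) * e j.
  by apply: eq_bigr => j _; rewrite evE mxE.
case: hF => hd he hs hk hex.
have hx' : linear_generators RG x'.
  split=> [i|r].
    apply: (graded_sum (sg_grading hR)) => j _; apply: (sg_scale hR); exact: hx.1.
  by have [p <-] := hx.2 r; exists (th p); rewrite evE thK.
exists n, le_dn, x', g, F', e; split=> //.
- by move=> j; rewrite hC; apply: eq_bigr => l _; rewrite hG mxE.
- split=> //=.
  + by move=> i j l; rewrite mxE; apply: homog_deg_subst => // ?; apply: wt_deg.
  + by move=> r; have [v <-] := hs r; exists (map_mx th v); rewrite augE mapK.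
  + move=> v; rewrite augE; split=> [/hk [w ew]|[w ->]].
      by exists (map_mx th w); rewrite -map_mxM -ew mapK'.
    by apply/hk; exists (map_mx eta w); rewrite map_mxM mapK.
  + move=> i v; split=> [vd|[w ->]].
      have /hex [w ew] : map_mx eta v *m df F i = 0.
        by rewrite -[df F i]mapK -map_mxM vd map_mx0.
      by exists (map_mx th w); rewrite -map_mxM -ew mapK'.
    rewrite -[w]mapK' -!map_mxM; have -> : map_mx eta w *m df F i.+1 *m df F i = 0.
      by apply/hex; exists (map_mx eta w).
    by rewrite map_mx0.
- have cocE i (c : 'cV[S]_(rk F i)) : @cocycle k n F' i c -> @cocycle k n F i (map_mx eta c).
    rewrite /cocycle /= => hc.
    by rewrite -[df F i]mapK -map_mxM hc map_mx0.
  have cobE i (c : 'cV[S]_(rk F i)) :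
      @coboundary k n F i (map_mx eta c) <-> @coboundary k n F' i c.
    case: i c => [|i] c /=.
      by split=> [h|->]; [rewrite -[c]mapK' h map_mx0|rewrite map_mx0].
    split=> [[b hb]|[b ->]].
      by exists (map_mx th b); rewrite -map_mxM -hb mapK'.
    by exists (map_mx eta b); rewrite map_mxM mapK.
  exists (fun c => psi (map_mx eta c)); split.
  + move=> p c c' hc hc'; rewrite evE -psiL; [|exact: cocE|exact: cocE].
    by congr psi; apply/matrixP => i j; rewrite !mxE rmorphD rmorphM.
  + move=> w; have [c [hc <-]] := psiS w; exists (map_mx th c); split.
      by rewrite /cocycle /= -map_mxM (hc : df F g *m c = 0) map_mx0.
    by rewrite mapK.
  + by move=> c hc; rewrite (psiK _ (cocE _ _ hc)); apply: cobE.
  + move=> t c hc dc; apply: psiD; first exact: cocE.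
    by move=> j; rewrite mxE; apply: homog_deg_subst; [move=> ?; apply: wt_deg|apply: dc].
Qed.

End Coordinates.

(** * The pairing between the canonical module and the ring *)

Section Pairing.
Variables (k : fieldType) (R : comAlgType k) (RG : int -> set R) (d : nat).
Variables (W : lmodType R) (WG : int -> set W) (y : 'I_d -> R).

(** A perfect homogeneous pairing that identifies [W] with the homogeneous
    A-linear maps from [R] to A, shifted by [d], where A is the polynomial ring
    in the parameters. Values in A are given by their coefficients, and only the
    finiteness that homogeneity implies is recorded. *)
Definition duality_pairing (phi : W -> R -> 'X_{1..d} -> k) :=
  [/\ forall w (c : k) r s m, phi w (c *: r + s) m = c * phi w r m + phi w s m,
      forall w (j : 'I_d) r m,
        phi w (y j * r) m = if m j == 0%N then 0 else phi w r (m - U_(j))%MM,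
      forall r w w' s m, phi (r *: w + w') s m = phi w (r * s) m + phi w' s m,
      forall t s w r m, WG t w -> RG s r -> phi w r m != 0 ->
        (mdeg m)%:Z = s + t - d%:Z
    & forall t w, WG t w -> (forall r m, phi w r m = 0) -> w = 0] /\
  forall (t : int) (f : R -> 'X_{1..d} -> k),
    (forall (c : k) r s m, f (c *: r + s) m = c * f r m + f s m) ->
    (forall (j : 'I_d) r m,
       f (y j * r) m = if m j == 0%N then 0 else f r (m - U_(j))%MM) ->
    (forall s r m, RG s r -> f r m != 0 -> (mdeg m)%:Z = s + t - d%:Z) ->
    exists w, WG t w /\ forall r m, phi w r m = f r m.

Lemma canonical_pairing : standard_graded RG -> cohen_macaulay R ->
  linear_sop RG y -> graded_canonical_module RG WG ->
  (exists t w, WG t w /\ w != 0) -> exists phi, duality_pairing phi.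
Proof.
move=> hR hCM hy hW [t0 [w0 [hw0 w0n]]].
have [q [b [e [pi [_ pib piL _ _]]]]] := sop_free_basis hR hCM hy.
have [_ hy1 hrad] := hy; have gW := hW.1.
have [n [le_dn [x [g [F [e0 [hx hxy hF [psi [psiL psiS psiK psiD]]]]]]]]] :=
  adapted_presentation hR hy1 (sop_alg_indep hR hCM hy) hW.
have eg : g = (n - d + 0)%N.
  rewrite addn0.
  exact: (ext_degree hrad pib piL hx hxy hF gW psiL psiS psiK psiD hw0 w0n).
move: psi psiL psiS psiK psiD; rewrite eg => psi psiL psiS psiK psiD.
exists (residue hrad hx hxy hF psiS); split; first split.
- exact: residue_linear.
- exact: residue_shift.
- exact: residue_module.
- by move=> t s w r m; apply: residue_degree.
- by move=> t w; apply: residue_nondegenerate.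
- by move=> t f; apply: residue_surjective.
Qed.

End Pairing.

(** * Powers of the parameter ideal *)

Section Powers.
Variables (k : fieldType) (R : comAlgType k) (RG : int -> set R) (d : nat).
Hypothesis hR : standard_graded RG.
Variables (y : 'I_d -> R).
Let J : set R := ideal_gen (range y).

Lemma poly_eval_ideal_pow i (P : {mpoly k[d]}) r :
  (forall m, P@_m != 0 -> (i <= mdeg m)%N) ->
  ideal_pow J i%:Z (poly_eval y P * r).
Proof.
move=> hP; apply: (ideal_mulr _ (ideal_pow_ideal J _)).
rewrite poly_evalE big_seq; apply: (@submod_sum R R^o _ _ _ _ _ (ideal_pow_ideal J _)).
move=> m; rewrite mcoeff_msupp => /hP im; rewrite -mulr_algl.
by apply: (ideal_mull _ (ideal_pow_ideal J _)); apply: mmap1_ideal_pow im => j; apply: sub_ideal_gen; exists j.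
Qed.

Variables (W : lmodType R) (WG : int -> set W) (phi : W -> R -> 'X_{1..d} -> k).
Hypothesis hphi : duality_pairing RG WG y phi.

Lemma pairingD w r s m : phi w (r + s) m = phi w r m + phi w s m.
Proof.
by case: hphi => [[h _ _ _ _] _]; rewrite -[r in LHS]scale1r h mul1r.
Qed.

Lemma pairing0 w m : phi w 0 m = 0.
Proof.
case: hphi => [[h _ _ _ _] _]; have := h w (-1) 0 0 m.
by rewrite scaler0 addr0 => ->; rewrite mulN1r addNr.
Qed.

Lemma pairing_sum w m (I : Type) (s : seq I) (P : pred I) (G : I -> R) :
  phi w (\sum_(i <- s | P i) G i) m = \sum_(i <- s | P i) phi w (G i) m.
Proof.
exact: (big_morph (fun r => phi w r m) (fun r s => pairingD w r s m) (pairing0 w m)).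
Qed.

Lemma pairing_scale r w s m : phi (r *: w) s m = phi w (r * s) m.
Proof.
case: hphi => [[_ _ h _ _] _].
have := h (-1) 0 0 s m; rewrite scaler0 addr0 mulN1r.
have -> : phi 0 (- s) m = - phi 0 s m.
  by have := pairingD 0 (- s) s m; rewrite addNr pairing0 => /eqP; rewrite eq_sym addr_eq0 => /eqP.
rewrite addNr => z; have := h r w 0 s m; by rewrite addr0 z addr0.
Qed.

Lemma pairingDl w w' s m : phi (w + w') s m = phi w s m + phi w' s m.
Proof.
by case: hphi => [[_ _ h _ _] _]; rewrite -[w in LHS]scale1r h mul1r.
Qed.

Lemma pairing0l s m : phi 0 s m = 0.
Proof. by rewrite -[0](scale0r (0 : W)) pairing_scale mul0r pairing0. Qed.

Lemma pairing_suml s m (I : Type) (l : seq I) (P : pred I) (G : I -> W) :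
  phi (\sum_(i <- l | P i) G i) s m = \sum_(i <- l | P i) phi (G i) s m.
Proof.
exact: (big_morph (fun w => phi w s m) (fun w w' => pairingDl w w' s m)
  (pairing0l s m)).
Qed.

Lemma pairing_poly w P : forall r, (forall m, phi w r m = 0) ->
  forall m, phi w (poly_eval y P * r) m = 0.
Proof.
case: hphi => [[hl hs _ _ _] _].
elim/mpoly_var_ind: P => [||i P IH|c P Q IHP IHQ] r hr m.
- by rewrite poly_eval0 mul0r pairing0.
- by rewrite poly_eval1 mul1r.
- rewrite poly_evalM poly_evalXU -mulrA hs; case: ifP => // _; exact: IH.
- by rewrite poly_evalD poly_evalZ mulrDl -scalerAl hl IHP // IHQ // mulr0 addr0.
Qed.

Lemma pairing_power w (j : 'I_d) l r :
  (forall m, phi w (y j ^+ l * r) m = 0) -> forall m, phi w r m = 0.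
Proof.
case: hphi => [[_ hs _ _ _] _].
elim: l r => [|l IH] r h; first by move=> m; have := h m; rewrite mul1r.
move=> m; have := IH (y j * r) _ (m + U_(j))%MM.
rewrite hs mnmDE mnm1E eqxx addn1 addmK; apply=> m'.
by rewrite mulrA -exprSr.
Qed.

(** Multiplication by a parameter shifts the pairing by one degree. *)
Lemma pairing_order i w r m : ideal_pow J i%:Z r -> phi w r m != 0 -> (i <= mdeg m)%N.
Proof.
case: (hphi) => [[_ hs _ _ _] _] hr; apply: contraR; rewrite -ltnNge => mi.
suff main : ideal_pow J i%:Z `<=`
    [set r | forall r' m, (mdeg m < i)%N -> phi w (r' * r) m = 0].
  by have := main r hr 1 m mi; rewrite mul1r => ->.
have idl i' : ideal [set r | forall r' m, (mdeg m < i')%N -> phi w (r' * r) m = 0].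
  apply/idealP; split; first by move=> r' m' _; rewrite mulr0 pairing0.
  move=> a u v hu hv r' m' hm; rewrite mulrDr pairingD hv // addr0 mulrA.
  exact: hu.
elim: i {hr mi} => [|i IH]; first by move=> ? _ ? ? .
rewrite ideal_powS; apply: (@submod_mul_sub R R^o); first exact: idl.
move=> a u ha /IH hu /=.
suff sub : J `<=` [set a | forall r' m, (mdeg m < i.+1)%N -> phi w (r' * (a * u)) m = 0].
  exact: sub.
apply: ideal_gen_sub.
  apply/idealP; split; first by move=> r' m' _; rewrite mul0r mulr0 pairing0.
  move=> c a1 a2 h1 h2 r' m' hm; rewrite mulrDl mulrDr pairingD h2 // addr0.
  by have := h1 (r' * c) m' hm; rewrite !mulrA.
move=> _ [j _ <-] r' m' hm; rewrite mulrCA hs; case: ifPn => // mj.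
apply: hu; rewrite -ltnS; apply: leq_trans _ hm.
have e : m' = (U_(j) + (m' - U_(j)))%MM by rewrite addmC submK // lep1mP.
by rewrite [in X in (_ < X)%N]e mdegD mdeg1 add1n ltnS.
Qed.

End Powers.

(** * Dual bases and colon ideals *)

Section Criterion.
Variables (k : fieldType) (R : comAlgType k) (RG : int -> set R) (d : nat).
Hypothesis hR : standard_graded RG.
Variables (W : lmodType R) (WG : int -> set W) (y : 'I_d -> R).
Hypotheses (hgW : graded_module RG WG) (hy1 : forall j, RG 1 (y j)).
Variable phi : W -> R -> 'X_{1..d} -> k.
Hypothesis hphi : duality_pairing RG WG y phi.
Variables (q : nat) (b : 'I_q -> R) (e : 'I_q -> nat).
Variable pi : 'I_q -> R -> {mpoly k[d]}.
Hypothesis hb : forall j, RG (e j)%:Z (b j).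
Hypothesis pib : forall r, r = \sum_j poly_eval y (pi j r) * b j.
Hypothesis piL : forall j p r s, pi j (poly_eval y p * r + s) = p * pi j r + pi j s.
Hypothesis piD : forall j t r, RG t r -> homog_deg (t - (e j)%:Z) (pi j r).
Hypothesis piE : forall j l, pi j (b l) = (j == l)%:R.
Let J : set R := ideal_gen (range y).
Let gRG : @is_grading R RG := sg_grading hR.

Lemma mcoeff_mulXU (i : 'I_d) (p : {mpoly k[d]}) m :
  ('X_i * p)@_m = if m i == 0%N then 0 else p@_(m - U_(i)).
Proof.
case: ifPn => mi; last first.
  have em : m = (U_(i) + (m - U_(i)))%MM by rewrite addmC submK // lep1mP.
  by rewrite [in LHS]em mulrC mcoeffMX.
apply/eqP; apply: contraTT mi; rewrite -mcoeff_msupp.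
move=> /msuppM_le /allpairsP [[m1 m2] /= [h1 _ ->]].
by move: h1; rewrite msuppX mem_seq1 => /eqP ->; rewrite mnmDE mnm1E eqxx.
Qed.

Lemma mulXUn_eq0 (i : 'I_d) l (p : {mpoly k[d]}) : 'X_i ^+ l * p = 0 -> p = 0.
Proof.
move/eqP; rewrite mulf_eq0 expf_eq0 => /orP [/andP [_ /eqP X0]|/eqP //].
have := mcoeffXU k i i; rewrite X0 eqxx mcoeff0 => /eqP.
by rewrite eq_sym oner_eq0.
Qed.

Lemma coord0 j : pi j 0 = 0.
Proof.
have := piL j 1 0 0; rewrite mulr0 addr0 mul1r => /esym/eqP.
by rewrite -subr_eq0 addrK => /eqP.
Qed.

Lemma coordM j p r : pi j (poly_eval y p * r) = p * pi j r.
Proof. by rewrite -[poly_eval y p * r]addr0 piL coord0 addr0. Qed.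

(** The coordinate [pi j] is homogeneous and linear over the polynomials in the
    parameters, so it is the pairing with some element. *)
Lemma dual_basis j : exists w, WG (d%:Z - (e j)%:Z) w /\
  forall r m, phi w r m = (pi j r)@_m.
Proof.
have [_ hs] := hphi; apply: hs => [c r s m|i r m|s r m hr nz].
- by rewrite -[c *: r]mulr_algl -(poly_evalC y) piL mcoeffD mcoeffCM.
- by rewrite -[y i](poly_evalXU y) coordM mcoeff_mulXU.
- rewrite ((homog_degP _ _).1 (piD j hr) m nz); ring.
Qed.

Lemma dual_basis_neq0 j w : (forall r m, phi w r m = (pi j r)@_m) -> w != 0.
Proof.
move=> hw; apply/eqP => w0; have /eqP := hw (b j) 0%MM.
by rewrite w0 (pairing0l hphi) piE eqxx mcoeff1 eqxx eq_sym oner_eq0.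
Qed.

Lemma coords_eq0 r : (forall j, pi j r = 0) -> r = 0.
Proof.
by move=> h; rewrite (pib r) big1 // => j _; rewrite h poly_eval0 mul0r.
Qed.

Lemma basis_nonempty : (0 < q)%N.
Proof.
case: posnP => // q0; have /eqP := pib 1; rewrite big1 ?oner_eq0 // => j.
by suff: (j < 0)%N by []; rewrite -q0.
Qed.

Lemma pairing_basis w :
  (forall j m, phi w (b j) m = 0) -> forall r m, phi w r m = 0.
Proof.
move=> h r m; rewrite (pib r) (pairing_sum hphi) big1 // => j _.
exact: (pairing_poly hphi).
Qed.

Variable a : int.
Hypothesis amin : forall i w, WG i w -> w != 0 -> - a <= i.

(** The dual basis elements are nonzero, so their degrees are at least [-a]. *)
Lemma basis_degree_le j : (e j)%:Z <= a + d%:Z.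
Proof.
have [w [hw ew]] := dual_basis j; have := amin hw (dual_basis_neq0 ew).
by move=> h; lia.
Qed.

Variable D : nat.
Hypothesis eD : a + d%:Z = D%:Z.

Lemma basis_deg_le j : (e j <= D)%N.
Proof. by have := basis_degree_le j; rewrite eD lez_nat. Qed.

(** The coefficients are the values of [w] at the basis elements, which are
    polynomials by homogeneity. *)
Lemma dual_expansion u w : WG u w ->
  exists (v : 'I_q -> W) (P : 'I_q -> {mpoly k[d]}),
    (forall j, homog_deg ((e j)%:Z + u - d%:Z) (P j)) /\
    w = \sum_j poly_eval y (P j) *: v j.
Proof.
move=> hw; have [[_ _ _ hdeg hnd] _] := hphi.
have [v hv] := choice dual_basis.
pose N j := (absz ((e j)%:Z + u - d%:Z)%R).+1.
pose P j : {mpoly k[d]} := \sum_(m : 'X_{1..d < N j}) phi w (b j) m *: 'X_[m].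
have hP j m : (P j)@_m = phi w (b j) m.
  case: (ltnP (mdeg m) (N j)) => hm; first exact: mcoeff_mpoly.
  have -> : phi w (b j) m = 0.
    apply/eqP/negPn/negP => /(hdeg _ _ _ _ _ hw (hb j)); move: hm; rewrite /N.
    by lia.
  rewrite raddf_sum /= big1 // => m' _; rewrite mcoeffZ mcoeffX.
  case: (_ =P m) => [em|]; last by rewrite mulr0.
  by have := bmdeg m'; rewrite em ltnNge hm.
have PD j : homog_deg ((e j)%:Z + u - d%:Z) (P j).
  by apply/homog_degP => m; rewrite hP => /(hdeg _ _ _ _ _ hw (hb j)).
exists v, P; split=> //; apply/eqP; rewrite -subr_eq0; apply/eqP.
apply: (hnd u); last first.
  apply: pairing_basis => l m; rewrite (pairingDl hphi) -scaleN1r.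
  rewrite (pairing_scale hphi) mulN1r (pairing_suml hphi) (bigD1 l) //=.
  have eP j : phi (poly_eval y (P j) *: v j) (- b l) m = - (if j == l then phi w (b l) m else 0).
    have -> : - b l = poly_eval y (-1) * b l by rewrite poly_evalN poly_eval1 mulN1r.
    rewrite (pairing_scale hphi) (hv j).2 !coordM piE mulN1r mulrN mcoeffN.
    by case: eqP => [->|_]; rewrite ?mulr1 ?hP // mulr0 mcoeff0.
  rewrite eP eqxx big1 => [|j jl]; first by rewrite addr0 subrr.
  by rewrite eP (negbTE jl) oppr0.
apply: (gradedB hgW.1) => //; apply: (graded_sum hgW.1) => j _.
have -> : u = ((e j)%:Z + u - d%:Z) + (d%:Z - (e j)%:Z) by ring.
by apply: hgW.2; [exact: homog_eval|exact: (hv j).1].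
Qed.

(** The coordinates of a form of degree at least [i + D] have degree at least
    [i], as the basis elements have degree at most [D]. *)
Lemma sub_params_pow i : Rge RG (i + D) `<=` ideal_pow J i%:Z.
Proof.
move=> r hr; have [s [_ -> _]] := gprojE gRG r.
apply: (@submod_sum R R^o _ _ _ _ _ (ideal_pow_ideal J _)) => t _.
have [->|nz] := eqVneq (gproj RG t r) 0.
  by apply: (@submod0 R R^o); apply: ideal_pow_ideal.
have it := RgeP hr nz; rewrite (pib (gproj RG t r)).
apply: (@submod_sum R R^o _ _ _ _ _ (ideal_pow_ideal J _)) => j _.
apply: poly_eval_ideal_pow => m; have := piD j (gproj_in gRG t r).
by move=> /homog_degP h /h; have := basis_deg_le j; lia.
Qed.

Lemma colon_sub i :
  Rge RG i `<=` ideal_colon (ideal_pow J i%:Z) (Rge RG D).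
Proof.
move=> x hx r hr; apply: sub_params_pow; rewrite addnC.
exact: Rge_mul.
Qed.

(** If [x] multiplies [Rge D] into the [i]-th power of the parameter ideal and
    [w] lies in degree [-a], then the pairing of [x_t w] with a form of degree
    [D] is supported in degree [t], while it is a part of the pairing of [w]
    with an element of order at least [i]; so it vanishes for [t < i].  As all
    basis elements have degree at most [D], this determines [x_t w]. *)
Lemma colon_kills i x w t : ideal_colon (ideal_pow J i%:Z) (Rge RG D) x ->
  WG (- a) w -> t < i%:Z -> (0 < d)%N -> gproj RG t x *: w = 0.
Proof.
move=> hx hw ti d0; have [[_ _ _ hdeg hnd] _] := hphi.
have hxw : WG (t - a) (gproj RG t x *: w) by apply: hgW.2 => //; apply: gproj_in.
have top r : RG D%:Z r -> forall m, phi (gproj RG t x *: w) r m = 0.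
  move=> hr m; apply/eqP/negPn/negP => nz.
  have em : (mdeg m)%:Z = t by rewrite (hdeg _ _ _ _ _ hxw hr nz) -eD; ring.
  move: nz; rewrite (pairing_scale hphi) => nz.
  have hxr : ideal_pow J i%:Z (x * r).
    by rewrite mulrC; apply: hx; apply: (Rge_homog hR) hr _.
  have : phi w (x * r) m != 0.
    apply: contra_neq nz => z.
    have -> : gproj RG t x * r = x * r - (x - gproj RG t x) * r.
      by rewrite mulrBl opprB addrC subrK.
    rewrite (pairingD hphi) z add0r.
    have [s [us ex _]] := gprojE gRG (x - gproj RG t x).
    rewrite -mulNr ex -sumrN mulr_suml (pairing_sum hphi) big1 // => l _.
    rewrite (gprojB gRG) (gproj_id gRG _ (gproj_in gRG t x)).
    case: (l =P t) => [->|lt]; first by rewrite subrr oppr0 mul0r (pairing0 hphi).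
    rewrite subr0; apply/eqP/negPn/negP => nz'.
    have hl : RG (l + D%:Z) (- gproj RG l x * r).
      by apply: sg_mul => //; apply: (gradedN gRG); apply: gproj_in.
    have := hdeg _ _ _ _ _ hw hl nz'.
    by rewrite em -eD; lia.
  by move/(pairing_order hphi hxr); move: em ti; lia.
apply: hnd hxw _; apply: pairing_basis => j.
apply: (pairing_power hphi (j := Ordinal d0) (l := (D - e j)%N)).
apply: top; have -> : D%:Z = 1 * (D - e j)%N%:Z + (e j)%:Z.
  by have := basis_deg_le j; lia.
by apply: sg_mul => //; apply: sg_exp.
Qed.

Lemma colon_pow i : (0 < d)%N -> faithful (submod_gen (WG (- a))) ->
  ideal_colon (ideal_pow J i%:Z) (Rge RG D) = Rge RG i.
Proof.
move=> d0 hA; apply/seteqP; split; last exact: colon_sub.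
move=> x hx t ti; apply: hA; apply: submod_gen_sub.
  apply/submodP; split=> [|c u v hu hv]; first exact: scaler0.
  by rewrite /= scalerDr hv addr0 scalerA mulrC -scalerA hu scaler0.
by move=> w hw; apply: (colon_kills hx).
Qed.

(** A form of degree [i - 1] that annihilates the lowest component of the
    canonical module is orthogonal to the dual basis elements of degree [- a],
    so its products with forms of degree at least [D] have no coordinates at
    basis elements of degree [D]; the other coordinates have degree at least
    [i]. *)
Lemma annihilator_colon i x : RG (i%:Z - 1) x ->
  (forall w, WG (- a) w -> x *: w = 0) ->
  ideal_colon (ideal_pow J i%:Z) (Rge RG D) x.
Proof.
move=> hx xw r hr; suff: ideal_pow J i%:Z (r * x) by [].
have [s [_ -> _]] := gprojE gRG r; rewrite mulr_suml.
apply: (@submod_sum R R^o _ _ _ _ _ (ideal_pow_ideal J _)) => t _.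
have [->|nz] := eqVneq (gproj RG t r) 0.
  by rewrite mul0r; apply: (@submod0 R R^o); apply: ideal_pow_ideal.
have Dt := RgeP hr nz; rewrite (pib (gproj RG t r * x)).
apply: (@submod_sum R R^o _ _ _ _ _ (ideal_pow_ideal J _)) => j _.
have [eDj|ne] := eqVneq (e j) D.
  have [w [hw ew]] := dual_basis j.
  have -> : pi j (gproj RG t r * x) = 0.
    apply/mpolyP => m; rewrite -ew mcoeff0 mulrC -(pairing_scale hphi) xw.
      exact: pairing0l hphi _ _.
    by have -> : - a = d%:Z - (e j)%:Z by rewrite eDj -eD; ring.
  by rewrite poly_eval0 mul0r; apply: (@submod0 R R^o); apply: ideal_pow_ideal.
apply: poly_eval_ideal_pow => m.
have /homog_degP h := piD j (sg_mul hR (gproj_in gRG t r) hx).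
by move/h; have := basis_deg_le j; move: ne Dt; lia.
Qed.

Lemma param_power_inj (j : 'I_d) l x : y j ^+ l * x = 0 -> x = 0.
Proof.
move=> h; apply: coords_eq0 => i.
apply: (mulXUn_eq0 (i := j) (l := l)).
by rewrite -coordM poly_evalXn poly_evalXU h coord0.
Qed.

(** A nonzero homogeneous annihilator of the lowest component, multiplied by a
    power of a parameter, has degree [i - 1] and contradicts the equality. *)
Lemma colon_faithful : (0 < d)%N ->
  exists i0 : nat, forall i, (i0 <= i)%N ->
    ideal_colon (ideal_pow J i%:Z) (Rge RG D) = Rge RG i ->
    faithful (submod_gen (WG (- a))).
Proof.
move=> d0; have [hA|/existsNP [x0 /not_implyP [hx0 x0n]]] :=
  pselect (faithful (submod_gen (WG (- a)))); first by exists 0%N.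
have [t nz] : exists t, gproj RG t x0 != 0.
  apply: contrapT => /forallNP h; apply: x0n; apply: (gproj_eq0 gRG) => t.
  by apply/eqP/negPn/negP; apply: h.
have xw w : WG (- a) w -> gproj RG t x0 *: w = 0.
  move=> hw; have := congr1 (gproj WG (t - a)) (hx0 w (sub_submod_gen hw)).
  rewrite (gproj0 hgW.1).
  have [s [us ex sx]] := gprojE gRG x0.
  rewrite {1}ex scaler_suml (gproj_bigsum hgW.1).
  have [ts|ts] := boolP (t \in s); last by rewrite sx // scale0r.
  rewrite (bigD1_seq t) //= big1 => [|l lt].
    rewrite addr0 (gproj_id hgW.1 _ (hgW.2 _ _ _ _ (gproj_in gRG t x0) hw)).
    by rewrite eqxx.
  rewrite (gproj_id hgW.1 _ (hgW.2 _ _ _ _ (gproj_in gRG l x0) hw)).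
  by rewrite (inj_eq (addIr _)) eq_sym (negbTE lt).
have t0 : 0 <= t by rewrite leNgt; apply: contra_neqN nz => /(gproj_neg hR x0).
exists (absz t).+1 => i ti hE; case/negP: nz; apply/eqP.
pose l := (i - 1 - absz t)%N; apply: (@param_power_inj (Ordinal d0) l).
have hl : RG (i%:Z - 1) (y (Ordinal d0) ^+ l * gproj RG t x0).
  have -> : i%:Z - 1 = 1 * l%:Z + t by move: t0 ti; rewrite /l; lia.
  by apply: sg_mul; [|apply: sg_exp|apply: gproj_in].
have : Rge RG i (y (Ordinal d0) ^+ l * gproj RG t x0).
  rewrite -hE; apply: annihilator_colon hl _ => w hw.
  by rewrite -scalerA xw // scaler0.
move/(_ (i%:Z - 1)); rewrite (gproj_id gRG _ hl) eqxx; apply.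
by lia.
Qed.

Lemma gproj_scale_low (x : R) i u r v : Rge RG i r ->
  (forall u', u' <= u - i%:Z -> x *: gproj WG u' v = 0) ->
  x *: gproj WG u (r *: v) = 0.
Proof.
move=> hr hv; have [s [_ -> _]] := gprojE gRG r.
rewrite scaler_suml (gproj_bigsum hgW.1) scaler_sumr big1 // => t _.
rewrite (gprojZ _ _ hgW (gproj_in gRG t r)) scalerA mulrC -scalerA.
have [->|nz] := eqVneq (gproj RG t r) 0; first by rewrite scale0r.
by rewrite hv ?scaler0 // lerD2l lerN2; exact: (RgeP hr nz).
Qed.

(** The component of degree [i - a] of [W] always lies in the colon submodule of
    [J^i W], hence in [Rge i W] by the two equalities; but in degree [i - a] the
    latter only involves the lowest component of [W]. An annihilator of the
    lowest component thus kills the component of degree [i - a], where a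
    multiple of each dual basis element by a power of a parameter occurs. *)
Lemma module_colon_faithful i : (0 < d)%N -> (D <= i)%N ->
  submod_colon (submod_mul (ideal_pow J i%:Z) [set: W]) (Rge RG D) =
    submod_mul (ideal_colon (ideal_pow J i%:Z) (Rge RG D)) [set: W] ->
  ideal_colon (ideal_pow J i%:Z) (Rge RG D) = Rge RG i ->
  faithful (submod_gen (WG (- a))).
Proof.
move=> d0 Di hcol hE x xA.
have xw u v : u <= - a -> x *: gproj WG u v = 0.
  rewrite le_eqVlt => /predU1P [->|ua].
    by apply: xA; exact: (sub_submod_gen (gproj_in hgW.1 (- a) v)).
  have [->|nz] := eqVneq (gproj WG u v) 0; first by rewrite scaler0.
  by have := amin (gproj_in hgW.1 u v) nz; rewrite leNgt ua.
have xi w : WG (i%:Z - a) w -> x *: w = 0.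
  move=> hw; have : submod_mul (Rge RG i) [set: W] w.
    rewrite -hE -hcol => r hr; have [s [_ -> _]] := gprojE gRG r.
    rewrite scaler_suml.
    apply: submod_sum => [|t _]; first exact: submod_mul_submod.
    have [->|nz] := eqVneq (gproj RG t r) 0.
      by rewrite scale0r; apply: submod0; apply: submod_mul_submod.
    have Dt := RgeP hr nz.
    have [v [P [hP ->]]] := dual_expansion (hgW.2 _ _ _ _ (gproj_in gRG t r) hw).
    apply: submod_sum => [|j _]; first exact: submod_mul_submod.
    apply: mem_submod_mul => //; rewrite -[poly_eval y _]mulr1.
    apply: poly_eval_ideal_pow => m; have /homog_degP h := hP j.
    by move/h; lia.
  have -> : x *: w = x *: gproj WG (i%:Z - a) w by rewrite (gproj_id hgW.1 _ hw) eqxx.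
  suff sub : submod_mul (Rge RG i) [set: W] `<=`
      [set w | forall u, u <= i%:Z - a -> x *: gproj WG u w = 0].
    by move=> /sub; apply.
  apply: submod_mul_sub => [|r v hr _ u ui].
    apply/submodP; split=> [u _|c w1 w2 h1 h2 u ui].
      by rewrite (gproj0 hgW.1) scaler0.
    rewrite (gprojD hgW.1) scalerDr h2 // addr0.
    by apply: (gproj_scale_low (Rge0 hR c)) => u' u'u; apply: h1; lia.
  by apply: (gproj_scale_low hr) => u' u'u; apply: xw; lia.
apply: coords_eq0 => j; have [w [hw ew]] := dual_basis j.
pose l := absz (i%:Z - a - d%:Z + (e j)%:Z); pose j0 := Ordinal d0.
have : x *: (y j0 ^+ l *: w) = 0.
  apply: xi; have -> : i%:Z - a = 1 * l%:Z + (d%:Z - (e j)%:Z) by rewrite /l; lia.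
  by apply: hgW.2 => //; apply: sg_exp.
rewrite scalerA => z; apply: (mulXUn_eq0 (i := j0) (l := l)).
rewrite -coordM poly_evalXn poly_evalXU; apply/mpolyP => m.
rewrite -ew mcoeff0 -[_ * x]mulr1 -(pairing_scale hphi) mulrC z.
exact: pairing0l hphi _ _.
Qed.

End Criterion.

Theorem corollary2p10 (k : fieldType) (R : comAlgType k) (RG : int -> set R)
    (d : nat) (W : lmodType R) (WG : int -> set W) (a : int) (y : 'I_d -> R)
    (hR : standard_graded RG) (hCM : cohen_macaulay R)
    (hdim : krull_dim R d) (hd : (1 <= d)%N)
    (hW : graded_canonical_module RG WG) (ha : is_a_invariant WG a)
    (hy : linear_sop RG y) :
  let m := irrelevant_ideal RG in
  let J := ideal_gen (range y) in
  let A := faithful (submod_gen (WG (- a))) in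
  let E (i : int) :=
    ideal_colon (ideal_pow J i) (ideal_pow m (a + d%:Z)) = ideal_pow m i in
  exists i0 : int,
    [<-> A;
         forall i : int, E i;
         exists i : int, i0 <= i /\ E i] /\
    (reduced R -> forall i : int, a + d%:Z <= i ->
       submod_colon (submod_mul (ideal_pow J i) [set: W])
                    (ideal_pow m (a + d%:Z)) =
       submod_mul (ideal_colon (ideal_pow J i) (ideal_pow m (a + d%:Z)))
                  [set: W] ->
       [<-> A;
            forall j : int, E j;
            exists j : int, i0 <= j /\ E j;
            E i]).
Proof.
move=> m J A E.
have [[w0 [hw0 w0n]] amin] := ha; have gW := hW.1; have [_ hy1 _] := hy.
have [phi hphi] : exists phi, duality_pairing RG WG y phi.
  by apply: canonical_pairing => //; exists (- a), w0.
have [q [b [e [pi [hb pib piL piD piE]]]]] := sop_free_basis hR hCM hy.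
have [D eD] : exists D : nat, a + d%:Z = D%:Z.
  have := basis_degree_le hphi piL piD piE amin (Ordinal (basis_nonempty pib)).
  by exists (absz (a + d%:Z)); lia.
have EE (i : nat) : E i%:Z =
    (ideal_colon (ideal_pow J i%:Z) (Rge RG D) = Rge RG i).
  by rewrite /E eD !(irrelevant_pow hR).
have AB : A -> forall i, E i.
  move=> hA [i|i]; last by apply/seteqP.
  by rewrite EE; apply: (colon_pow hR gW hy1 hphi hb pib piL piD piE amin eD).
have [i0 hi0] := colon_faithful hR gW hy1 hphi pib piL piD piE amin eD hd.
have CA : (exists i : int, i0%:Z <= i /\ E i) -> A.
  by case=> -[i|i] [ii] //; rewrite EE; apply: (hi0 i).
have BC : (forall i, E i) -> exists i : int, i0%:Z <= i /\ E i.
  by move=> h; exists i0%:Z.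
exists i0%:Z; split; first by tfae.
move=> _ i; rewrite eD; case: i => [i|//] Di.
rewrite (irrelevant_pow hR) => hcol; have DA : E i%:Z -> A.
  rewrite EE.
  exact: (module_colon_faithful hR gW hy1 hphi hb pib piL piD piE amin eD hd Di hcol).
by tfae; [exact: AB|exact: BC|move/CA/AB; apply|exact: DA].
Qed.
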